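(* Let $X$ be the Chamanara surface and let $h\in\mathcal{B}_{\mathbb{Z}/2\mathbb{Z}}$. Then $Y_h$ is a Jacob's ladder if and only if $h$ is either bi-eventually equal to $0$ and contains an even number of entries with value $1$, or bi-eventually equal to $1$ and contains an even number of entries with value $0$ (including the entry $h_0=0$). In all other cases, $Y_h$ is a Loch Ness monster.
   Context: Chamanara surface: take the open unit square $(0,1)^2$ and, for each $n\ge 1$, add open boundary segments and glue them by translations: the left segment $\{0\}\times(1-2^{1-n},1-2^{-n})$ is glued to the right segment $\{1\}\times(2^{-n},2^{1-n})$, giving a vertical segment $a_n$; the bottom segment $(1-2^{1-n},1-2^{-n})\times\{0\}$ is glued to the top segment $(2^{-n},2^{1-n})\times\{1\}$, giving a horizontal segment $b_n$. The result $X$ (endpoints of segments and corners not included) is a translation surface. Let $x$ be the midpoint of the square. For $i\ge1$ let $\alpha_i$ be the closed curve at $x$ that crosses $a_i$ once from left to right (leaving the square through the right side, re-entering through the left side) and $\beta_i$ the closed curve at $x$ that crosses $b_i$ once from top to bottom (leaving through the bottom side, re-entering through the top side), with no other intersections with the boundary of the square. The group $\pi_1(X,x)$ is free on all $\alpha_i,\beta_i$, $i\ge 1$. $\mathcal{B}_{\mathbb{Z}/2\mathbb{Z}}$ is the set of nonzero $(h_i)\in(\mathbb{Z}/2\mathbb{Z})^{\mathbb{Z}}$ with $h_0=0$. For such $h$, $Y_h\to X$ is the connected degree-$2$ cover corresponding to the kernel of the homomorphism $\pi_1(X,x)\to\mathbb{Z}/2\mathbb{Z}$ with $\alpha_i\mapsto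 h_i$, $\beta_i\mapsto h_{-i}$ ($i\ge1$). The vector $h$ is bi-eventually equal to $g$ if all but finitely many entries of $h$ are equal to $g$. A Loch Ness monster is a surface of infinite genus with exactly one end; a Jacob's ladder is a surface of infinite genus with exactly two ends, both accumulated by genus. *)

(* Defs.v *)
From HB Require Import structures.
From mathcomp Require Import all_boot all_order all_algebra.
From mathcomp Require Import all_classical all_reals all_analysis.
From Stdlib Require Import Relation_Operators.

Set Implicit Arguments.
Unset Strict Implicit.
Unset Printing Implicit Defensive.

Import Order.TTheory GRing.Theory Num.Theory numFieldNormedType.Exports.

Local Open Scope classical_set_scope.
Local Open Scope ring_scope.
Local Open Scope quotient_scope.
Local Open Scope card_scope.

Section paths.
Context {R : realType} {T : topologicalType}.
Implicit Types (x : T) (c d : R -> T).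

(* Paths are functions on R of which only the values on [0, 1] matter. *)
Definition is_loop x c : Prop :=
  [/\ {within `[0, 1], continuous c}, c 0 = x & c 1 = x].

Definition concat c d : R -> T :=
  fun t => if t <= 2^-1 then c (2 * t) else d (2 * t - 1).

Definition path_homotopic c d : Prop :=
  exists H : R * R -> T,
    [/\ {within `[0, 1] `*` `[0, 1], continuous H},
        forall s, `[0, 1]%classic s -> H (s, 0) = c s /\ H (s, 1) = d s &
        forall t, `[0, 1]%classic t -> H (0, t) = c 0 /\ H (1, t) = c 1].

(* A homomorphism from the fundamental group at x to an additive group G,
   seen as a function on loops that is invariant under homotopy. *)
Definition pi1_hom {G : zmodType} x (phi : (R -> T) -> G) : Prop :=
  (forall c d, is_loop x c -> is_loop x d -> path_homotopic c d ->
     phi c = phi d) /\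
  (forall c d, is_loop x c -> is_loop x d ->
     phi (concat c d) = phi c + phi d).

Definition simple_closed_curve c : Prop :=
  [/\ {within `[0, 1], continuous c}, c 0 = c 1 &
      forall s t, `[0, 1[%classic s -> `[0, 1[%classic t -> c s = c t -> s = t].

(* The genus is the largest number of pairwise disjoint simple closed curves
   that can be removed without disconnecting the surface; it is used for
   connected open subsets U of a surface. *)
Definition genus_ge (U : set T) (n : nat) : Prop :=
  exists c : 'I_n -> R -> T,
    [/\ forall i, simple_closed_curve (c i) /\ c i @` `[0, 1] `<=` U,
        trivIset [set: 'I_n] (fun i => c i @` `[0, 1]) &
        connected (U `\` \bigcup_i c i @` `[0, 1])].

Definition infinite_genus (U : set T) : Prop := forall n, genus_ge U n.

End paths.

Definition homeo_between {S T : topologicalType} (A : set S) (B : set T)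
    (f : S -> T) : Prop :=
  exists g : T -> S,
    [/\ {within A, continuous f}, {within B, continuous g},
        f @` A `<=` B /\ g @` B `<=` A,
        forall a, A a -> g (f a) = a & forall b, B b -> f (g b) = b].

Definition covering_map {Y X : topologicalType} (p : Y -> X) : Prop :=
  continuous p /\
  forall x, exists U : set X, exists sheets : set (set Y),
    [/\ open U /\ U x, forall V, sheets V -> open V, trivIset sheets id,
        p @^-1` U = \bigcup_(V in sheets) V &
        forall V, sheets V -> homeo_between V U p].

Section surfaces.
Variables (R : realType) (Y : topologicalType).

Definition is_surface : Prop :=
  [/\ connected [set: Y], hausdorff_space Y, @second_countable Y &
      forall y : Y, exists U : set Y, exists V : set (R * R), exists f,
        [/\ open U, U y, open V & homeo_between U V f]].

(* Freudenthal ends: coherent choices of a connected component of the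
   complement of each compact set. Noncompact sets are sent to set0 so that
   distinct functions are distinct ends. *)
Definition ends : set (set Y -> set Y) :=
  [set e | [/\ forall K, compact K ->
                 exists2 y, (~` K) y & e K = connected_component (~` K) y,
               forall K L, compact K -> compact L -> K `<=` L -> e L `<=` e K &
               forall K, ~ compact K -> e K = set0]].

Definition end_of_infinite_genus (e : set Y -> set Y) : Prop :=
  forall K, compact K -> infinite_genus (R := R) (e K).

Definition loch_ness_monster : Prop :=
  [/\ is_surface, infinite_genus (R := R) [set: Y] & ends #= `I_1].

Definition jacobs_ladder : Prop :=
  [/\ is_surface, infinite_genus (R := R) [set: Y], ends #= `I_2 &
      forall e, ends e -> end_of_infinite_genus e].

End surfaces.

Section chamanara.
Variable R : realType.

Definition open_square : set (R * R) := `]0, 1[ `*` `]0, 1[.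
Definition left_segment (n : nat) : set (R * R) :=
  [set 0] `*` `](1 - 2 ^- n.-1), (1 - 2 ^- n)[.
Definition right_segment (n : nat) : set (R * R) :=
  [set 1] `*` `](2 ^- n), (2 ^- n.-1)[.
Definition bottom_segment (n : nat) : set (R * R) :=
  `](1 - 2 ^- n.-1), (1 - 2 ^- n)[ `*` [set 0].
Definition top_segment (n : nat) : set (R * R) :=
  `](2 ^- n), (2 ^- n.-1)[ `*` [set 1].

Definition unglued : set (R * R) :=
  open_square `|` \bigcup_(n in [set n | (0 < n)%N])
    (left_segment n `|` right_segment n `|` bottom_segment n `|` top_segment n).

(* The gluing translations, mapping left to right and bottom to top. *)
Definition glue_a (n : nat) (z : R * R) : R * R :=
  (z.1 + 1, z.2 - (1 - 2 ^- n.-1) + 2 ^- n).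
Definition glue_b (n : nat) (z : R * R) : R * R :=
  (z.1 - (1 - 2 ^- n.-1) + 2 ^- n, z.2 + 1).

Definition glued (z w : unglued) : Prop :=
  exists2 n, (0 < n)%N &
    (left_segment n (set_val z) /\ set_val w = glue_a n (set_val z)) \/
    (bottom_segment n (set_val z) /\ set_val w = glue_b n (set_val z)).

Definition glued_eq : rel unglued :=
  fun z w => `[< clos_refl_sym_trans unglued glued z w >].

Lemma glued_eq_equiv : equiv_class_of glued_eq.
Proof.
split=> [z|z w|w z v].
- exact/asboolP/rst_refl.
- by apply/asboolP/asboolP => ?; exact: rst_sym.
- by move=> /asboolP zw /asboolP wv; apply/asboolP; exact: rst_trans wv.
Qed.

Canonical glued_equiv_rel := EquivRelPack glued_eq_equiv.

Definition chamanara : topologicalType :=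
  quotient_topology {eq_quot glued_equiv_rel}.

Definition square_center : R * R := (2^-1, 2^-1).

Lemma square_center_unglued : square_center \in unglued.
Proof.
rewrite inE; left; split => /=; rewrite in_itv /= invr_gt0 ltr0n /=;
  by rewrite invf_lt1 ?ltr0n // ltr1n.
Qed.

(* Meaningful on unglued only. *)
Definition to_chamanara (z : R * R) : chamanara :=
  \pi_{eq_quot glued_equiv_rel}
    (insubd (exist _ square_center square_center_unglued : unglued) z).

Definition midpoint : chamanara := to_chamanara square_center.

Definition line (z w : R * R) : R -> chamanara := fun t =>
  to_chamanara ((1 - t) * z.1 + t * w.1, (1 - t) * z.2 + t * w.2).

(* The curves run straight to the midpoint of the boundary segment that they
   cross, and straight back from the midpoint of the opposite segment. *)
Definition alpha (i : nat) : R -> chamanara :=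
  concat (line square_center (1, 3 / 2 * 2 ^- i))
         (line (0, 1 - 3 / 2 * 2 ^- i) square_center).

Definition beta (i : nat) : R -> chamanara :=
  concat (line square_center (1 - 3 / 2 * 2 ^- i, 0))
         (line (3 / 2 * 2 ^- i, 1) square_center).

(* p : Y -> chamanara is the cover Y_h: the loops of X whose class lies in the
   image of the fundamental group of Y are those in the kernel. *)
Definition is_cover_of (h : int -> 'Z_2) (Y : topologicalType)
    (p : Y -> chamanara) : Prop :=
  exists phi : (R -> chamanara) -> 'Z_2,
    [/\ pi1_hom midpoint phi,
        forall i : nat, (0 < i)%N ->
          phi (alpha i) = h i%:Z /\ phi (beta i) = h (- i%:Z),
        connected [set: Y],
        covering_map p /\ (forall x, p @^-1` [set x] #= `I_2) &
        exists2 y, p y = midpoint &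
          forall c, is_loop midpoint c ->
            (phi c = 0 <->
             exists2 d, is_loop y d & path_homotopic (p \o d) c)].

End chamanara.

Definition calB (h : int -> 'Z_2) : Prop := h 0 = 0 /\ exists i, h i != 0.

Definition bi_eventually_equal (h : int -> 'Z_2) (g : 'Z_2) : Prop :=
  finite_set [set i | h i != g].

Definition even_number_of_entries (h : int -> 'Z_2) (g : 'Z_2) : Prop :=
  exists n, [set i | h i = g] #= `I_(n.*2).

(* Main.v *)
(* The cover is two copies of the square glued along the segments a_n and b_n,
   with a change of sheet when h n, respectively h (- n), is 1. Small squares
   around the missing boundary points of the two sheets form the complements of
   a cofinal sequence of compact sets, so the ends are the classes of missing
   points that are linked by gluings at every scale. Every missing point is
   linked to the corner (0, 1) of one of the two sheets, and the corner (1, 0)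
   of a sheet s is linked to the corner (0, 1) of the sheets s + h n and
   s + h (- n) for every large n. Hence there are at most two ends, and only one
   unless almost all entries of h are equal to some g. In this case the missing
   points form a closed chain from (0, 1) along the a_n to (0, 0), along the b_n
   to (1, 0), and back to (0, 1); going around it changes the sheet by the parity
   of the number of entries other than g, which decides whether the two corners
   (0, 1) are linked.

   If h k = h l = h m, then two thin strips, along the right side of one sheet
   and along the left side of a sheet, glued along a_k, a_l and a_m, form a
   one-holed torus, and there is a simple closed curve that does not separate
   it. Such triples exist arbitrarily far out, near each end. *)

Require Import Defs.
From HB Require Import structures.
From mathcomp Require Import all_boot all_order all_algebra.
From mathcomp Require Import all_classical all_reals all_analysis.
From mathcomp Require Import lra ring zify.
From Stdlib Require Import Relation_Operators.

Set Implicit Arguments.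
Unset Strict Implicit.
Unset Printing Implicit Defensive.

Import Order.TTheory GRing.Theory Num.Theory numFieldNormedType.Exports.

Local Open Scope classical_set_scope.
Local Open Scope ring_scope.
Local Open Scope card_scope.

(** * Lifting homotopies to a covering space *)

(** The hypothesis on the cover only says which loops lift to closed loops. The square is
    star-shaped about its midpoint, so it lifts as a whole from each of the two points of the fibre.
    The lift of [alpha i] or [beta i] is then explicit: it goes out in one copy of the square and
    returns in the copy glued there, so it closes exactly when the sheet does not change. After
    [two_sheets_of_cover] only the predicate [two_sheets] is used. It is preserved by the half-turn
    of the square and by the reflection in the diagonal (which replaces [h i] by [h (- i)]), so most
    local statements need a proof on the right side only. The genus comes from order: [a_k], [a_l],
    [a_m] appear in opposite vertical orders on the left and right sides; with equal orders the two
    glued strips would be planar. When there are two ends, they are told apart by a colour in [Z_2]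
    of each missing point of each sheet, invariant under the gluings. Its consistency at the corners
    (0, 1) and (1, 0) is exactly the parity condition. *)

Lemma if_continuous_at (T Y : topologicalType) (b : T -> bool) (f g : T -> Y)
    (x : T) :
  {for x, continuous f} -> {for x, continuous g} -> f x = g x ->
  {for x, continuous (fun t => if b t then f t else g t)}.
Proof.
move=> cf cg fg A /= nA.
have {}nA : nbhs (f x) A by move: nA => /=; case: (b x); rewrite // -fg.
have nf : nbhs x (f @^-1` A) by exact: cf.
have ng : nbhs x (g @^-1` A) by apply: cg; rewrite -fg.
by apply: filterS2 nf ng => t ft gt /=; case: ifP.
Qed.

Lemma near_continuous_at (T Y : topologicalType) (f g : T -> Y) (x : T) :
  (\near x, f x = g x) -> {for x, continuous f} -> {for x, continuous g}.
Proof.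
move=> fg cf A /=; rewrite -(nbhs_singleton fg) => /cf.
rewrite /= !nbhs_simpl /= => nA; apply: filterS2 fg nA => t /= ->; exact: id.
Qed.

Lemma pair_continuous_at (T U V : topologicalType) (f : T -> U) (g : T -> V)
    (x : T) :
  continuous_at x f -> continuous_at x g ->
  continuous_at x (fun t => (f t, g t)).
Proof.
move=> cf cg; exact: (@cvg_pair _ _ _ (nbhs x) (nbhs (f x)) (nbhs (g x))).
Qed.

Lemma paste_continuous (R : realType) (Y : topologicalType) (f g : R -> Y)
    (a : R) : continuous f -> continuous g -> f a = g a ->
  continuous (fun t => if t <= a then f t else g t).
Proof.
move=> cf cg fg t; have [ta|ta|ta] := ltgtP t a.
- apply: near_continuous_at (cf t); have := lt_nbhsl ta.
  by apply: filterS => u /ltW ->.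
- apply: near_continuous_at (cg t); have := lt_nbhsr ta.
  by apply: filterS => u; rewrite leNgt => ->.
- apply: (@if_continuous_at R Y (fun t => t <= a)); [exact: cf|exact: cg|].
  by rewrite ta.
Qed.

(** Precomposing with [clamp 0 1] turns a path that is continuous within the unit interval into a
    continuous function on the whole line, the form in which lifting is proved. *)
Definition clamp (R : realType) (a b u : R) : R := Num.max a (Num.min u b).

Lemma clamp_itv (R : realType) (a b u : R) : a <= b -> a <= clamp a b u <= b.
Proof. by move=> ab; rewrite /clamp le_max lexx ge_max ab ge_min lexx orbT. Qed.

Lemma clamp_id (R : realType) (a b u : R) : a <= u <= b -> clamp a b u = u.
Proof. by move=> /andP[au ub]; rewrite /clamp min_l // max_r. Qed.

Lemma clamp_continuous (R : realType) (a b : R) : continuous (clamp a b).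
Proof.
move=> u; apply: (@continuous_max R R (cst a) (fun v => Num.min v b)).
  exact: cst_continuous.
apply: (@continuous_min R R id (cst b)); first exact: cvg_id.
exact: cst_continuous.
Qed.

Lemma comp_continuous_at (T U V : topologicalType) (f : T -> U) (g : U -> V)
    (x : T) :
  continuous_at x f -> continuous g -> continuous_at x (fun t => g (f t)).
Proof. by move=> cf cg; apply: continuous_comp => //; exact: cg. Qed.

Section continuity_rules.
Variables (R : realType) (T U V : topologicalType).
Implicit Types (x : T).

Lemma addr_continuous_at (f g : T -> R) x : continuous_at x f ->
  continuous_at x g -> continuous_at x (fun t => f t + g t).
Proof. exact: (@continuousD R R^o). Qed.

Lemma oppr_continuous_at (f : T -> R) x : continuous_at x f ->
  continuous_at x (fun t => - f t).
Proof. exact: (@continuousN R R^o). Qed.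

Lemma mulr_continuous_at (f g : T -> R) x : continuous_at x f ->
  continuous_at x g -> continuous_at x (fun t => f t * g t).
Proof. exact: (@continuousM R). Qed.

Lemma clamp_continuous_at a b (f : T -> R) x : continuous_at x f ->
  continuous_at x (fun t => clamp a b (f t)).
Proof.
by move=> cf; apply: (@continuous_comp _ _ _ f) => //; exact: clamp_continuous.
Qed.

Lemma fst_continuous_at (f : T -> U * V) x : continuous_at x f ->
  continuous_at x (fun t => (f t).1).
Proof. by move=> cf; apply: (@continuous_comp _ _ _ f fst) => //; exact: cvg_fst. Qed.

Lemma snd_continuous_at (f : T -> U * V) x : continuous_at x f ->
  continuous_at x (fun t => (f t).2).
Proof. by move=> cf; apply: (@continuous_comp _ _ _ f snd) => //; exact: cvg_snd. Qed.

End continuity_rules.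

Ltac continuity_at x :=
  lazymatch goal with
  | |- {for _, continuous ?f} => change (continuous_at x f); continuity_at x
  | |- continuous_at _ (fun=> ?c) => exact: cst_continuous
  | |- continuous_at _ (fun t => t) => exact: cvg_id
  | |- continuous_at _ (fun t => (@?f t, @?g t)) =>
      apply: (@pair_continuous_at _ _ _ _ _ x); continuity_at x
  | |- continuous_at _ (fun t => @?f t + @?g t) =>
      apply: addr_continuous_at; continuity_at x
  | |- continuous_at _ (fun t => @?f t * @?g t) =>
      apply: mulr_continuous_at; continuity_at x
  | |- continuous_at _ (fun t => - @?f t) =>
      apply: oppr_continuous_at; continuity_at x
  | |- continuous_at _ (fun t => clamp _ _ (@?f t)) =>
      apply: clamp_continuous_at; continuity_at x
  | |- continuous_at _ (fun t => fst (@?f t)) =>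
      apply: fst_continuous_at; continuity_at x
  | |- continuous_at _ (fun t => snd (@?f t)) =>
      apply: snd_continuous_at; continuity_at x
  | |- continuous_at _ ( *%R ?c) => exact: mulrl_continuous
  | |- continuous_at _ -%R => exact: oppr_continuous
  | |- continuous_at _ (clamp _ _) => exact: clamp_continuous
  | |- continuous_at _ fst => exact: cvg_fst
  | |- continuous_at _ snd => exact: cvg_snd
  | |- _ =>
    match goal with
    | H : continuous ?f |- _ => exact: H
    | H : continuous ?f |- _ =>
      apply: (@comp_continuous_at _ _ _ _ f x _ H); continuity_at x
    end
  end.
Ltac continuity := let x := fresh "x" in
  move=> x; lazymatch goal with
  | |- continuous_at ?y ?f =>
    let g := eval cbv beta in f in change (continuous_at y g); continuity_at x
  end.

Section lifting.
Context {Y X : topologicalType} (p : Y -> X) (cp : covering_map p).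

(** The set of agreement is open and closed: over an evenly covered set, the sheets through [f t]
    and [g t] are either equal, and then [p] is injective on them, or disjoint. *)
Lemma lift_unique (T : topologicalType) (f g : T -> Y) (t0 : T) :
  connected [set: T] -> continuous f -> continuous g ->
  (forall t, p (f t) = p (g t)) -> f t0 = g t0 -> f = g.
Proof.
move=> cT cf cg pfg fg0.
have sheetP t : exists V V' : set Y, [/\ open V, open V', V (f t), V' (g t) &
    (f t = g t -> forall a b, V a -> V' b -> p a = p b -> a = b) /\
    (f t <> g t -> V `&` V' = set0)].
  have [_ /(_ (p (f t)))[U [sh [[oU Uft] osh tsh pU hom]]]] := cp.
  have [V sV Vf] : (\bigcup_(V in sh) V) (f t) by rewrite -pU.
  have [V' sV' Vg] : (\bigcup_(V in sh) V) (g t) by rewrite -pU /= -pfg.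
  exists V, V'; split; [exact: osh|exact: osh|by []|by []|].
  have [e [_ _ _ eK _]] := hom _ sV.
  split=> [E a b Va V'b pab|nE].
    have VV' : V = V' by apply: (tsh _ _ sV sV'); exists (f t); split; rewrite // E.
    by rewrite -(eK _ Va) pab eK // VV'.
  apply: contra_notP nE => /eqP/set0P VV'.
  have {VV'}E : V = V' by exact: (tsh _ _ sV sV').
  by rewrite -(eK _ Vf) pfg eK // E.
have nearV t (V : set Y) (k : T -> Y) : continuous k -> open V -> V (k t) ->
    \near t, V (k t).
  by move=> ck oV Vt; apply: ck; exact: open_nbhs_nbhs.
suff E : [set t | f t = g t] = [set: T].
  by apply/funext => t; have : [set: T] t by []; rewrite -E.
apply: cT; first by exists t0.
- exists [set t | f t = g t]; rewrite ?setTI // openE => t /= E.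
  have [V [V' [oV oV' Vf Vg [inj _]]]] := sheetP t.
  apply: filterS2 (nearV t V f cf oV Vf) (nearV t V' g cg oV' Vg) => u Vu V'u.
  exact: inj.
- exists [set t | f t = g t]; rewrite ?setTI // -openC openE => t /= nE.
  have [V [V' [oV oV' Vf Vg [_ dis]]]] := sheetP t.
  apply: filterS2 (nearV t V f cf oV Vf) (nearV t V' g cg oV' Vg) => u Vu V'u E.
  have : (V `&` V') (f u) by split; rewrite // E.
  by rewrite dis.
Qed.

Context {R : realType}.

Lemma connected_realT : connected [set: R].
Proof. by apply/connected_intervalP => x y _ _ z _. Qed.

Section homotopy.
Context {T : topologicalType} (H : T * R -> X) (g0 : T -> Y).
Hypotheses (cH : continuous H) (cg0 : continuous g0).
Hypothesis H_neg : forall z u, u <= 0 -> H (z, u) = p (g0 z).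

(** The lift exists over a whole neighbourhood of [z0] and is frozen after time [t], so that it is
    defined on all of [N] times the line. *)
Let lifts_upto (z0 : T) (t : R) := exists (N : set T) (G : T * R -> Y),
  [/\ open N /\ N z0,
      forall z, N z -> G (z, 0) = g0 z,
      forall z u, N z -> p (G (z, u)) = H (z, Num.min u t) &
      forall z u, N z -> {for (z, u), continuous G}].

Let lifts_upto0 z0 : lifts_upto z0 0.
Proof.
exists setT, (g0 \o fst); split=> //=; first by split=> //; exact: openT.
  by move=> z u _; rewrite H_neg // ge_min lexx orbT.
by move=> z u _; apply: continuous_comp; [exact: cvg_fst|exact: cg0].
Qed.

(** One evenly covered neighbourhood of [H (z0, t0)] serves all times within [d] of [t0]; the lift
    is prolonged from [s] to [s'] by the inverse of [p] on the sheet that it has reached. *)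
Let lifts_upto_extend z0 t0 : exists2 d, 0 < d &
  forall s s', 0 <= s -> t0 - d < s -> s <= s' -> s' < t0 + d ->
    lifts_upto z0 s -> lifts_upto z0 s'.
Proof.
have [_ /(_ (H (z0, t0)))[U [sh [[oU UH] osh tsh pU hom]]]] := cp.
have : nbhs (z0, t0) (H @^-1` U) by apply: cH; exact: open_nbhs_nbhs.
case=> -[N1 B] /= [nN1 nB] NBU.
have /nbhs_ballP[d /= d0 dB] := nB.
exists d => // s s' s0 sd ss' s'd [N [G [[oN Nz0] G0 pG cG]]].
have HU z u : N1 z -> s <= u -> u <= s' -> U (H (z, u)).
  move=> N1z su us'; apply: (NBU (z, u)); split => //=; apply: dB => /=.
  by rewrite /ball /= ltr_norml; apply/andP; split; lra.
have N1z0 : N1 z0 by exact: nbhs_singleton nN1.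
have pGs z : N z -> p (G (z, s)) = H (z, s) by move=> Nz; rewrite pG // minxx.
have [V sV Vy] : (\bigcup_(V in sh) V) (G (z0, s)).
  by rewrite -pU /= pGs //; apply: HU.
have [e [_ ce [pV eV] eK pe]] := hom _ sV.
have oV := osh _ sV.
(* The neighbourhood of [z0] is cut down to the points whose lift at time [s] lies in the same sheet
   [V]. *)
have nV : nbhs z0 [set z | V (G (z, s))].
  have : {for z0, continuous (G \o (fun z => (z, s)))}.
    apply: continuous_comp; last exact: cG.
    by apply: pair_continuous_at; [exact: cvg_id|exact: cvg_cst].
  by move=> /(_ V); apply; exact: open_nbhs_nbhs.
exists (interior (N `&` N1 `&` [set z | V (G (z, s))])).
pose c := clamp s s'.
pose F2 (w : T * R) := e (H (w.1, c w.2)).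
exists (fun w => if w.2 <= s then G w else F2 w).
have intP z : (N `&` N1 `&` [set z | V (G (z, s))])° z ->
    [/\ N z, N1 z & V (G (z, s))] by move=> /interior_subset [[]].
split.
- split; first exact: open_interior.
  apply: filterI => //; apply: filterI => //.
  exact: open_nbhs_nbhs.
- by move=> z /intP[Nz _ _] /=; rewrite s0 G0.
- move=> z u /intP[Nz N1z Vz] /=; case: leP => us.
    by rewrite pG // !min_l // (le_trans us).
  have smin : s <= Num.min u s' by rewrite le_min (ltW us).
  rewrite /F2 /= /c /clamp max_r // pe //.
  by apply: HU; rewrite ?le_min ?ge_min ?(ltW us) ?lexx ?orbT.
- move=> z u /intP[Nz N1z Vz].
  have cF2 : {for (z, u), continuous F2}.
    apply: (@continuous_comp _ _ _ (fun w => H (w.1, c w.2)) e).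
      apply: (@continuous_comp _ _ _ (fun w : T * R => (w.1, c w.2)) H).
        apply: pair_continuous_at; first exact: cvg_fst.
        apply: (@continuous_comp _ _ _ snd c); [exact: cvg_snd|exact: clamp_continuous].
      exact: cH.
    have /andP[c1 c2] := clamp_itv u ss'.
    by move: ce; rewrite continuous_open_subspace //; apply; rewrite inE; exact: HU.
  have snd_near (A : set R) : nbhs u A -> nbhs (z, u) [set w | A w.2].
    have : {for (z, u), continuous (@snd T R)} by exact: cvg_snd.
    by move=> /(_ A).
  have [us|us|us] := ltgtP u s.
  + apply: near_continuous_at (cG z u Nz).
    have : nbhs (z, u) [set w | w.2 < s] by apply: (snd_near [set v | v < s]); exact: lt_nbhsl.
    by apply: filterS => w /= /ltW ->.
  + apply: near_continuous_at cF2.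
    have : nbhs (z, u) [set w | s < w.2] by apply: (snd_near [set v | s < v]); exact: lt_nbhsr.
    by apply: filterS => w /= ws; rewrite leNgt ws.
  + apply: if_continuous_at => //; first exact: cG.
    by rewrite /F2 /= us /c clamp_id ?lexx // -pGs // eK.
Qed.

(** At the supremum of the reachable times, [lifts_upto_extend] either reaches 1 or goes beyond the
    supremum. *)
Let lifts_upto1 z0 : lifts_upto z0 1.
Proof.
pose A := [set t | 0 <= t <= 1 /\ lifts_upto z0 t].
have A0 : A 0 by split; [rewrite lexx ler01|exact: lifts_upto0].
have hA : has_sup A by split; [exists 0|exists 1 => t [/andP[]]].
have s0 : 0 <= sup A by apply: ub_le_sup => //; exact: hA.2.
have s1 : sup A <= 1 by apply: ge_sup; [exists 0|move=> t [/andP[]]].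
have [d d0 dP] := lifts_upto_extend z0 (sup A).
have [t [/andP[t0 t1] At] td] := sup_adherent d0 hA.
have ts : t <= sup A by apply: ub_le_sup; [exact: hA.2|split=> //; rewrite t0 t1].
have [s1d|s1d] := ltP 1 (sup A + d); first exact: (dP t).
have hs : A (sup A + d / 2).
  by split; [apply/andP; split; lra|apply: (dP t) => //; lra].
by have := ub_le_sup hA.2 hs; lra.
Qed.

(** Local lifts around different points agree on each line over a fixed [z], by [lift_unique] on the
    line, so they glue over an arbitrary space [T]. *)
Lemma homotopy_lifting : exists G : T * R -> Y,
  [/\ continuous G, forall z, G (z, 0) = g0 z &
      forall z u, p (G (z, u)) = H (z, Num.min u 1)].
Proof.
have /choice[NG NGP] : forall z0, exists NG : set T * (T * R -> Y),
  [/\ open NG.1 /\ NG.1 z0,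
      forall z, NG.1 z -> NG.2 (z, 0) = g0 z,
      forall z u, NG.1 z -> p (NG.2 (z, u)) = H (z, Num.min u 1) &
      forall z u, NG.1 z -> {for (z, u), continuous NG.2}].
  by move=> z0; have [N [G NGP]] := lifts_upto1 z0; exists (N, G).
(* Each point uses the local lift chosen for itself; [GE] shows that near [z0] this is the single
   continuous lift chosen for [z0]. *)
pose G w := (NG w.1).2 w.
have GE z0 z u : (NG z0).1 z -> (NG z0).2 (z, u) = G (z, u).
  move=> Nz; have [[oN Nz0] G0 pG cG] := NGP z0.
  have [[oN' Nz'] G0' pG' cG'] := NGP z.
  have : (fun v => (NG z0).2 (z, v)) = (fun v => (NG z).2 (z, v)).
    apply: (@lift_unique _ _ _ 0); first exact: connected_realT.
    - move=> v; apply: (@continuous_comp _ _ _ (fun v => (z, v))).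
        by apply: pair_continuous_at; [exact: cvg_cst|exact: cvg_id].
      exact: cG.
    - move=> v; apply: (@continuous_comp _ _ _ (fun v => (z, v))).
        by apply: pair_continuous_at; [exact: cvg_cst|exact: cvg_id].
      exact: cG'.
    - by move=> v; rewrite pG // pG'.
    - by rewrite G0 // G0'.
  by move=> /(congr1 (fun f => f u)).
exists G; split=> [[z u]|z|z u].
- have [[oN Nz] _ _ cG] := NGP z.
  apply: near_continuous_at (cG z u Nz).
  have : nbhs (z, u) [set w | (NG z).1 w.1].
    have : {for (z, u), continuous (@fst T R)} by exact: cvg_fst.
    by move=> /(_ (NG z).1); apply; exact: open_nbhs_nbhs.
  by apply: filterS => -[w v] /= Nw; rewrite GE.
- by have [[_ Nz] G0 _ _] := NGP z; rewrite /G /= G0.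
- by have [[_ Nz] _ pG _] := NGP z; rewrite /G /= pG.
Qed.

End homotopy.
End lifting.

(** * The square and its gluings *)

Section square_geometry.
Variable R : realType.
Implicit Types (z w : R * R) (m n : nat).

Definition dy n : R := 2 ^- n.

Lemma dyS n : dy n = 2 * dy n.+1.
Proof. by rewrite /dy exprS invfM mulrA divff ?mul1r // pnatr_eq0. Qed.

Lemma dy_gt0 n : 0 < dy n.
Proof. by rewrite /dy invr_gt0 exprn_gt0. Qed.

Lemma dy0 : dy 0 = 1.
Proof. by rewrite /dy expr0 invr1. Qed.

Lemma dy_ltn m n : (m < n)%N -> 2 * dy n <= dy m.
Proof.
elim: n => // n IH; rewrite ltnS leq_eqVlt => /orP[/eqP ->|/IH h].
  by rewrite -dyS.
by have := dyS n; have := dy_gt0 n.+1; lra.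
Qed.

Lemma dy_leq m n : (m <= n)%N -> dy n <= dy m.
Proof.
rewrite leq_eqVlt => /orP[/eqP -> //|/dy_ltn]; have := dy_gt0 n; lra.
Qed.

Lemma dy_le1 n : dy n <= 1.
Proof. by rewrite -dy0 dy_leq. Qed.

Lemma dy_pred n : (0 < n)%N -> 2 ^- n.-1 = 2 * dy n :> R.
Proof. by case: n => // n _; rewrite -dyS. Qed.

Lemma dy_le_half n : (0 < n)%N -> 2 * dy n <= 1.
Proof. by move=> n0; rewrite -dy_pred // -/(dy n.-1) dy_le1. Qed.

Lemma dy_small (x : R) : 0 < x -> exists N, dy N < x.
Proof.
move=> x0; exists (Num.bound x^-1); rewrite /dy invf_plt ?posrE ?exprn_gt0 //.
apply: le_lt_trans (ler_norm _) _; rewrite ger0_norm ?invr_ge0 ?ltW //.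
apply: lt_trans (archi_boundP _) _; first by rewrite invr_ge0 ltW.
by rewrite -natrX ltr_nat ltn_expl.
Qed.

(* The boundary segments are {1} x ]dy n, 2 dy n[ and its images under the
   symmetries of the square. *)
Definition seg n (x : R) : bool := dy n < x < 2 * dy n.

Lemma seg_inj m n x : seg m x -> seg n x -> m = n.
Proof.
by rewrite /seg => hm hn; case: (ltngtP m n) => // /dy_ltn h; exfalso; lra.
Qed.

Lemma seg_bounds n x : (0 < n)%N -> seg n x -> 0 < x < 1.
Proof. by rewrite /seg => /dy_le_half; have := dy_gt0 n; lra. Qed.

Lemma seg_sym n x : seg n (3 * dy n - x) = seg n x.
Proof. by rewrite /seg; apply/idP/idP => h; lra. Qed.

Lemma open_squareP z : open_square z <-> (0 < z.1 < 1) && (0 < z.2 < 1).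
Proof.
rewrite /open_square /= !in_itv /=; split=> [[-> ->] //|/andP[] //].
Qed.

Lemma leftP n z : (0 < n)%N ->
  left_segment n z <-> z.1 = 0 /\ seg n (1 - z.2).
Proof.
move=> n0; rewrite /left_segment /seg /= in_itv /= dy_pred //.
by rewrite -/(dy n); split=> -[-> h]; split=> //; lra.
Qed.

Lemma rightP n z : (0 < n)%N ->
  right_segment n z <-> z.1 = 1 /\ seg n z.2.
Proof.
move=> n0; rewrite /right_segment /seg /= in_itv /= dy_pred //.
Qed.

Lemma bottomP n z : (0 < n)%N ->
  bottom_segment n z <-> z.2 = 0 /\ seg n (1 - z.1).
Proof.
move=> n0; rewrite /bottom_segment /seg /= in_itv /= dy_pred //.
by rewrite -/(dy n); split=> -[h h']; split=> //; lra.
Qed.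

Lemma topP n z : (0 < n)%N ->
  top_segment n z <-> z.2 = 1 /\ seg n z.1.
Proof.
move=> n0; rewrite /top_segment /seg /= in_itv /= dy_pred //.
by split=> -[].
Qed.

Lemma glue_aE n z : (0 < n)%N -> glue_a n z = (z.1 + 1, z.2 - 1 + 3 * dy n).
Proof.
by move=> n0; rewrite /glue_a dy_pred // -/(dy n); congr pair; lra.
Qed.

Lemma glue_bE n z : (0 < n)%N -> glue_b n z = (z.1 - 1 + 3 * dy n, z.2 + 1).
Proof.
by move=> n0; rewrite /glue_b dy_pred // -/(dy n); congr pair; lra.
Qed.

Lemma ungluedP z : unglued z <-> open_square z \/
  exists2 n, (0 < n)%N &
    [\/ z.1 = 0 /\ seg n (1 - z.2), z.1 = 1 /\ seg n z.2,
        z.2 = 0 /\ seg n (1 - z.1) | z.2 = 1 /\ seg n z.1].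
Proof.
split=> [[|[n /= n0]]|[|[n n0]]].
- by left.
- by move=> [[[/leftP|/rightP]|/bottomP]|/topP] h; right; exists n => //;
    [apply: Or41|apply: Or42|apply: Or43|apply: Or44]; apply: h.
- by left.
- move=> h; right; exists n => //; case: h => h.
  + by left; left; left; apply/leftP.
  + by left; left; right; apply/rightP.
  + by left; right; apply/bottomP.
  + by right; apply/topP.
Qed.

Lemma unglued_bounds z : unglued z -> (0 <= z.1 <= 1) && (0 <= z.2 <= 1).
Proof.
move=> /ungluedP[/open_squareP|[n n0 [[h /seg_bounds]|[h /seg_bounds]|
  [h /seg_bounds]|[h /seg_bounds]]]]; try (move=> /(_ n0)); lra.
Qed.

Lemma open_square_unglued z : open_square z -> unglued z.
Proof. by left. Qed.

(** Only the end [t = 1] can touch the boundary. This star shape is what makes the square liftable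
    and the boxes around missing points connected. *)
Lemma unglued_star c z (t : R) : open_square c -> unglued z -> 0 <= t < 1 ->
  open_square ((1 - t) * c.1 + t * z.1, (1 - t) * c.2 + t * z.2).
Proof.
move=> /open_squareP hc /unglued_bounds hz ht; apply/open_squareP => /=.
have key (a b : R) : 0 < a < 1 -> 0 <= b <= 1 ->
    0 < (1 - t) * a + t * b < 1.
  move=> ha hb; have h1 : 0 < (1 - t) * a by apply: mulr_gt0; lra.
  have h2 : 0 < (1 - t) * (1 - a) by apply: mulr_gt0; lra.
  have h3 : 0 <= t * b by apply: mulr_ge0; lra.
  have h4 : 0 <= t * (1 - b) by apply: mulr_ge0; lra.
  by lra.
by rewrite !key //; lra.
Qed.

Lemma center_open_square : open_square (square_center R).
Proof. by apply/open_squareP => /=; lra. Qed.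

Lemma seg_mid n : (0 < n)%N -> seg n (3 / 2 * dy n).
Proof. by move=> n0; rewrite /seg; have := dy_gt0 n; lra. Qed.

Lemma seg_exists (x : R) : 0 < x < 1 ->
  exists2 n, (0 < n)%N & (x = dy n) \/ seg n x.
Proof.
move=> /andP[x0 x1]; have [N hN] := dy_small x0.
have ex : exists n, dy n <= x by exists N; exact: ltW.
(* The least [n] with [dy n <= x] is not 0 since [x < 1], and minimality gives [x < dy n.-1]. *)
case: (ex_minnP ex) => -[|n]; first by rewrite dy0; lra.
move=> h hmin; exists n.+1 => //.
have : x < 2 * dy n.+1.
  rewrite -dyS ltNge; apply/negP => /hmin; by rewrite ltnn.
move: h; rewrite le_eqVlt => /orP[/eqP <-|h]; first by left.
by right; rewrite /seg h.
Qed.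

End square_geometry.

Arguments dy {R}.

Lemma continuous_within_comp (S T U : topologicalType) (A : set T)
    (g : S -> T) (f : T -> U) :
  {within A, continuous f} -> (forall s, A (g s)) -> continuous g ->
  continuous (f \o g).
Proof.
move=> /subspace_continuousP cf gA cg s.
apply: cvg_trans (cf _ (gA s)).
move=> B nB; have n1 : nbhs (g s) [set x | A x -> B (f x)] by exact: nB.
have : nbhs s [set t | A (g t) -> B (f (g t))] := cg s _ n1.
by apply: filterS => t /(_ (gA t)).
Qed.

Section two_sheets.
Variables (R : realType).
Implicit Types (z w : R * R) (s : 'Z_2) (h : int -> 'Z_2).

(** Nearness in the sup norm, written as four linear inequalities for [lra]. *)
Definition close (e : R) z w : bool :=
  [&& z.1 - e < w.1, w.1 < z.1 + e, z.2 - e < w.2 & w.2 < z.2 + e].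

Lemma nbhs_closeP z (A : set (R * R)) :
  nbhs z A <-> exists2 e, 0 < e & forall w, close e z w -> A w.
Proof.
split=> [/nbhs_ballP[e /= e0 eA]|[e e0 eA]].
  exists e => // w /and4P[h1 h2 h3 h4]; apply: eA; split => /=;
    by rewrite /ball /= ltr_norml; apply/andP; split; lra.
apply/nbhs_ballP; exists e => //= w [/=]; rewrite /ball /= !ltr_norml.
by move=> /andP[h1 h2] /andP[h3 h4]; apply: eA; rewrite /close; lra.
Qed.

Lemma close_refl e z : 0 < e -> close e z z.
Proof. by rewrite /close; lra. Qed.

Lemma open_close e z : open (close e z : set (R * R)).
Proof.
rewrite openE => w /= cw; apply/nbhs_closeP.
exists (Num.min (Num.min (w.1 - (z.1 - e)) (z.1 + e - w.1))
                (Num.min (w.2 - (z.2 - e)) (z.2 + e - w.2))).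
  by move: cw; rewrite !lt_min /close; lra.
move=> v; move: cw; rewrite /close.
move=> /and4P[h1 h2 h3 h4] /and4P[].
rewrite !ltrBlDr -!ltrBlDl !lt_min => /andP[/andP[k1 k2] /andP[k3 k4]].
move=> /andP[/andP[l1 l2] /andP[l3 l4]].
move=> /andP[/andP[m1 m2] /andP[m3 m4]].
by move=> /andP[/andP[n1 n2] /andP[n3 n4]]; lra.
Qed.

Definition glue_rel h s z s' z' : Prop :=
  exists2 n, (0 < n)%N &
    (left_segment n z /\ z' = glue_a n z /\ s' = s + h n%:Z) \/
    (bottom_segment n z /\ z' = glue_b n z /\ s' = s + h (- n%:Z)).

(** Since gluings do not chain, the identity, one gluing and one inverse gluing already exhaust the
    equivalence relation. *)
Definition cross h s z s' z' : Prop :=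
  [\/ s = s' /\ z = z', glue_rel h s z s' z' | glue_rel h s' z' s z].

(* Y is two copies of the square glued along the segments, crossing a_n (b_n)
   changing the sheet by h n (h (- n)). *)
Definition two_sheets h (Y : topologicalType) (q : 'Z_2 -> R * R -> Y) : Prop :=
  [/\ forall y, exists s z, unglued z /\ q s z = y,
      forall s z s' z', unglued z -> unglued z' ->
        (q s z = q s' z' <-> cross h s z s' z') &
      forall V : set Y, open V <-> forall s z, unglued z -> V (q s z) ->
        exists2 e, 0 < e & forall w, unglued w -> close e z w -> V (q s w)].

Lemma Z2_case (s : 'Z_2) : s = 0 \/ s = 1.
Proof. by case: s => [[|[|[]]]] // ?; [left|right]; apply/val_inj. Qed.

Lemma Z2_addss (s : 'Z_2) : s + s = 0.
Proof. by have [->|->] := Z2_case s; apply/val_inj. Qed.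

Lemma Z2_addK (s t : 'Z_2) : s + t + t = s.
Proof. by rewrite -addrA Z2_addss addr0. Qed.

Lemma left_glue_a n z : (0 < n)%N -> left_segment n z ->
  right_segment n (glue_a n z).
Proof.
move=> n0 /(leftP _ n0)[h1 h2]; apply/(rightP _ n0); rewrite glue_aE //=.
by split; [rewrite h1 add0r|rewrite -seg_sym; move: h2; congr (is_true (seg _ _)); lra].
Qed.

Lemma bottom_glue_b n z : (0 < n)%N -> bottom_segment n z ->
  top_segment n (glue_b n z).
Proof.
move=> n0 /(bottomP _ n0)[h1 h2]; apply/(topP _ n0); rewrite glue_bE //=.
by split; [rewrite h1 add0r|rewrite -seg_sym; move: h2; congr (is_true (seg _ _)); lra].
Qed.

Lemma unglued_seg n z : (0 < n)%N -> left_segment n z \/ right_segment n z \/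
  bottom_segment n z \/ top_segment n z -> unglued z.
Proof.
by move=> n0 h; right; exists n => //; case: h => [|[|[|]]] h;
  [left; left; left|left; left; right|left; right|right].
Qed.

(* A gluing starts on the left or bottom side and ends on the right or top
   side, so gluings do not chain. *)
Lemma glued_eqP (z w : @unglued R) : glued_eq z w ->
  [\/ z = w, glued z w | glued w z].
Proof.
have source (u v : @unglued R) : glued u v -> exists2 n, (0 < n)%N &
    ((set_val u).1 = 0 /\ seg n (1 - (set_val u).2)) \/
    ((set_val u).2 = 0 /\ seg n (1 - (set_val u).1)).
  move=> [n n0 [[/(leftP _ n0) h _]|[/(bottomP _ n0) h _]]]; exists n => //.
    by left.
  by right.
have target (u v : @unglued R) : glued u v -> exists2 n, (0 < n)%N &
    ((set_val v).1 = 1 /\ seg n ((set_val v).2)) \/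
    ((set_val v).2 = 1 /\ seg n ((set_val v).1)).
  move=> [n n0 [[/(left_glue_a n0) h e]|[/(bottom_glue_b n0) h e]]]; exists n => //.
    by left; rewrite e; apply/rightP.
  by right; rewrite e; apply/topP.
have nochain (u v t : @unglued R) : glued u v -> glued v t -> False.
  move=> /target[n n0 h] /source[m m0 h'].
  case: h => -[e /(seg_bounds n0) b]; case: h' => -[e' /(seg_bounds m0) b'];
    rewrite e in b b' e'; lra.
have vinj : injective (set_val : @unglued R -> _) by exact: val_inj.
have funl (u v t : @unglued R) : glued u v -> glued u t -> v = t.
  move=> [n n0 h] [m m0 h']; apply: vinj.
  case: h => -[sn ->]; case: h' => -[sm ->].
  - move: sn sm => /(leftP _ n0)[_ h] /(leftP _ m0)[_ h'].
    by rewrite (seg_inj h h').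
  - move: sn sm => /(leftP _ n0)[e h] /(bottomP _ m0)[_ /(seg_bounds m0) ?]; exfalso; lra.
  - move: sn sm => /(bottomP _ n0)[e h] /(leftP _ m0)[_ /(seg_bounds m0) ?]; exfalso; lra.
  - move: sn sm => /(bottomP _ n0)[_ h] /(bottomP _ m0)[_ h'].
    by rewrite (seg_inj h h').
have funr (u v t : @unglued R) : glued u t -> glued v t -> u = v.
  move=> [n n0 h] [m m0 h']; apply: vinj.
  case: h => -[sn e]; case: h' => -[sm e']; rewrite e in e'.
  - have /(rightP _ n0)[_ h1] := left_glue_a n0 sn.
    have /(rightP _ m0)[_] := left_glue_a m0 sm; rewrite -e' => h2.
    have nm := seg_inj h1 h2; move: e'; rewrite nm !glue_aE // => -[??].
    by apply/pair_eqP; rewrite /pair_eq; apply/andP; split; apply/eqP; lra.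
  - have /(rightP _ n0)[h1 _] := left_glue_a n0 sn.
    have /(topP _ m0)[_ /(seg_bounds m0) b] := bottom_glue_b m0 sm.
    by exfalso; move: b; rewrite -e' h1; lra.
  - have /(topP _ n0)[_ /(seg_bounds n0) b] := bottom_glue_b n0 sn.
    have /(rightP _ m0)[h1 _] := left_glue_a m0 sm.
    by exfalso; move: b; rewrite e' h1; lra.
  - have /(topP _ n0)[_ h1] := bottom_glue_b n0 sn.
    have /(topP _ m0)[_] := bottom_glue_b m0 sm; rewrite -e' => h2.
    have nm := seg_inj h1 h2; move: e'; rewrite nm !glue_bE // => -[??].
    by apply/pair_eqP; rewrite /pair_eq; apply/andP; split; apply/eqP; lra.
move=> /asboolP; elim=> {z w} [z w|z|z w _ [->|zw|wz]|z w v _ IH1 _ IH2].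
- by move=> zw; apply: Or32.
- exact: Or31.
- exact: Or31.
- exact: Or33.
- exact: Or32.
- case: IH1 => [->//|zw|wz]; case: IH2 => [<-|wv|vw].
  + exact: Or32.
  + by have := nochain _ _ _ zw wv.
  + by apply: Or31; apply: funr zw vw.
  + exact: Or33.
  + by apply: Or31; apply: funl wz wv.
  + by have := nochain _ _ _ vw wz.
Qed.

End two_sheets.

(** * The double cover as two glued squares *)

Lemma card2P (T : Type) (A : set T) (a : T) : A #= `I_2 -> A a ->
  exists b, b <> a /\ A = [set a; b].
Proof.
move=> /eq_cardSP[x Ax /eq_cardSP[y [Ay yx]]]; rewrite II0 card_eq0 => /eqP e.
have AE z : A z -> z = x \/ z = y.
  move=> Az; apply: contrapT => /not_orP[zx zy].
  by have : (A `\ x `\ y) z by []; rewrite e.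
move=> /[dup] Aa /AE[->|->]; [exists y|exists x]; split=> //.
- by apply/seteqP; split=> [z /AE//|z [->|->]].
- exact/nesym.
- by apply/seteqP; split=> [z /AE[]|z [->|->]] //; [right|left].
Qed.

Section model.
Variables (R : realType) (h : int -> 'Z_2) (Y : topologicalType)
  (p : Y -> chamanara R).
Local Notation T := (@unglued R).
Local Notation X := (chamanara R).

Let center : T := exist _ (square_center R) (square_center_unglued R).
Let mkT (z : R * R) : T := insubd center z.
Let pr (z : T) : X := \pi_{eq_quot (glued_equiv_rel R)}%qT z.

Let mkTK z : unglued z -> set_val (mkT z) = z.
Proof. by move=> uz; rewrite /mkT set_valE insubdK // inE. Qed.

Let valT (z : T) : unglued (set_val z).
Proof. by rewrite set_valE; apply: set_mem; exact: valP. Qed.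

Let mkT_val (z : T) : mkT (set_val z) = z.
Proof. by apply: val_inj; exact: mkTK (valT z). Qed.

Let pr_continuous : continuous pr.
Proof. exact: pi_continuous. Qed.

Let open_T (A : set T) : open A <-> forall z, A z ->
  exists2 e, 0 < e & forall w : T, close e (set_val z) (set_val w) -> A w.
Proof.
split=> [[W oW <-] z /= Wz|hA].
  have : nbhs (set_val z) W by exact: open_nbhs_nbhs.
  by move=> /nbhs_closeP[e e0 eW]; exists e => // w /eW.
pose P (ze : T * R) := forall w : T, close ze.2 (set_val ze.1) (set_val w) -> A w.
exists (\bigcup_(ze in P) (close ze.2 (set_val ze.1) : set (R * R))).
  by apply: bigcup_open => ze _; exact: open_close.
apply/seteqP; split=> [w [ze Pze /= /Pze//]|w Aw].
have [e e0 eA] := hA _ Aw.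
by exists (w, e) => //=; exact: close_refl.
Qed.

Let continuous_T (S : topologicalType) (f : T -> S) : continuous f ->
  forall (V : set S) z, open V -> V (f z) ->
  exists2 e, 0 < e & forall w : T, close e (set_val z) (set_val w) -> V (f w).
Proof.
by move=> /continuousP cf V z /cf /open_T oV; exact: oV.
Qed.

Let continuous_mkT (S : topologicalType) (g : S -> R * R) :
  continuous g -> (forall s, unglued (g s)) -> continuous (mkT \o g).
Proof.
move=> cg ug; apply: continuous_comp_initial.
rewrite (_ : set_val \o _ = g) //.
by apply/funext => s /=; rewrite mkTK.
Qed.

(** The contraction of the square to its midpoint; lifting this homotopy lifts the square. *)
Let radial (w : T * R) : R * R :=
  let t := clamp 0 1 w.2 in
  ((1 - t) * (square_center R).1 + t * (set_val w.1).1,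
   (1 - t) * (square_center R).2 + t * (set_val w.1).2).

Let set_val_continuous : continuous (set_val : T -> R * R).
Proof. exact: initial_continuous. Qed.

Let unglued_radial w : unglued (radial w).
Proof.
have := clamp_itv w.2 (@ler01 R); rewrite /radial.
set t := clamp _ _ _ => t01.
have [t1|t1] := eqVneq t 1.
  rewrite t1 subrr !mul0r !add0r !mul1r.
  by have := valT w.1; case: (set_val w.1).
apply: open_square_unglued; apply: unglued_star.
- exact: center_open_square.
- exact: valT.
- by move: t1; rewrite neq_lt; lra.
Qed.

Let radial_continuous : continuous radial.
Proof.
have c := set_val_continuous.
rewrite /radial; continuity.
Qed.

Let midpointE : midpoint R = pr center.
Proof.
rewrite /midpoint /to_chamanara -/(mkT _).
by rewrite -[square_center R]/(set_val center) mkT_val.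
Qed.

Hypothesis cp : covering_map p.

Let path_lift_unique (f g : R -> Y) : continuous f -> continuous g ->
  (forall t, p (f t) = p (g t)) -> (exists t, f t = g t) -> f =1 g.
Proof.
move=> cf cg pfg [t ft] u.
by rewrite (lift_unique cp (@connected_realT R) cf cg pfg ft).
Qed.

(** The contraction is lifted from the constant map [y0], and its value at time 1 is the section. *)
Lemma sheet_lift y0 : p y0 = midpoint R -> exists f : T -> Y,
  [/\ continuous f, f center = y0 & forall z, p (f z) = pr z].
Proof.
move=> py0; pose H w := pr (mkT (radial w)).
have cH : continuous H.
  move=> w; apply: (@continuous_comp _ _ _ (mkT \o radial) pr w).
    exact: (continuous_mkT radial_continuous unglued_radial).
  exact: pr_continuous.
have rc u : radial (center, u) = square_center R.
  by rewrite /radial set_valE /=; congr pair; lra.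
have H0 z u : u <= 0 -> H (z, u) = p y0.
  move=> u0; rewrite py0 midpointE /H; congr pr; rewrite -[RHS]mkT_val; congr mkT.
  rewrite /radial /= /clamp min_l ?max_l ?subr0 ?mul0r ?addr0 ?mul1r //.
  exact: le_trans u0 _.
have [G [cG G0 pG]] := homotopy_lifting cp cH (@cst_continuous _ _ y0) H0.
exists (fun z => G (z, 1)); split.
- move=> z; apply: (@continuous_comp _ _ _ (fun z => (z, 1 : R)) G); last exact: cG.
  by apply: pair_continuous_at; [exact: cvg_id|exact: cst_continuous].
- have GE : (fun u => G (center, u)) =1 cst y0; last exact: GE 1.
  apply: path_lift_unique.
  + move=> u; apply: (@continuous_comp _ _ _ (fun u => (center, u)) G); last exact: cG.
    by apply: pair_continuous_at; [exact: cst_continuous|exact: cvg_id].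
  + exact: cst_continuous.
  + by move=> t; rewrite pG /H rc py0.
  + by exists 0; rewrite G0.
- move=> z; rewrite pG minxx /H -[in RHS](mkT_val z); congr (pr (mkT _)).
  rewrite /radial /= clamp_id ?lexx ?ler01 // subrr !mul0r !add0r !mul1r.
  by case: (set_val z).
Qed.

(** If the lift [d] closes, it is itself the required loop. Conversely a homotopy from [p \o d'] to
    [c] is lifted from [d']; its vertical sides lie over the base point, hence are constant, and its
    top is [d]. *)
Let closed_lift (y : Y) (c : R -> X) (d : R -> Y) :
  is_loop (midpoint R) c -> {within `[0, 1], continuous d} -> d 0 = y ->
  (forall t, `[0, 1]%classic t -> p (d t) = c t) ->
  d 1 = y <-> exists2 d', is_loop y d' & path_homotopic (p \o d') c.
Proof.
have I0 : `[0, 1]%classic (0 : R) by rewrite /= in_itv /= lexx ler01.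
have I1 : `[0, 1]%classic (1 : R) by rewrite /= in_itv /= lexx ler01.
have Ic t : `[0, 1]%classic (clamp 0 1 t : R).
  by rewrite /= in_itv /=; exact: clamp_itv ler01.
have c0 : clamp 0 1 0 = 0 :> R by rewrite clamp_id // lexx ler01.
have c1 : clamp 0 1 1 = 1 :> R by rewrite clamp_id // lexx ler01.
move=> [cc cc0 cc1] cd d0 pd; split=> [d1|[d' [cd' d'0 d'1] [H [cH Hs Ht]]]].
  exists d; first by split.
  exists (c \o fst); split=> /=.
  - apply/subspace_continuousP => -[s t] [/= Is It].
    move/subspace_continuousP: cc => /(_ _ Is) cs B nB.
    have n1 : nbhs s [set x | `[0, 1]%classic x -> B (c x)] := cs _ nB.
    have n2 : nbhs (s, t) [set w | `[0, 1]%classic w.1 -> B (c w.1)].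
      have : {for (s, t), continuous (@fst R R)} by exact: cvg_fst.
      by move=> /(_ _ n1).
    suff : nbhs (s, t) [set w | (`[0, 1]%classic `*` `[0, 1]%classic) w -> B (c w.1)].
      by [].
    by move: n2; apply: filterS => w nw -[w1 _]; exact: nw.
  - by move=> s Is; rewrite pd.
  - by move=> t It; rewrite !pd //= cc0 cc1.
(* The homotopy on the unit square, extended to the plane. *)
pose K (w : R * R) := H (clamp 0 1 w.1, clamp 0 1 w.2).
have cK : continuous K.
  apply: (continuous_within_comp cH) => [s|].
    by split => /=; exact: Ic.
  by continuity.
have cdc : continuous (d \o clamp 0 1).
  by apply: (continuous_within_comp cd) => //; exact: clamp_continuous.
have cdc' : continuous (d' \o clamp 0 1).
  by apply: (continuous_within_comp cd') => //; exact: clamp_continuous.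
have K0 s t : t <= 0 -> K (s, t) = p ((d' \o clamp 0 1) s).
  move=> t0; have -> : K (s, t) = H (clamp 0 1 s, 0).
    by rewrite /K /=; congr (H (_, _)); rewrite /clamp min_l ?max_l ?(le_trans t0).
  by have [-> _] := Hs _ (Ic s).
have [G [cG G0 pG]] := homotopy_lifting cp cK cdc' K0.
have pGK s t : p (G (s, t)) = K (s, t).
  by rewrite pG /K /= {2}/clamp -minA minxx.
have cGl s : continuous (fun t => G (s, t)).
  move=> t; apply: (@continuous_comp _ _ _ (fun t => (s, t)) G); last exact: cG.
  by apply: pair_continuous_at; [exact: cst_continuous|exact: cvg_id].
have cGr t : continuous (fun s => G (s, t)).
  move=> s; apply: (@continuous_comp _ _ _ (fun s => (s, t)) G); last exact: cG.
  by apply: pair_continuous_at; [exact: cvg_id|exact: cst_continuous].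
have Gl : (fun t => G (0, t)) =1 cst y.
  apply: (path_lift_unique (cGl 0) (@cst_continuous _ _ y)).
    by move=> u; rewrite pGK /K /= c0; have [-> _] := Ht _ (Ic u); rewrite /= d'0.
  by exists 0; rewrite G0 /= c0.
have Gr : (fun t => G (1, t)) =1 cst y.
  apply: (path_lift_unique (cGl 1) (@cst_continuous _ _ y)).
    by move=> u; rewrite pGK /K /= c1; have [_ ->] := Ht _ (Ic u); rewrite /= d'1.
  by exists 0; rewrite G0 /= c1.
(* The top of the lifted homotopy and [d] both lift [c] from [y]; the endpoint of the former is [y]
   by [Gr]. *)
have GE : (fun s => G (s, 1)) =1 d \o clamp 0 1.
  apply: (path_lift_unique (cGr 1) cdc).
    move=> u; rewrite pGK /K /= c1 pd //.
    by have [_ ->] := Hs _ (Ic u).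
  by exists 0; rewrite Gl /= c0.
by have := GE 1; rewrite /= c1 Gr.
Qed.

Section sheets.
Variables (phi : (R -> X) -> 'Z_2) (y0 : Y).
Hypotheses
  (phi_ab : forall i : nat, (0 < i)%N ->
     phi (@alpha R i) = h i%:Z /\ phi (@beta R i) = h (- i%:Z))
  (fiber2 : forall x, p @^-1` [set x] #= `I_2)
  (py0 : p y0 = midpoint R)
  (phiP : forall c, is_loop (midpoint R) c ->
     (phi c = 0 <-> exists2 d, is_loop y0 d & path_homotopic (p \o d) c)).

Variables (y1 : Y) (f : 'Z_2 -> T -> Y).
Hypotheses (y10 : y1 <> y0)
  (cf : forall s, continuous (f s))
  (f0c : f 0 center = y0) (f1c : f 1 center = y1)
  (pf : forall s z, p (f s z) = pr z).

Let arm s w u := f s (mkT (radial (w, u))).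

Let arm_continuous s w : continuous (arm s w).
Proof.
move=> u; apply: (@continuous_comp _ _ _ (mkT \o (fun u => radial (w, u))) (f s) u).
  apply: continuous_mkT => [v|v]; last exact: unglued_radial.
  apply: (@continuous_comp _ _ _ (fun u => (w, u)) radial).
    by apply: pair_continuous_at; [exact: cst_continuous|exact: cvg_id].
  exact: radial_continuous.
exact: cf.
Qed.

Let arm0 s w : arm s w 0 = f s center.
Proof.
rewrite /arm -[in RHS](mkT_val center); congr (f s (mkT _)).
rewrite /radial /= clamp_id ?lexx ?ler01 // subr0 !mul0r !addr0 !mul1r.
by [].
Qed.

Let arm1 s w : arm s w 1 = f s w.
Proof.
rewrite /arm -[in RHS](mkT_val w); congr (f s (mkT _)).
rewrite /radial /= clamp_id ?lexx ?ler01 // subrr !mul0r !add0r !mul1r.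
by case: (set_val w).
Qed.

(** If the two copies met at [z], the lifted radii from the centre to [z] would agree throughout,
    including at [y0] and [y1]. *)
Let f01 z : f 0 z <> f 1 z.
Proof.
move=> e; apply: y10; rewrite -f0c -f1c -!(arm0 _ z).
apply/esym; apply: path_lift_unique; [exact: arm_continuous|exact: arm_continuous| |].
  by move=> t; rewrite !pf.
by exists 1; rewrite !arm1.
Qed.

Let f_inj s s' z : f s z = f s' z -> s = s'.
Proof.
have [->|->] := Z2_case s; have [->|->] := Z2_case s' => //.
  by move=> /f01.
by move=> /esym/f01.
Qed.

Let fiberP y z : p y = pr z -> exists s, y = f s z.
Proof.
move=> py; have [b [b0 fE]] := card2P (fiber2 (pr z)) (pf 0 z).
have : (p @^-1` [set pr z]) (f 1 z) by exact: pf.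
rewrite fE => -[/esym/f01//|/= f1b].
have : (p @^-1` [set pr z]) y by [].
by rewrite fE => -[->|->]; [exists 0|exists 1].
Qed.

(** A fibre has only two points, so the change of sheet seen from the sheet 0 determines the one
    seen from the sheet 1. *)
Let other_sheet z w k : pr z = pr w -> f 0 w = f k z ->
  forall s, f s z = f (s + k) w.
Proof.
move=> zw fk; have {}fk s : f s w = f (s + k) z.
  have [->|->] := Z2_case s; first by rewrite add0r.
  have [c fc] : exists c, f 1 w = f c z by apply: fiberP; rewrite pf zw.
  rewrite fc; congr f; have ck : c <> k.
    by move=> ck; apply: (@f01 w); rewrite fk fc ck.
  move: ck; have [->|->] := Z2_case c; have [->|->] := Z2_case k => // _;
    exact/val_inj.
by move=> s; rewrite fk Z2_addK.
Qed.

Let propagate s s' (zt wt : R -> R * R) : continuous zt -> continuous wt ->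
  (forall t, unglued (zt t)) -> (forall t, unglued (wt t)) ->
  (forall t, pr (mkT (zt t)) = pr (mkT (wt t))) ->
  f s (mkT (wt 0)) = f s' (mkT (zt 0)) -> f s (mkT (wt 1)) = f s' (mkT (zt 1)).
Proof.
move=> cz cw uz uw zw e.
have cc k (g : R -> R * R) : continuous g -> (forall t, unglued (g t)) ->
    continuous (fun t => f k (mkT (g t))).
  move=> cg ug t; apply: (@continuous_comp _ _ _ (mkT \o g) (f k)).
    exact: continuous_mkT.
  exact: cf.
have := path_lift_unique (cc s wt cw uw) (cc s' zt cz uz); apply.
  by move=> t; rewrite !pf zw.
by exists 0.
Qed.

(** The loop through the glued points [wm] and [zm] lifts to the radius to [wm] in the sheet 0
    followed by the radius back from [zm] in some sheet [j]. It closes exactly when [j = 0]. *)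
Let cross_mid zm wm k : unglued zm -> unglued wm ->
  pr (mkT zm) = pr (mkT wm) ->
  phi (concat (line (square_center R) wm) (line zm (square_center R))) = k ->
  f 0 (mkT wm) = f k (mkT zm).
Proof.
move=> uz uw zw; set c := concat _ _ => phic.
have [j fj] : exists j, f 0 (mkT wm) = f j (mkT zm).
  by apply: fiberP; rewrite pf zw.
rewrite fj; congr f.
(* The lift of [c]; the two halves fit together at time 1/2 by [fj]. *)
pose d t := if t <= 2^-1 then arm 0 (mkT wm) (2 * t) else arm j (mkT zm) (2 - 2 * t).
have cd : continuous d.
  apply: (@paste_continuous R Y (fun t => arm 0 (mkT wm) (2 * t))
    (fun t => arm j (mkT zm) (2 - 2 * t)) 2^-1).
  - move=> t; apply: (@continuous_comp R R Y (fun t => 2 * t) (arm 0 (mkT wm)) t).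
      by continuity_at t.
    exact: arm_continuous.
  - move=> t; apply: (@continuous_comp R R Y (fun t => 2 - 2 * t) (arm j (mkT zm)) t).
      by continuity_at t.
    exact: arm_continuous.
  - by rewrite divff ?pnatr_eq0 // (_ : 2 - 1 = 1) ?arm1 //; lra.
have h0 : (0 : R) <= 2^-1 by lra.
have h1 : ((1 : R) <= 2^-1) = false by apply/negP; lra.
have d0 : d 0 = y0 by rewrite /d h0 mulr0 arm0.
have d1 : d 1 = f j center by rewrite /d h1 mulr1 subrr arm0.
have pd t : `[0, 1]%classic t -> p (d t) = c t.
  rewrite /= in_itv /= => t01; rewrite /d /c /concat; case: ifP => t2.
    rewrite pf; congr (pr (mkT _)); rewrite /radial /= clamp_id ?mkTK //.
    by apply/andP; split; lra.
  have {}t2 : 2^-1 < t by rewrite ltNge t2.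
  rewrite pf; congr (pr (mkT _)); rewrite /radial /= clamp_id ?mkTK //.
    by congr pair; lra.
  by apply/andP; split; lra.
have I0 : `[0, 1]%classic (0 : R) by rewrite /= in_itv /= lexx ler01.
have I1 : `[0, 1]%classic (1 : R) by rewrite /= in_itv /= lexx ler01.
have lc : is_loop (midpoint R) c.
  split; last first.
  - by rewrite -pd // d1 pf midpointE.
  - by rewrite -pd // d0 py0.
  apply: (@subspace_eq_continuous _ _ _ (p \o d)).
    by move=> t; rewrite inE => /pd.
  apply: continuous_subspaceT => t.
  by apply: continuous_comp; [exact: cd|exact: cp.1].
(* Now [j = 0] and [k = 0] are equivalent, which is enough in [Z_2]. *)
have := closed_lift lc (continuous_subspaceT cd) d0 pd.
rewrite d1 -(phiP lc) phic => -[jk kj].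
have [j0|j1] := Z2_case j; first by rewrite j0 jk // j0.
have [k0|->] := Z2_case k; last by [].
by have := kj k0; rewrite j1 f1c => /y10.
Qed.

(** A change of sheet known at one point of a convex boundary piece propagates along straight paths
    in it, by uniqueness of lifts. *)
Let cross_seg (S : set (R * R)) (G : R * R -> R * R) zm k :
  (forall z w t, S z -> S w -> 0 <= t <= 1 ->
     S ((1 - t) * z.1 + t * w.1, (1 - t) * z.2 + t * w.2)) ->
  continuous G -> S `<=` @unglued R -> (forall z, S z -> unglued (G z)) ->
  (forall z, S z -> pr (mkT z) = pr (mkT (G z))) -> S zm ->
  f 0 (mkT (G zm)) = f k (mkT zm) ->
  forall z s, S z -> f s (mkT z) = f (s + k) (mkT (G z)).
Proof.
move=> Sconv cG Su Gu SG Szm fk z s Sz.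
apply: other_sheet; first exact: SG.
pose zt u := ((1 - clamp 0 1 u) * zm.1 + clamp 0 1 u * z.1,
              (1 - clamp 0 1 u) * zm.2 + clamp 0 1 u * z.2).
have Szt u : S (zt u) by apply: Sconv => //; apply: clamp_itv; exact: ler01.
have zt0 : zt 0 = zm.
  rewrite /zt clamp_id ?lexx ?ler01 // subr0 !mul0r !mul1r !addr0.
  by case: (zm).
have zt1 : zt 1 = z.
  rewrite /zt clamp_id ?lexx ?ler01 // subrr !mul0r !mul1r !add0r.
  by case: (z).
have czt : continuous zt by rewrite /zt; continuity.
rewrite -zt1; apply: (@propagate 0 k zt (G \o zt)).
- by [].
- by move=> u; apply: continuous_comp; [exact: czt|exact: cG].
- by move=> u; exact: Su.
- by move=> u; exact: Gu.
- by move=> u; exact: SG.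
- by rewrite /= zt0.
Qed.

Let pr_glued z w : unglued z -> unglued w -> glued (mkT z) (mkT w) ->
  pr (mkT z) = pr (mkT w).
Proof.
by move=> uz uw g; apply/eqmodP/asboolP/rst_step.
Qed.

Let cross_a n z s : (0 < n)%N -> left_segment n z ->
  f s (mkT z) = f (s + h n%:Z) (mkT (glue_a n z)).
Proof.
move=> n0; have ul w : left_segment n w -> unglued w.
  by move=> lw; apply: (unglued_seg n0); left.
have ur w : left_segment n w -> unglued (glue_a n w).
  by move=> lw; apply: (unglued_seg n0); right; left; exact: left_glue_a.
have lm : left_segment n (0, 1 - 3 / 2 * dy n : R).
  by apply/(leftP _ n0); split=> //=; rewrite opprB addrC subrK; exact: seg_mid.
apply: (@cross_seg (left_segment n) (glue_a n) (0, 1 - 3 / 2 * dy n)) => //.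
- move=> {}z w t /(leftP _ n0)[z0 sz] /(leftP _ n0)[w0 sw] t01.
  apply/(leftP _ n0) => /=; split; first by rewrite z0 w0 !mulr0 addr0.
  move: sz sw; rewrite /seg => /andP[h1 h2] /andP[h3 h4].
  have k (a b x y : R) : a < x -> a < y -> a < (1 - t) * x + t * y.
    move=> ax ay; have : 0 <= (1 - t) * (x - a) by apply: mulr_ge0; lra.
    have : 0 <= t * (y - a) by apply: mulr_ge0; lra.
    have [->|t0] := eqVneq t 0; first lra.
    have : 0 < t * (y - a) by apply: mulr_gt0; lra.
    lra.
  have := k _ 0 _ _ h1 h3; have := k (- (2 * dy n)) 0 (- (1 - z.2)) (- (1 - w.2)).
  by lra.
- by rewrite /glue_a; continuity.
- exact: ul.
- exact: ur.
- move=> {}z lz; apply: pr_glued; [exact: ul|exact: ur|].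
  exists n => //; left; rewrite !mkTK //; first [exact: ul|exact: ur].
apply: cross_mid; [exact: ul|exact: ur|apply: pr_glued|].
- exact: ul.
- exact: ur.
- exists n => //; left; rewrite !mkTK //; first [exact: ul|exact: ur].
rewrite -(phi_ab n0).1 /alpha; congr (phi (concat (line _ _) _)).
by rewrite glue_aE //= add0r; congr pair; rewrite /dy; lra.
Qed.

Let cross_b n z s : (0 < n)%N -> bottom_segment n z ->
  f s (mkT z) = f (s + h (- n%:Z)) (mkT (glue_b n z)).
Proof.
move=> n0; have ul w : bottom_segment n w -> unglued w.
  by move=> lw; apply: (unglued_seg n0); right; right; left.
have ur w : bottom_segment n w -> unglued (glue_b n w).
  by move=> lw; apply: (unglued_seg n0); right; right; right; exact: bottom_glue_b.
have bm : bottom_segment n (1 - 3 / 2 * dy n : R, 0).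
  by apply/(bottomP _ n0); split=> //=; rewrite opprB addrC subrK; exact: seg_mid.
apply: (@cross_seg (bottom_segment n) (glue_b n) (1 - 3 / 2 * dy n, 0)) => //.
- move=> {}z w t /(bottomP _ n0)[z0 sz] /(bottomP _ n0)[w0 sw] t01.
  apply/(bottomP _ n0) => /=; split; first by rewrite z0 w0 !mulr0 addr0.
  move: sz sw; rewrite /seg => /andP[h1 h2] /andP[h3 h4].
  have k (a b x y : R) : a < x -> a < y -> a < (1 - t) * x + t * y.
    move=> ax ay; have : 0 <= (1 - t) * (x - a) by apply: mulr_ge0; lra.
    have : 0 <= t * (y - a) by apply: mulr_ge0; lra.
    have [->|t0] := eqVneq t 0; first lra.
    have : 0 < t * (y - a) by apply: mulr_gt0; lra.
    lra.
  have := k _ 0 _ _ h1 h3; have := k (- (2 * dy n)) 0 (- (1 - z.1)) (- (1 - w.1)).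
  by lra.
- by rewrite /glue_b; continuity.
- exact: ul.
- exact: ur.
- move=> {}z lz; apply: pr_glued; [exact: ul|exact: ur|].
  exists n => //; right; rewrite !mkTK //; first [exact: ul|exact: ur].
(* [beta] leaves through the source of the gluing, whereas [alpha] leaves through its target; so the
   two sides are exchanged before [cross_mid]. *)
set k := h _; rewrite -[k]add0r; apply: other_sheet.
  apply/esym/pr_glued; [exact: ul|exact: ur|].
  by exists n => //; right; rewrite !mkTK //; first [exact: ul|exact: ur].
apply: cross_mid; [exact: ur|exact: ul|apply/esym/pr_glued|].
- exact: ul.
- exact: ur.
- exists n => //; right; rewrite !mkTK //; first [exact: ul|exact: ur].
rewrite /k -(phi_ab n0).2 /beta; congr (phi (concat _ (line _ _))).
by rewrite glue_bE //=; congr pair; rewrite /dy; lra.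
Qed.

Lemma two_sheets_of_lifts : two_sheets h (fun s z => f s (mkT z)).
Proof.
have glue_cross s z s' z' : unglued z -> unglued z' -> f s (mkT z) = f s' (mkT z') ->
    glued (mkT z) (mkT z') -> glue_rel h s z s' z'.
  move=> uz uz' e [n n0]; rewrite !mkTK // => -[[lz zz']|[bz zz']]; exists n => //.
    left; split=> //; split=> //; apply: (@f_inj _ _ (mkT z')).
    by rewrite -e (cross_a s n0 lz) zz'.
  right; split=> //; split=> //; apply: (@f_inj _ _ (mkT z')).
  by rewrite -e (cross_b s n0 bz) zz'.
have cross_glue s z s' z' : glue_rel h s z s' z' -> f s (mkT z) = f s' (mkT z').
  move=> [n n0 [[lz [-> ->]]|[bz [-> ->]]]]; first exact: cross_a.
  exact: cross_b.
have open_q (V : set Y) : open V -> forall s z, unglued z -> V (f s (mkT z)) ->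
    exists2 e, 0 < e & forall w, unglued w -> close e z w -> V (f s (mkT w)).
  move=> oV s z uz Vz; have [e e0 eV] := continuous_T (@cf s) oV Vz.
  by exists e => // w uw; rewrite -{1}(mkTK uz) -{1}(mkTK uw) => /eV.
split.
- move=> y; have [s ys] : exists s, y = f s (repr (p y)).
    by apply: fiberP; rewrite /pr reprK.
  by exists s, (set_val (repr (p y))); split; [exact: valT|rewrite mkT_val].
- move=> s z s' z' uz uz'; split=> [e|[[-> ->]//|/cross_glue//|/cross_glue//]].
  have /eqmodP/glued_eqP : pr (mkT z) = pr (mkT z') by rewrite -(pf s) e pf.
  case=> [zz'|g|g].
  + have {}zz' : z = z' by rewrite -(mkTK uz) zz' mkTK.
    by apply: Or31; split=> //; move: e; rewrite zz' => /f_inj.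
  + exact/Or32/glue_cross.
  + exact/Or33/glue_cross.
- move=> V; split=> [|hV]; first exact: open_q.
  rewrite openE => y Vy.
  have [_ /(_ (p y))[U [sh [[oU Uy] osh _ pU hom]]]] := cp.
  have [W sW Wy] : (\bigcup_(V in sh) V) y by rewrite -pU.
  have [e [_ _ _ eK _]] := hom _ sW.
  have oW := osh _ sW.
  (* Openness in the quotient is tested on [unglued], where the hypothesis on [V] applies.
     Injectivity of [p] on the sheet [W] then brings the conclusion back to [Y]. *)
  have oP : open (p @` (V `&` W)).
    suff : open (pr @^-1` (p @` (V `&` W))) by [].
    apply/open_T => z [v [Vv Wv] pv].
    have [s vs] := fiberP pv; rewrite vs in Vv Wv.
    rewrite -(mkT_val z) in Vv Wv.
    have [e1 e10 h1] := hV s (set_val z) (valT z) Vv.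
    have [e2 e20 h2] := open_q _ oW s (set_val z) (valT z) Wv.
    exists (Num.min e1 e2); first by rewrite lt_min e10 e20.
    move=> w cw; exists (f s w); last exact: pf.
    have [m1 m2] : Num.min e1 e2 <= e1 /\ Num.min e1 e2 <= e2.
      by rewrite !ge_min !lexx orbT.
    rewrite -(mkT_val w); split; [apply: h1|apply: h2]; try exact: valT;
      by move: cw; rewrite /close => /and4P[*]; apply/and4P; split; lra.
  have : nbhs y (p @^-1` (p @` (V `&` W))).
    by apply: cp.1; apply: open_nbhs_nbhs; split=> //; exists y.
  have : nbhs y W by exact: open_nbhs_nbhs.
  apply: filterS2 => v Wv [v' [Vv' Wv'] pv'].
  by rewrite -(eK _ Wv) -pv' eK.
Qed.

End sheets.

End model.

Lemma two_sheets_of_cover (R : realType) (h : int -> 'Z_2)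
    (Y : topologicalType) (p : Y -> chamanara R) :
  is_cover_of h p -> exists q : 'Z_2 -> R * R -> Y, two_sheets h q.
Proof.
move=> [phi [_ phi_ab _ [cp fiber2] [y0 py0 phiP]]].
have [y1 [y10 fE]] := card2P (fiber2 (midpoint R)) py0.
have py1 : p y1 = midpoint R.
  by have : (p @^-1` [set midpoint R]) y1 by rewrite fE; right.
have [f0 [cf0 f0c pf0]] := sheet_lift cp py0.
have [f1 [cf1 f1c pf1]] := sheet_lift cp py1.
pose f (s : 'Z_2) := if s == 0 then f0 else f1.
eexists; apply: (@two_sheets_of_lifts _ _ _ _ cp phi y0 _ _ _ _ y1 f) => //.
- by move=> s; rewrite /f; case: ifP.
- by move=> s z; rewrite /f; case: ifP.
Qed.

(** * Symmetries of the glued squares *)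

Section symmetries.
Variable R : realType.
Implicit Types (z w : R * R) (n : nat) (h : int -> 'Z_2).

Definition flip z : R * R := (1 - z.1, 1 - z.2).
Definition diag z : R * R := (z.2, z.1).

Lemma flipK : involutive flip.
Proof. by move=> [a b]; rewrite /flip /=; congr pair; lra. Qed.

Lemma diagK : involutive diag.
Proof. by case. Qed.

Lemma open_square_flip z : open_square (flip z) <-> open_square z.
Proof. by split=> /open_squareP /= ?; apply/open_squareP; rewrite /=; lra. Qed.

Lemma open_square_diag z : open_square (diag z) <-> open_square z.
Proof. by split=> /open_squareP /= ?; apply/open_squareP; rewrite /=; lra. Qed.

Lemma left_flip n z : (0 < n)%N -> left_segment n (flip z) <-> right_segment n z.
Proof.
move=> n0; split=> [/(leftP _ n0)[/= ?]|/(rightP _ n0)[? ?]].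
  by rewrite opprB addrC subrK => ?; apply/(rightP _ n0); split=> //; lra.
by apply/(leftP _ n0); split=> /=; [lra|rewrite opprB addrC subrK].
Qed.

Lemma right_flip n z : (0 < n)%N -> right_segment n (flip z) <-> left_segment n z.
Proof. by move=> n0; rewrite -left_flip // flipK. Qed.

Lemma top_diag n z : (0 < n)%N -> top_segment n (diag z) <-> right_segment n z.
Proof. by move=> n0; rewrite topP // rightP. Qed.

Lemma right_diag n z : (0 < n)%N -> right_segment n (diag z) <-> top_segment n z.
Proof. by move=> n0; rewrite -top_diag // diagK. Qed.

Lemma bottom_diag n z : (0 < n)%N -> bottom_segment n (diag z) <-> left_segment n z.
Proof. by move=> n0; rewrite bottomP // leftP. Qed.

Lemma left_diag n z : (0 < n)%N -> left_segment n (diag z) <-> bottom_segment n z.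
Proof. by move=> n0; rewrite -bottom_diag // diagK. Qed.

Lemma bottom_flip n z : (0 < n)%N -> bottom_segment n (flip z) <-> top_segment n z.
Proof.
move=> n0; rewrite -left_diag // -right_diag //.
by rewrite -left_flip.
Qed.

Lemma top_flip n z : (0 < n)%N -> top_segment n (flip z) <-> bottom_segment n z.
Proof. by move=> n0; rewrite -bottom_flip // flipK. Qed.

(* Up to the symmetries of the square there is only one kind of boundary
   segment. *)
Lemma unglued_ind (P : set (R * R)) :
  (forall z, open_square z -> P z) ->
  (forall n z, (0 < n)%N -> right_segment n z -> P z) ->
  (forall z, P (flip z) -> P z) -> (forall z, P (diag z) -> P z) ->
  forall z, unglued z -> P z.
Proof.
move=> Po Pr Pf Pd; have Pl n z : (0 < n)%N -> left_segment n z -> P z.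
  by move=> n0 /(right_flip _ n0)/(Pr _ _ n0)/Pf.
move=> z [/Po//|[n /= n0 [[[lz|rz]|bz]|tz]]].
- exact: Pl lz.
- exact: Pr rz.
- by apply/Pd/(Pl n) => //; apply/left_diag.
- by apply/Pd/(Pr n) => //; apply/right_diag.
Qed.

Lemma unglued_flip z : unglued z -> unglued (flip z).
Proof.
move=> [/open_square_flip oz|[n /= n0 [[[lz|rz]|bz]|tz]]]; first by left.
- by apply: (unglued_seg n0); right; left; apply/right_flip.
- by apply: (unglued_seg n0); left; apply/left_flip.
- by apply: (unglued_seg n0); do 3! right; apply/top_flip.
- by apply: (unglued_seg n0); do 2! right; left; apply/bottom_flip.
Qed.

Lemma unglued_diag z : unglued z -> unglued (diag z).
Proof.
move=> [/open_square_diag oz|[n /= n0 [[[lz|rz]|bz]|tz]]]; first by left.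
- by apply: (unglued_seg n0); do 2! right; left; apply/bottom_diag.
- by apply: (unglued_seg n0); do 3! right; apply/top_diag.
- by apply: (unglued_seg n0); left; apply/left_diag.
- by apply: (unglued_seg n0); right; left; apply/right_diag.
Qed.

Lemma close_flip e z w : close e (flip z) (flip w) = close e z w.
Proof. by rewrite /close /flip /=; apply/idP/idP => /and4P[*]; apply/and4P; split; lra. Qed.

Lemma close_diag e z w : close e (diag z) (diag w) = close e z w.
Proof. by rewrite /close /diag /=; apply/idP/idP => /and4P[*]; apply/and4P; split. Qed.

Lemma close_le e e' z w : e <= e' -> close e z w -> close e' z w.
Proof. by rewrite /close => ee /and4P[*]; apply/and4P; split; lra. Qed.

Lemma glue_rel_diag h s z s' z' :
  glue_rel (fun i => h (- i)) s (diag z) s' (diag z') <-> glue_rel h s z s' z'.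
Proof.
have imp k t w t' w' : glue_rel (fun i => k (- i)) t (diag w) t' (diag w') ->
    glue_rel k t w t' w'.
  move=> [n n0 [[/left_diag lw [e ->]]|[/bottom_diag bw [e ->]]]]; exists n => //.
    by right; split; [exact: lw|split=> //; rewrite -[w']diagK e].
  by left; split; [exact: bw|split; [rewrite -[w']diagK e|rewrite opprK]].
split=> [/imp//|g]; apply: (imp (fun i => h (- i))); rewrite !diagK.
rewrite (_ : (fun i => h (- - i)) = h) //.
by apply/funext => i; rewrite opprK.
Qed.

(** The half-turn reverses the direction of every gluing; in [Z_2] the reversed change of sheet is
    the same. *)
Lemma glue_rel_flip h s z s' z' :
  glue_rel h s (flip z) s' (flip z') <-> glue_rel h s' z' s z.
Proof.
have imp t w t' w' : glue_rel h t (flip w) t' (flip w') -> glue_rel h t' w' t w.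
  move=> [n n0 [[lw [e ->]]|[bw [e ->]]]]; exists n => //.
  - left; have e' : w' = flip (glue_a n (flip w)) by rewrite -e flipK.
    split; first by rewrite e'; apply/left_flip => //; exact: left_glue_a.
    split; last by rewrite Z2_addK.
    have [w1 _] := (leftP _ n0).1 lw; move: w1 => /= w1.
    rewrite e' glue_aE // [glue_a _ _]glue_aE // /flip /=.
    by rewrite [LHS]surjective_pairing; congr pair; lra.
  - right; have e' : w' = flip (glue_b n (flip w)) by rewrite -e flipK.
    split; first by rewrite e'; apply/bottom_flip => //; exact: bottom_glue_b.
    split; last by rewrite Z2_addK.
    have [w1 _] := (bottomP _ n0).1 bw; move: w1 => /= w1.
    rewrite e' glue_bE // [glue_b _ _]glue_bE // /flip /=.
    by rewrite [LHS]surjective_pairing; congr pair; lra.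
by split=> [/imp//|g]; apply: imp; rewrite !flipK.
Qed.

Lemma cross_diag h s z s' z' :
  cross (fun i => h (- i)) s (diag z) s' (diag z') <-> cross h s z s' z'.
Proof.
split=> -[[-> e]|/glue_rel_diag e|/glue_rel_diag e];
  by [apply: Or31; rewrite -[z]diagK e diagK|apply: Or31; rewrite e|apply: Or32|apply: Or33].
Qed.

Lemma cross_flip h s z s' z' :
  cross h s (flip z) s' (flip z') <-> cross h s z s' z'.
Proof.
split=> -[[-> e]|/glue_rel_flip e|/glue_rel_flip e];
  by [apply: Or31; rewrite -[z]flipK e flipK|apply: Or31; rewrite e|apply: Or33|apply: Or32].
Qed.

End symmetries.

Section two_sheets_symmetries.
Variables (R : realType) (h : int -> 'Z_2) (Y : topologicalType)
  (q : 'Z_2 -> R * R -> Y).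
Hypothesis hq : two_sheets h q.

Let two_sheets_involution (k : int -> 'Z_2) (sigma : R * R -> R * R) :
  involutive sigma -> (forall z, unglued z -> unglued (sigma z)) ->
  (forall e z w, close e (sigma z) (sigma w) = close e z w) ->
  (forall s z s' z', cross h s (sigma z) s' (sigma z') <-> cross k s z s' z') ->
  two_sheets k (fun s z => q s (sigma z)).
Proof.
move=> sK su sc scr; have [q1 q2 q3] := hq; split.
- move=> y; have [s [z [uz <-]]] := q1 y.
  by exists s, (sigma z); rewrite sK; split=> //; exact: su.
- by move=> s z s' z' uz uz'; rewrite q2; [exact: scr|exact: su|exact: su].
- move=> V; rewrite q3; split=> hV s z uz Vz.
    have [e e0 eV] := hV s (sigma z) (su _ uz) Vz.
    by exists e => // w uw cw; apply: eV; [exact: su|rewrite sc].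
  rewrite -[z]sK in Vz; have [e e0 eV] := hV s (sigma z) (su _ uz) Vz.
  exists e => // w uw cw; rewrite -[w]sK; apply: eV; first exact: su.
  by rewrite sc.
Qed.

Lemma two_sheets_flip : two_sheets h (fun s z => q s (flip z)).
Proof.
apply: two_sheets_involution; [exact: flipK|exact: unglued_flip|exact: close_flip|].
exact: cross_flip.
Qed.

Lemma two_sheets_diag : two_sheets (fun i => h (- i)) (fun s z => q s (diag z)).
Proof.
apply: two_sheets_involution; [exact: diagK|exact: unglued_diag|exact: close_diag|].
move=> s z s' z'; rewrite -(cross_diag _ _ (diag z)) !diagK.
by split; apply: id.
Qed.

End two_sheets_symmetries.

(** * The gluing near a point, and separation of points *)

Section separation.
Variable R : realType.
Implicit Types (z w : R * R) (n : nat) (h : int -> 'Z_2).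

Lemma cross_open_square h s z s' w : open_square z -> cross h s z s' w ->
  s = s' /\ z = w.
Proof.
move=> /open_squareP oz [//|[n n0]|[n n0]].
  by case=> [[/(leftP _ n0)[? _] _]|[/(bottomP _ n0)[? _] _]]; exfalso; lra.
case=> [[/(left_glue_a n0)/(rightP _ n0)[e _] [ze _]]|
        [/(bottom_glue_b n0)/(topP _ n0)[e _] [ze _]]];
  by exfalso; rewrite -ze in e; lra.
Qed.

Lemma crossC h s z s' z' : cross h s z s' z' -> cross h s' z' s z.
Proof. by move=> [[-> ->]|c|c]; [apply: Or31|apply: Or33|apply: Or32]. Qed.

Definition unglue_a n z : R * R := (z.1 - 1, z.2 + 1 - 3 * dy n).

Lemma glue_aK n z : (0 < n)%N -> unglue_a n (glue_a n z) = z.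
Proof.
move=> n0; rewrite glue_aE // /unglue_a /= [RHS]surjective_pairing.
by congr pair; lra.
Qed.

Lemma unglue_aK n z : (0 < n)%N -> glue_a n (unglue_a n z) = z.
Proof.
move=> n0; rewrite glue_aE // /unglue_a /= [RHS]surjective_pairing.
by congr pair; lra.
Qed.

Lemma left_unglue_a n z : (0 < n)%N -> right_segment n z ->
  left_segment n (unglue_a n z).
Proof.
move=> n0 /(rightP _ n0)[z1 sz]; apply/(leftP _ n0) => /=; split; first lra.
by move: sz; rewrite /seg; lra.
Qed.

Lemma right_cross h n s z s' w : (0 < n)%N -> right_segment n z ->
  cross h s z s' w ->
  (s = s' /\ z = w) \/ (w = unglue_a n z /\ s = s' + h n%:Z).
Proof.
move=> n0 /(rightP _ n0)[z1 sz] [|[m m0]|[m m0]]; first by left.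
  case=> [[/(leftP _ m0)[? _] _]|[/(bottomP _ m0)[? _] _]]; first (exfalso; lra).
  by have ? := seg_bounds n0 sz; exfalso; lra.
case=> [[lw [zw ->]]|[bw [zw _]]].
  have /(rightP _ m0)[_] := left_glue_a m0 lw; rewrite -zw => /(seg_inj sz) nm.
  by right; rewrite nm zw glue_aK // -nm.
have /(topP _ m0)[z2 _] := bottom_glue_b m0 bw; rewrite -zw in z2.
by have ? := seg_bounds n0 sz; exfalso; lra.
Qed.

Lemma cross_right h n s z : (0 < n)%N -> right_segment n z ->
  cross h s z (s + h n%:Z) (unglue_a n z).
Proof.
move=> n0 rz; apply: Or33; exists n => //; left.
by rewrite unglue_aK // Z2_addK; split; first exact: left_unglue_a.
Qed.

Lemma cross_partner z : unglued z -> forall h, exists z', forall s t w,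
  cross h s z t w -> w = z \/ w = z'.
Proof.
move: z; apply: unglued_ind.
- by move=> z oz h; exists z => s t w /(cross_open_square oz)[_ <-]; left.
- move=> n w n0 rw h; exists (unglue_a n w) => s t v.
  by move=> /(right_cross n0 rw)[[_ <-]|[-> _]]; [left|right].
- move=> z IH h; have [z' hz'] := IH h; exists (flip z') => s t w.
  by move=> /cross_flip/hz'[|<-]; [left|right]; rewrite ?flipK //; exact: (can_inj (@flipK R)).
- move=> z IH h; have [z' hz'] := IH (fun i => h (- i)); exists (diag z') => s t w.
  by move=> /cross_diag/hz'[|<-]; [left|right]; rewrite ?diagK //; exact: (can_inj (@diagK R)).
Qed.

(** Near [z] a gluing is a translation that also moves [z], so offsets are preserved. In the open
    square [e] is the distance to the boundary, on a segment the distance to its ends. *)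
Lemma cross_local z : unglued z -> exists2 e, 0 < e & forall h s w s' w',
  unglued w -> close e z w -> cross h s w s' w' ->
  exists2 z', cross h s z s' z' &
    forall d, close d z w -> close d z' w'.
Proof.
move: z; apply: unglued_ind.
- move=> z oz; have /open_squareP bz := oz.
  exists (Num.min (Num.min z.1 (1 - z.1)) (Num.min z.2 (1 - z.2))).
    by rewrite !lt_min; lra.
  move=> h s w s' w' uw; set m := Num.min _ _ => cw.
  have [m1 m2 m3 m4] : [/\ m <= z.1, m <= 1 - z.1, m <= z.2 & m <= 1 - z.2].
    by rewrite /m !ge_min !lexx !orbT.
  have ow : open_square w.
    by apply/open_squareP; move: cw; rewrite /close => /and4P[*]; lra.
  by move=> /(cross_open_square ow)[<- <-]; exists z => //; apply: Or31.
- move=> n w n0 rw; have /(rightP _ n0)[w1 /andP[sw1 sw2]] := rw.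
  have wb := seg_bounds n0 (introT andP (conj sw1 sw2)).
  exists (Num.min (w.2 - dy n) (2 * dy n - w.2)); first by rewrite lt_min; lra.
  move=> h s v s' v' uv; set m := Num.min _ _ => cv.
  have [m1 m2] : m <= w.2 - dy n /\ m <= 2 * dy n - w.2.
    by rewrite /m !ge_min !lexx !orbT.
  have hd := dy_le_half R n0.
  have [ov|rv] : open_square v \/ right_segment n v.
    move: uv cv => /ungluedP[|[k k0 b]]; first by left.
    rewrite /close => /and4P[c1 c2 c3 c4]; right.
    case: b => -[b1 b2]; try (exfalso; lra).
    apply/(rightP _ n0); split=> //; rewrite /seg; lra.
  + by move=> /(cross_open_square ov)[<- <-]; exists w => //; apply: Or31.
  + move=> /(right_cross n0 rv)[[<- <-]|[-> ->]].
      by exists w => //; apply: Or31.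
    exists (unglue_a n w).
      by have := cross_right h (s' + h n) n0 rw; rewrite Z2_addK.
    by move=> d; rewrite /close /unglue_a /= => /and4P[*]; apply/and4P; split; lra.
- move=> z [e e0 IH]; exists e => // h s w s' w' uw cw c.
  have [||z' cz' cl] := IH h s (flip w) s' (flip w') (unglued_flip uw).
  + by rewrite close_flip.
  + exact/cross_flip.
  exists (flip z'); first by apply/cross_flip; rewrite flipK.
  by move=> d cd; rewrite -close_flip flipK; apply: cl; rewrite close_flip.
- move=> z [e e0 IH]; exists e => // h s w s' w' uw cw c.
  have [||z' cz' cl] := IH (fun i => h (- i)) s (diag w) s' (diag w') (unglued_diag uw).
  + by rewrite close_diag.
  + exact/cross_diag.
  exists (diag z'); first by apply/cross_diag; rewrite diagK.
  by move=> d cd; rewrite -close_diag diagK; apply: cl; rewrite close_diag.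
Qed.

Lemma close_separate (a b : R * R) : exists2 e, 0 < e &
  forall w, close e a w -> close e b w -> a = b.
Proof.
have [->|ab] := eqVneq a b; first by exists 1.
pose D := Num.max `|a.1 - b.1| `|a.2 - b.2|.
have D0 : 0 < D.
  rewrite /D lt_max !normr_gt0 !subr_eq0 -negb_and.
  by apply: contra ab => /andP[/eqP e1 /eqP e2]; apply/eqP;
    rewrite [a]surjective_pairing e1 e2 -surjective_pairing.
exists (D / 2); first by lra.
move=> w /and4P[a1 a2 a3 a4] /and4P[b1 b2 b3 b4]; exfalso.
have : D < D by rewrite {1}/D gt_max !ltr_norml; apply/andP; split; apply/andP; split; lra.
by rewrite ltxx.
Qed.

Lemma cross_unglued h s z s' z' : unglued z -> cross h s z s' z' -> unglued z'.
Proof.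
move=> uz [[_ <-]//|[n n0]|[n n0]].
- case=> [[lz [-> _]]|[bz [-> _]]]; apply: (unglued_seg n0).
    by right; left; exact: left_glue_a.
  by do 3! right; exact: bottom_glue_b.
- by case=> [[lz _]|[bz _]]; apply: (unglued_seg n0); [left|do 2! right; left].
Qed.

End separation.

Section surface.
Variables (R : realType) (h : int -> 'Z_2) (Y : topologicalType)
  (q : 'Z_2 -> R * R -> Y).
Hypothesis hq : two_sheets h q.
Implicit Types (z w : R * R) (s t : 'Z_2).

Lemma q_surj y : exists s z, unglued z /\ q s z = y.
Proof. by have [] := hq. Qed.

Lemma q_eq s z s' z' : unglued z -> unglued z' ->
  (q s z = q s' z' <-> cross h s z s' z').
Proof. by have [_ + _] := hq; apply. Qed.

Lemma q_open (V : set Y) : open V <-> forall s z, unglued z -> V (q s z) ->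
  exists2 e, 0 < e & forall w, unglued w -> close e z w -> V (q s w).
Proof. by have [_ _] := hq; apply. Qed.

Lemma q_nbhs s z (V : set Y) : unglued z -> nbhs (q s z) V ->
  exists2 e, 0 < e & forall w, unglued w -> close e z w -> V (q s w).
Proof.
rewrite nbhsE => uz [W [oW Wz] WV]; have [e e0 eW] := (q_open W).1 oW s z uz Wz.
by exists e => // w uw /(eW _ uw)/WV.
Qed.

Lemma q_right n s z : (0 < n)%N -> right_segment n z ->
  q s z = q (s + h n%:Z) (unglue_a n z).
Proof.
move=> n0 rz; apply/q_eq; last exact: cross_right.
  by apply: (unglued_seg n0); right; left.
by apply: (unglued_seg n0); left; exact: left_unglue_a.
Qed.

Lemma q_within s : {within @unglued R, continuous (q s)}.
Proof.
apply/subspace_continuousP => z uz V nV.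
have [e e0 eV] := q_nbhs uz nV.
suff : nbhs z [set w | unglued w -> V (q s w)] by [].
by apply/nbhs_closeP; exists e => // w cw uw; exact: eV.
Qed.

(** Boxes are taken around all preimages of [y], so that on a segment both sides are covered. *)
Let q_ball e (y : Y) := [set y' | exists s z w, [/\ unglued z /\ unglued w,
  q s z = y, q s w = y' & close e z w]].

Let q_ball_open y : exists2 e, 0 < e & forall d, 0 < d -> d <= e ->
  open (q_ball d y) /\ forall s w, unglued w -> q_ball d y (q s w) ->
    exists2 z, unglued z /\ q s z = y & close d z w.
Proof.
have [s0 [z0 [uz0 yz0]]] := q_surj y.
have [z1 hz1] := cross_partner uz0 h.
(* At most two points of the square lie under [y]; the partner [z1] counts only if it belongs to
   [unglued]. *)
have [e [e0 eP]] : exists e, 0 < e /\ forall s z, unglued z -> q s z = y ->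
    forall t w s' w', unglued w -> close e z w -> cross h t w s' w' ->
    exists2 z', cross h t z s' z' & forall d, close d z w -> close d z' w'.
  have [e0 e00 h0] := cross_local uz0.
  have [uz1|nuz1] := pselect (unglued z1).
    have [e1 e10 h1] := cross_local uz1.
    have [m0 m1] : Num.min e0 e1 <= e0 /\ Num.min e0 e1 <= e1.
      by rewrite !ge_min !lexx orbT.
    exists (Num.min e0 e1); rewrite lt_min e00 e10; split=> // s z uz.
    rewrite -yz0 => /esym/(q_eq _ _ uz0 uz) /hz1[->|->] t w s' w' uw cw.
      by apply: h0 => //; exact: close_le cw.
    by apply: h1 => //; exact: close_le cw.
  exists e0; split=> // s z uz; rewrite -yz0 => /esym/(q_eq _ _ uz0 uz) /hz1[->|zz1].
    by move=> t w s' w' uw cw; exact: h0.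
  by case: nuz1; rewrite -zz1.
exists e => // d d0 de.
have sat s w : unglued w -> q_ball d y (q s w) ->
    exists2 z, unglued z /\ q s z = y & close d z w.
  move=> uw [t [z [v [[uz uv] yz /(q_eq _ _ uv uw) cvw cz]]]].
  have [z' czz' cl] := eP t z uz yz t v s w uv (close_le de cz) cvw.
  have uz' := cross_unglued uz czz'.
  by exists z'; [split=> //; rewrite -yz; apply/esym/q_eq|exact: cl].
split=> //; apply/q_open => s w uw /(sat _ _ uw)[z [uz yz] czw].
have : nbhs w (close d z).
  by apply: open_nbhs_nbhs; split; first exact: open_close.
move=> /nbhs_closeP[r r0 hr]; exists r => // v uv /hr czv.
by exists s, z, v.
Qed.

Lemma q_hausdorff : hausdorff_space Y.
Proof.
rewrite open_hausdorff => y y' /eqP yy'.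
have [e e0 eP] := q_ball_open y; have [e' e'0 eP'] := q_ball_open y'.
(* Distinct [y] and [y'] may lie over the same point of the square in different sheets, so only
   preimages in a common sheet can be separated. *)
have [d [d0 dP]] : exists d, 0 < d /\ forall s z z' w, unglued z -> unglued z' ->
    q s z = y -> q s z' = y' -> close d z w -> close d z' w -> False.
  have [s0 [z0 [uz0 yz0]]] := q_surj y; have [z1 hz1] := cross_partner uz0 h.
  have [s0' [z0' [uz0' yz0']]] := q_surj y'; have [z1' hz1'] := cross_partner uz0' h.
  have [d1 d10 h1] := close_separate z0 z0'.
  have [d2 d20 h2] := close_separate z0 z1'.
  have [d3 d30 h3] := close_separate z1 z0'.
  have [d4 d40 h4] := close_separate z1 z1'.
  exists (Num.min (Num.min d1 d2) (Num.min d3 d4)); split.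
    by rewrite !lt_min d10 d20 d30 d40.
  set m := Num.min _ _; have [m1 m2 m3 m4] : [/\ m <= d1, m <= d2, m <= d3 & m <= d4].
    by rewrite /m !ge_min !lexx !orbT.
  move=> s z z' w uz uz' yz yz' cz cz'; suff zz' : z = z' by apply: yy'; rewrite -yz -yz' zz'.
  have /hz1 : cross h s0 z0 s z by apply/q_eq => //; rewrite yz yz0.
  have /hz1' : cross h s0' z0' s z' by apply/q_eq => //; rewrite yz' yz0'.
  move=> [e1|e1] [e2|e2]; rewrite e1 e2; rewrite e1 in cz'; rewrite e2 in cz.
  - exact: h1 (close_le m1 cz) (close_le m1 cz').
  - exact: h3 (close_le m3 cz) (close_le m3 cz').
  - exact: h2 (close_le m2 cz) (close_le m2 cz').
  - exact: h4 (close_le m4 cz) (close_le m4 cz').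
pose r := Num.min d (Num.min e e').
have r0 : 0 < r by rewrite !lt_min d0 e0 e'0.
have [rd re re'] : [/\ r <= d, r <= e & r <= e'].
  by rewrite /r !ge_min !lexx !orbT.
have [oB satB] := eP r r0 re; have [oB' satB'] := eP' r r0 re'.
exists (q_ball r y, q_ball r y') => /=; last split=> //.
- have [s [z [uz yz]]] := q_surj y; have [s' [z' [uz' yz']]] := q_surj y'.
  by split; rewrite inE; [exists s, z, z|exists s', z', z']; split=> //; exact: close_refl.
- apply/eqP; rewrite -subset0 => x [Bx B'x]; have [s [w [uw xw]]] := q_surj x.
  rewrite -xw in Bx B'x.
  have [z [uz yz] cz] := satB s w uw Bx; have [z' [uz' yz'] cz'] := satB' s w uw B'x.
  exact: (dP s z z' w) (close_le rd cz) (close_le rd cz').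
Qed.

End surface.

(** * The cover is a surface *)

Section charts.
Variables (R : realType) (Y : topologicalType).

(** Charts are handled as parametrizations from the plane; openness of images stands for continuity
    of the inverse. *)
Definition is_chart (P : set (R * R)) (f : R * R -> Y) : Prop :=
  [/\ open P, forall w, P w -> {for w, continuous f},
      forall W, open W -> W `<=` P -> open (f @` W) &
      forall w w', P w -> P w' -> f w = f w' -> w = w'].

Lemma chart_homeo P f : is_chart P f ->
  exists g : Y -> R * R, homeo_between (f @` P) P g.
Proof.
move=> [oP cf of_ injf].
have /choice[g hg] : forall y, exists w, (f @` P) y -> P w /\ f w = y.
  move=> y; have [[w Pw fw]|n] := pselect ((f @` P) y); first by exists w.
  by exists point.
have gK w : P w -> g (f w) = w.
  by move=> Pw; have [Pg fg] := hg (f w) (ex_intro2 _ _ w Pw erefl); exact: injf.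
exists g, f; split.
- rewrite continuous_open_subspace; last exact: of_.
  move=> y; rewrite inE => -[w Pw <-] V; rewrite gK // nbhsE => -[W [oW Ww] WV].
  suff : nbhs (f w) (f @` (P `&` W)).
    by apply: filterS => _ [v [Pv Wv] <-] /=; apply: WV; rewrite gK.
  apply: open_nbhs_nbhs; split; first by apply: of_; [exact: openI|move=> v []].
  by exists w.
- by rewrite continuous_open_subspace // => w; rewrite inE => /cf.
- split=> [_ [_ [w Pw <-] <-]|_ [w Pw <-]]; first by rewrite gK.
  by exists w.
- by move=> y /hg[].
- by move=> w /gK.
Qed.

Lemma charts_second_countable (I : countType) (P : I -> set (R * R))
    (f : I -> R * R -> Y) :
  (forall i, is_chart (P i) (f i)) -> (forall y, exists i, (f i @` P i) y) ->
  @second_countable Y.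
Proof.
move=> ch cov.
pose B (k : I * (rat * rat) * rat) : set Y :=
  f k.1.1 @` (P k.1.1 `&` close (ratr k.2) (ratr k.1.2.1, ratr k.1.2.2)).
exists (range B).
  by apply: sub_countable (card_image_le _ _) (countableP _).
split=> [_ [[[i ab] r] _ <-]|y V].
  have [oP _ of_ _] := ch i.
  by apply: of_; [apply: openI => //; exact: open_close|move=> w []].
rewrite nbhsE => -[W [oW Wy] WV].
have [i [w Pw wy]] := cov y; have [oP cf of_ _] := ch i.
have : nbhs w (P i `&` f i @^-1` W).
  apply: filterI; first exact: open_nbhs_nbhs.
  by apply: cf => //; rewrite wy; exact: open_nbhs_nbhs.
move=> /nbhs_closeP[e e0 eP].
(* A centre within [e / 4] of [w] and a radius between [e / 4] and [e / 2] give a rational box that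
   contains [w] and stays inside the box of radius [e]. *)
have [a] := @rat_in_itvoo R (w.1 - e / 4) (w.1 + e / 4) ltac:(lra).
rewrite in_itv /= => ha.
have [b] := @rat_in_itvoo R (w.2 - e / 4) (w.2 + e / 4) ltac:(lra).
rewrite in_itv /= => hb.
have [r] := @rat_in_itvoo R (e / 4) (e / 2) ltac:(lra).
rewrite in_itv /= => hr.
exists (B (i, (a, b), r)).
  split; first by exists (i, (a, b), r).
  exists w => //; split=> //; rewrite /close /=.
  by apply/and4P; split; lra.
move=> _ [v [Pv /= /and4P[/= v1 v2 v3 v4]] <-]; apply: WV; apply: (eP v _).2.
by apply/and4P; split; lra.
Qed.

End charts.

Section surface.
Variables (R : realType).
Implicit Types (z w : R * R) (s t : 'Z_2) (n : nat).

Section charts_of_two_sheets.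
Variables (h : int -> 'Z_2) (Y : topologicalType) (q : 'Z_2 -> R * R -> Y).
Hypothesis hq : two_sheets h q.

Lemma open_open_square : open (@open_square R).
Proof.
rewrite openE => z /open_squareP oz; apply/nbhs_closeP.
exists (Num.min (Num.min z.1 (1 - z.1)) (Num.min z.2 (1 - z.2))).
  by rewrite !lt_min; lra.
move=> w; set m := Num.min _ _ => cw.
have [m1 m2 m3 m4] : [/\ m <= z.1, m <= 1 - z.1, m <= z.2 & m <= 1 - z.2].
  by rewrite /m !ge_min !lexx !orbT.
by apply/open_squareP; move: cw; rewrite /close => /and4P[*]; lra.
Qed.

Lemma square_chart s : is_chart (@open_square R) (q s).
Proof.
split.
- exact: open_open_square.
- move=> z oz V /(q_nbhs hq (open_square_unglued oz))[e e0 eV].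
  have : nbhs z (close e z `&` @open_square R).
    apply: open_nbhs_nbhs; split; last by split=> //; exact: close_refl.
    by apply: openI; [exact: open_close|exact: open_open_square].
  by apply: filterS => w [cw /open_square_unglued uw]; exact: eV.
- move=> W oW Wo; apply/(q_open hq) => t z uz [w Ww].
  move=> /(q_eq hq _ _ (open_square_unglued (Wo _ Ww)) uz)/(cross_open_square (Wo _ Ww))[<- <-].
  have : nbhs w W by exact: open_nbhs_nbhs.
  by move=> /nbhs_closeP[e e0 eW]; exists e => // v _ /eW Wv; exists v.
- move=> w w' ow ow'.
  have uw := open_square_unglued ow; have uw' := open_square_unglued ow'.
  by move=> /(q_eq hq _ _ uw uw')/(cross_open_square ow)[].
Qed.

(* The strip around the segment a_n, drawn in the plane across the right side
   of the square. *)
Definition strip n : set (R * R) := [set w | (1/2 < w.1 < 3/2) /\ seg n w.2].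

Definition strip_map n s w : Y :=
  if w.1 <= 1 then q s w else q (s + h n%:Z) (unglue_a n w).

Lemma open_strip n : open (strip n).
Proof.
rewrite openE => w [w1 w2]; apply/nbhs_closeP.
move: w2; rewrite /seg => w2.
exists (Num.min (Num.min (w.1 - 1/2) (3/2 - w.1)) (Num.min (w.2 - dy n) (2 * dy n - w.2))).
  by rewrite !lt_min; lra.
move=> v; set m := Num.min _ _ => cv.
have [m1 m2 m3 m4] : [/\ m <= w.1 - 1/2, m <= 3/2 - w.1, m <= w.2 - dy n & m <= 2 * dy n - w.2].
  by rewrite /m !ge_min !lexx !orbT.
by move: cv; rewrite /close => /and4P[*]; split; rewrite /seg; lra.
Qed.

Lemma strip_left n w : (0 < n)%N -> strip n w -> w.1 <= 1 ->
  open_square w \/ right_segment n w.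
Proof.
move=> n0 [w1 sw]; have ? := seg_bounds n0 sw.
rewrite le_eqVlt => /orP[/eqP e|lt1]; first by right; apply/(rightP _ n0).
by left; apply/open_squareP; lra.
Qed.

Lemma strip_right n w : (0 < n)%N -> strip n w -> 1 < w.1 ->
  open_square (unglue_a n w).
Proof.
move=> n0 [w1 sw] lt1; apply/open_squareP; rewrite /unglue_a /=.
by move: sw; rewrite /seg; have := dy_le_half R n0; have := dy_gt0 R n; lra.
Qed.

Lemma strip_unglued n w : (0 < n)%N -> strip n w -> w.1 <= 1 -> unglued w.
Proof.
move=> n0 sw w1; case: (strip_left n0 sw w1) => [/open_square_unglued//|rw].
by apply: (unglued_seg n0); right; left.
Qed.

Lemma strip_unglued' n w : (0 < n)%N -> strip n w -> 1 <= w.1 ->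
  unglued (unglue_a n w).
Proof.
move=> n0 sw; rewrite le_eqVlt => /orP[/eqP e|lt1]; last first.
  exact/open_square_unglued/strip_right.
apply: (unglued_seg n0); left; apply: left_unglue_a => //.
by apply/(rightP _ n0); split; [rewrite -e|case: sw].
Qed.

Lemma strip_mapE n s w : (0 < n)%N -> strip n w -> 1 <= w.1 ->
  strip_map n s w = q (s + h n%:Z) (unglue_a n w).
Proof.
move=> n0 sw w1; rewrite /strip_map; case: ifP => // w1'.
apply: (q_right hq) => //; apply/(rightP _ n0); split; last by case: sw.
by apply/eqP; rewrite eq_le w1 w1'.
Qed.

Lemma strip_chart n s : (0 < n)%N -> is_chart (strip n) (strip_map n s).
Proof.
move=> n0; split.
- exact: open_strip.
- move=> w sw V nV.
  (* Each closed half of the strip gets its own radius; if [w] is off a half, its distance to that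
     half will do. *)
  have [e1 [e10 h1]] : exists e, 0 < e /\ forall v, strip n v -> v.1 <= 1 ->
      close e w v -> V (strip_map n s v).
    have [w1|w1] := leP w.1 1.
      have uw := strip_unglued n0 sw w1.
      have nV' : nbhs (q s w) V by move: nV; rewrite /strip_map w1.
      have [e e0 eV] := q_nbhs hq uw nV'.
      exists e; split=> // v sv v1 cv; rewrite /strip_map v1.
      by apply: eV => //; exact: strip_unglued sv v1.
    exists (w.1 - 1); split; first by lra.
    by move=> v sv v1 /and4P[*]; exfalso; lra.
  have [e2 [e20 h2]] : exists e, 0 < e /\ forall v, strip n v -> 1 <= v.1 ->
      close e w v -> V (strip_map n s v).
    have [w1|w1] := leP 1 w.1.
      have uw := strip_unglued' n0 sw w1.
      have nV' : nbhs (q (s + h n%:Z) (unglue_a n w)) V.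
        by move: nV; rewrite strip_mapE.
      have [e e0 eV] := q_nbhs hq uw nV'.
      exists e; split=> // v sv v1 cv; rewrite strip_mapE //.
      apply: eV; first exact: strip_unglued' sv v1.
      by move: cv; rewrite /close /unglue_a /= => /and4P[*]; apply/and4P; split; lra.
    exists (1 - w.1); split; first by lra.
    by move=> v sv v1 /and4P[*]; exfalso; lra.
  have : nbhs w (close (Num.min e1 e2) w `&` strip n).
    apply: open_nbhs_nbhs; split; first by apply: openI; [exact: open_close|exact: open_strip].
    by split=> //; apply: close_refl; rewrite lt_min e10 e20.
  apply: filterS => v [cv sv].
  have [m1 m2] : Num.min e1 e2 <= e1 /\ Num.min e1 e2 <= e2.
    by rewrite !ge_min !lexx orbT.
  have /orP[v1|v1] := le_total v.1 1.
    exact: h1 sv v1 (close_le m1 cv).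
  exact: h2 sv v1 (close_le m2 cv).
- move=> W oW Ws; apply/(q_open hq) => t z uz [w Ww e].
  have sw := Ws _ Ww.
  have : nbhs w W by exact: open_nbhs_nbhs.
  move=> /nbhs_closeP[d d0 dW].
  have case1 : w.1 <= 1 -> t = s -> z = w -> exists2 e, 0 < e & forall v, unglued v ->
      close e z v -> (strip_map n s @` W) (q t v).
    move=> w1 -> ->; exists d => // v uv /dW Wv; exists v => //.
    have /andP[/andP[_ v1] _] := unglued_bounds uv.
    by rewrite /strip_map v1.
  have case2 : 1 <= w.1 -> t = s + h n%:Z -> z = unglue_a n w -> exists2 e, 0 < e &
      forall v, unglued v -> close e z v -> (strip_map n s @` W) (q t v).
    move=> w1 -> ->; exists d => // v uv cv.
    have Wv : W (glue_a n v).
      by apply: dW; move: cv; rewrite /close glue_aE // /unglue_a /= => /and4P[*]; apply/and4P; split; lra.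
    exists (glue_a n v) => //; rewrite strip_mapE ?glue_aK //; first exact: Ws.
    have /andP[/andP[v1 _] _] := unglued_bounds uv.
    by rewrite glue_aE //=; lra.
  have [w1|w1] := leP w.1 1.
    move: e; rewrite /strip_map w1 => /(q_eq hq _ _ (strip_unglued n0 sw w1) uz) c.
    have [ow|rw] := strip_left n0 sw w1.
      by have [ts zw] := cross_open_square ow c; apply: case1.
    have [[ts zw]|[zw ts]] := right_cross n0 rw c; first exact: case1.
    apply: case2 => //; first by have [-> _] := (rightP _ n0).1 rw.
    by rewrite ts Z2_addK.
  move: e; rewrite strip_mapE ?(ltW w1) // => /(q_eq hq _ _ (strip_unglued' n0 sw (ltW w1)) uz).
  by move=> /(cross_open_square (strip_right n0 sw w1))[ts zw]; apply: case2; rewrite ?(ltW w1).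
(* Back in the square, the two halves of the strip have first coordinates above and below 1/2, so
   they cannot meet except as prescribed. *)
- move=> w w' sw sw'.
  wlog : w w' sw sw' / w.1 <= w'.1.
    by move=> H; have /orP[le|le] := le_total w.1 w'.1; [exact: H|move=> /esym/(H _ _ sw' sw le)].
  move=> ww'; have [w1|w1] := leP w'.1 1.
    have w1' := le_trans ww' w1.
    rewrite /strip_map w1 w1' => /(q_eq hq _ _
      (strip_unglued n0 sw w1') (strip_unglued n0 sw' w1)) c.
    have [ow|rw] := strip_left n0 sw w1'; first by have [] := cross_open_square ow c.
    have [[]//|[e _]] := right_cross n0 rw c.
    have [e1 _] := (rightP _ n0).1 rw; have [sw1 _] := sw'.
    by exfalso; move: sw1; rewrite e /= e1; lra.
  rewrite (strip_mapE s n0 sw' (ltW w1)).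
  have os := strip_right n0 sw' w1.
  have [w1'|w1'] := leP w.1 1.
    rewrite /strip_map w1' => /esym/(q_eq hq _ _
      (strip_unglued' n0 sw' (ltW w1)) (strip_unglued n0 sw w1')).
    move=> /(cross_open_square os)[_ e].
    by have [s1 _] := sw; have [s2 _] := sw'; exfalso; move: s1; rewrite -e /=; lra.
  rewrite (strip_mapE s n0 sw (ltW w1')) => /esym/(q_eq hq _ _
      (strip_unglued' n0 sw' (ltW w1)) (strip_unglued' n0 sw (ltW w1'))).
  by move=> /(cross_open_square os)[_ /(congr1 (glue_a n))]; rewrite !unglue_aK.
Qed.

Lemma right_in_strip n s z : (0 < n)%N -> right_segment n z ->
  (strip_map n s @` strip n) (q s z).
Proof.
move=> n0 /(rightP _ n0)[z1 sz]; exists z; first by split=> //; lra.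
by rewrite /strip_map z1 lexx.
Qed.

Lemma left_in_strip n s z : (0 < n)%N -> left_segment n z ->
  (strip_map n (s + h n%:Z) @` strip n) (q s z).
Proof.
move=> n0 lz; have rw := left_glue_a n0 lz.
by have := right_in_strip (s + h n%:Z) n0 rw; rewrite (q_right hq _ n0 rw) Z2_addK glue_aK.
Qed.

End charts_of_two_sheets.

Variables (h : int -> 'Z_2) (Y : topologicalType) (q : 'Z_2 -> R * R -> Y).
Hypothesis hq : two_sheets h q.

Lemma two_sheets_surface : connected [set: Y] -> is_surface R Y.
Proof.
move=> cY.
pose qd s z := q s (diag z); have hqd := two_sheets_diag hq.
(* A countable atlas: the open square of each sheet, and in each sheet the strips across all [a_n]
   ([true]) and, through [diag], across all [b_n] ([false]). *)
pose P (i : 'Z_2 * option (bool * nat)) : set (R * R) :=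
  match i with (s, None) => @open_square R | (s, Some (_, n)) => strip n.+1 end.
pose f (i : 'Z_2 * option (bool * nat)) : R * R -> Y :=
  match i with (s, None) => q s
  | (s, Some (true, n)) => strip_map h q n.+1 s
  | (s, Some (false, n)) => strip_map (fun i => h (- i)) qd n.+1 s end.
have ch i : is_chart (P i) (f i).
  move: i => [s [[[] n]|]] /=.
  - exact: (strip_chart hq s (ltn0Sn n)).
  - exact: (strip_chart hqd s (ltn0Sn n)).
  - exact: (square_chart hq s).
have cov y : exists i, (f i @` P i) y.
  have [s [z [uz <-]]] := q_surj hq y.
  case: uz => [oz|[[//|k] /= k0 [[[lz|rz]|bz]|tz]]].
  - by exists (s, None) => /=; exists z.
  - by exists (s + h k.+1%:Z, Some (true, k)); exact: left_in_strip.
  - by exists (s, Some (true, k)); exact: right_in_strip.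
  - exists (s + h (- k.+1%:Z), Some (false, k)); rewrite -[z]diagK.
    by apply: (left_in_strip hqd s (n := k.+1) (z := diag z)) => //; exact/left_diag.
  - exists (s, Some (false, k)); rewrite -[z]diagK.
    by apply: (@right_in_strip _ _ qd k.+1 s (diag z)) => //; exact/right_diag.
split=> //.
- exact: q_hausdorff hq.
- exact: charts_second_countable ch cov.
- move=> y; have [i Uy] := cov y; have [g gP] := chart_homeo (ch i).
  have [oP _ of_ _] := ch i.
  by exists (f i @` P i), (P i), g; split=> //; exact: of_.
Qed.

End surface.

(** * Handles *)

Section connected_sets.
Context {Y : topologicalType}.

Lemma connectedP_component (E : set Y) y0 :
  E y0 -> (forall y, E y -> connected_component E y0 y) -> connected E.
Proof.
move=> Ey0 h; have -> : E = connected_component E y0.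
  by apply/seteqP; split=> [y /h//|]; exact: connected_component_sub.
exact: component_connected.
Qed.

(** A relatively clopen part [B] of the complement of [c] contains all or nothing of the connected
    set [H] minus [c]. In the first case [B] with [c] added is clopen in [U], in the second [B]
    itself is. *)
Lemma connected_setD_handle (U H c : set Y) :
  connected U -> open H -> closed c -> H `<=` U -> c `<=` H ->
  connected (H `\` c) -> connected (U `\` c).
Proof.
move=> cU oH clc HU cH cHc B B0 [W oW BW] [F clF BF].
have [Bsub|Hdis] : B `&` (H `\` c) = H `\` c \/ B `&` (H `\` c) = set0.
  have [->|/set0P Bne] := eqVneq (B `&` (H `\` c)) set0; first by right.
  left; apply: cHc => //.
    exists W => //; rewrite BW; apply/seteqP; split=> [x [[_ Wx] Hx]//|x [[Hx ncx] Wx]].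
    by split=> //; split=> //; split=> //; exact: HU.
  exists F => //; rewrite BF; apply/seteqP; split=> [x [[_ Fx] Hx]//|x [[Hx ncx] Fx]].
  by split=> //; split=> //; split=> //; exact: HU.
- have BcU : B `|` c = U.
    apply: cU; first by have [x Bx] := B0; exists x; left.
    + exists (W `|` H); first exact: openU.
      apply/seteqP; split=> [x [|cx]|x [Ux [Wx|Hx]]].
      * by rewrite BW => -[[Ux _] Wx]; split=> //; left.
      * by split; [exact/HU/cH|right; exact: cH].
      * by have [cx|ncx] := pselect (c x); [right|left; rewrite BW].
      * have [cx|ncx] := pselect (c x); [by right|left].
        have : (H `\` c) x by []. by rewrite -Bsub => -[].
    + exists (F `|` c); first exact: closedU.
      apply/seteqP; split=> [x [|cx]|x [Ux [Fx|cx]]].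
      * by rewrite BF => -[[Ux _] Fx]; split=> //; left.
      * by split; [exact/HU/cH|right].
      * by have [cx|ncx] := pselect (c x); [right|left; rewrite BF].
      * by right.
  rewrite -BcU setDUl setDv setU0; apply/esym/setDidPl.
  by apply/disjoints_subset; rewrite BW => x [[_ ncx] _] cx.
- have BU : B = U.
    apply: cU => //.
      exists (W `&` ~` c); first by apply: openI => //; exact: closed_openC.
      by rewrite BW; apply/seteqP; split=> [x [[Ux ncx] Wx]//|x [Ux [Wx ncx]]].
    exists (F `&` ~` H); first by apply: closedI => //; exact: open_closedC.
    apply/seteqP; split=> [x Bx|x [Ux [Fx nHx]]].
      have := Bx; rewrite {1}BF => -[[Ux ncx] Fx]; split=> //; split=> // Hx.
      suff : (B `&` (H `\` c)) x by rewrite Hdis.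
      by [].
    by rewrite BF; split=> //; split=> // /cH.
  rewrite -BU; apply/esym/setDidPl/disjoints_subset.
  by rewrite BW => x [[_ ncx] _] cx.
Qed.

Lemma closed_curve_closed {R : realType} (c : R -> Y) : hausdorff_space Y ->
  {within `[0, 1], continuous c} -> closed (c @` `[0, 1]).
Proof.
move=> hY cc; apply: compact_closed => //; apply: continuous_compact => //.
exact: segment_compact.
Qed.

(** The curves are removed one at a time. The handles are disjoint, so the next one is still intact
    in what remains. *)
Lemma genus_of_handles {R : realType} (U : set Y) (n : nat)
    (H : 'I_n -> set Y) (c : 'I_n -> R -> Y) :
  hausdorff_space Y -> connected U ->
  (forall i, [/\ open (H i), H i `<=` U, simple_closed_curve (c i),
     c i @` `[0, 1] `<=` H i & connected (H i `\` c i @` `[0, 1])]) ->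
  (forall i j, i != j -> H i `&` H j = set0) ->
  genus_ge (R := R) U n.
Proof.
move=> hY cU hH dH; exists c; split.
- by move=> i; have [_ HU sc cH _] := hH i; split=> //; exact: subset_trans cH HU.
- move=> i j _ _ [y [ci cj]]; apply/eqP; apply: contraT => /dH e.
  have [_ _ _ /(_ _ ci) Hi _] := hH i; have [_ _ _ /(_ _ cj) Hj _] := hH j.
  have : (H i `&` H j) y by [].
  by rewrite e.
suff main : forall s : seq 'I_n, uniq s ->
    connected (U `\` \bigcup_(i in [set` s]) c i @` `[0, 1]).
  have := main (enum 'I_n) (enum_uniq _); congr (connected (_ `\` _)).
  by apply/seteqP; split=> y [i _ ci]; exists i => //=; rewrite mem_enum.
elim=> [_|j s IH /= /andP[js us]].
  by rewrite set_nil bigcup_set0 setD0.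
have [oH HU [cc _ _] cH cHc] := hH j.
have -> : U `\` \bigcup_(i in [set` j :: s]) c i @` `[0, 1] =
    (U `\` \bigcup_(i in [set` s]) c i @` `[0, 1]) `\` c j @` `[0, 1].
  apply/seteqP; split=> y.
    move=> [Uy nc]; split; first split=> //.
      by move=> [i si ci]; apply: nc; exists i => //=; rewrite inE si orbT.
    by move=> cj; apply: nc; exists j => //=; rewrite inE eqxx.
  move=> [[Uy nc] ncj]; split=> // -[i /=]; rewrite inE => /orP[/eqP -> //|si ci].
  by apply: nc; exists i.
apply: (@connected_setD_handle _ (H j)) => //.
- exact: IH.
- exact: closed_curve_closed.
- move=> y Hy; split; first exact: HU.
  move=> [i /= si ci]; have [_ _ _ /(_ _ ci) Hi _] := hH i.
  have ij : i != j by apply: contraNneq js => <-.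
  have : (H i `&` H j) y by [].
  by rewrite dH.
Qed.

End connected_sets.

Section path_component.
Variables (R : realType) (h : int -> 'Z_2) (Y : topologicalType)
  (q : 'Z_2 -> R * R -> Y).
Hypothesis hq : two_sheets h q.

Lemma path_component (E : set Y) s (g : R -> R * R) : continuous g ->
  (forall t, 0 <= t <= 1 -> unglued (g t) /\ E (q s (g t))) ->
  connected_component E (q s (g 0)) (q s (g 1)).
Proof.
move=> cg gE; pose D := (q s \o g) @` `[0, 1]%classic.
exists D; last by exists 1 => //=; rewrite in_itv /= lexx ler01.
split; first by exists 0 => //=; rewrite in_itv /= lexx ler01.
  by move=> y [t /=]; rewrite in_itv /= => It <-; have [] := gE t It.
apply: connected_continuous_connected; first exact: segment_connected.
apply/subspace_continuousP => t; rewrite /= in_itv /= => It V nV.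
have [ug _] := gE t It.
have [e e0 eV] := q_nbhs hq ug nV.
have : nbhs t (g @^-1` close e (g t)).
  apply: cg; apply: open_nbhs_nbhs; split; first exact: open_close.
  exact: close_refl.
move=> nt; suff : nbhs t [set u | `[0, 1]%classic u -> V (q s (g u))] by [].
apply: filterS nt => u cu; rewrite /= in_itv /= => Iu.
by apply: eV => //; have [] := gE u Iu.
Qed.

Lemma segment_component (E : set Y) s z w :
  (forall t, 0 <= t <= 1 ->
     unglued ((1 - t) * z.1 + t * w.1, (1 - t) * z.2 + t * w.2) /\
     E (q s ((1 - t) * z.1 + t * w.1, (1 - t) * z.2 + t * w.2))) ->
  connected_component E (q s z) (q s w).
Proof.
move=> zwE; pose g t : R * R := ((1 - t) * z.1 + t * w.1, (1 - t) * z.2 + t * w.2).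
have g0 : g 0 = z.
  by rewrite /g subr0 !mul0r !mul1r !addr0; case: (z).
have g1 : g 1 = w.
  by rewrite /g subrr !mul0r !mul1r !add0r; case: (w).
rewrite -g0 -g1; apply: path_component => //.
by rewrite /g; continuity.
Qed.

End path_component.

(** * A one-holed torus across three segments *)

Section handle.
Variables (R : realType) (h : int -> 'Z_2) (k l m : nat) (g : 'Z_2) (d : R).
Hypotheses (k0 : (0 < k)%N) (kl : (k < l)%N) (lm : (l < m)%N).
Hypotheses (hk : h k%:Z = g) (hl : h l%:Z = g) (hm : h m%:Z = g).
Hypotheses (d0 : 0 < d) (d1 : d <= 1/2).
Implicit Types (z w : R * R) (s : 'Z_2) (n : nat).

Let l0 : (0 < l)%N. Proof. exact: leq_trans kl. Qed.
Let m0 : (0 < m)%N. Proof. exact: leq_trans lm. Qed.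
Let dyE : [/\ 2 * dy l <= dy k :> R, 2 * dy m <= dy l :> R,
  2 * dy k <= 1 :> R, 0 < dy m :> R & 0 < d <= 1 / 2].
Proof.
by split; [exact: dy_ltn|exact: dy_ltn|exact: dy_le_half|exact: dy_gt0|rewrite d0].
Qed.
Let rk : R := 3 / 2 * dy k.
Let rl : R := 3 / 2 * dy l.

(* The part of a handle near the right side; the part near the left side is
   its image under flip. *)
Definition handle_side : set (R * R) := [set z | [/\ 1 - d < z.1 <= 1,
  dy m < z.2 < 2 * dy k &
  z.1 < 1 \/ exists n, [/\ (0 < n)%N, h n%:Z = g, (k <= n <= m)%N,
    n = k \/ n = l \/ n = m & seg n z.2]]].

Let SR := handle_side.

(* On each strip the curve of the handle is the arc of the parabola
   z.1 = phi z.2 between the midpoints of two segments. *)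
Let phi (y : R) : R := 1 - d * ((y - rl) * (rk - y)).

(** The product is at most a quarter of the square of [rk - rl], and [rk - rl <= 1]. So the vertical
    line at [1 - d / 2] stays to the left of the arc. *)
Let phi_gt y : 1 - d / 2 < phi y.
Proof.
have [? ? ? ? ?] := dyE; rewrite /phi; have ab : (y - rl) * (rk - y) <= 1 / 4.
  have : 0 <= (2 * y - rl - rk) ^+ 2 by exact: sqr_ge0.
  have h1 : 0 <= rk - rl <= 1 by rewrite /rk /rl; lra.
  have : (rk - rl) ^+ 2 <= 1 by rewrite -(expr1n _ 2) lerXn2r ?nnegrE //; lra.
  rewrite !expr2; lra.
have dab : d * ((y - rl) * (rk - y)) <= d * (1 / 4) by rewrite ler_pM2l.
move: dab; set P := _ * (_ * _) => dab; lra.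
Qed.

Let phi_lt1 y : rl < y < rk -> phi y < 1.
Proof.
move=> /andP[y1 y2]; rewrite /phi.
have : 0 < d * ((y - rl) * (rk - y)) by rewrite !mulr_gt0 // subr_gt0.
lra.
Qed.

Let phi_gt1 y : y < rl \/ rk < y -> 1 < phi y.
Proof.
have [? ? ? ? ?] := dyE; move=> yy; rewrite /phi; have rlk : rl < rk by rewrite /rk /rl; lra.
suff : 0 < d * (- ((y - rl) * (rk - y))) by lra.
apply: mulr_gt0 => //; case: yy => yy.
  have : 0 < (rl - y) * (rk - y) by apply: mulr_gt0; lra.
  lra.
have : 0 < (y - rl) * (y - rk) by apply: mulr_gt0; lra.
lra.
Qed.

Let phil : phi rl = 1. Proof. by rewrite /phi subrr mul0r mulr0 subr0. Qed.
Let phik : phi rk = 1. Proof. by rewrite /phi subrr mulr0 mulr0 subr0. Qed.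

Let SR_right n z : (0 < n)%N -> SR z -> right_segment n z ->
  h n%:Z = g /\ (n = k \/ n = l \/ n = m).
Proof.
move=> n0 [_ _ [z1|[i [i0 hi _ ci si]]]] /(rightP _ n0)[z1' sn].
  by rewrite z1' ltxx in z1.
by rewrite (seg_inj sn si).
Qed.

Let SR_cases z : SR z -> open_square z \/ exists n, [/\ (0 < n)%N, right_segment n z,
  h n%:Z = g & n = k \/ n = l \/ n = m].
Proof.
have [? ? ? ? ?] := dyE; move=> [z1 z2 zz]; have [lt1|ge1] := ltP z.1 1.
  by left; apply/open_squareP; lra.
case: zz => [?|[n [n0 hn _ cn sn]]]; first by exfalso; lra.
by right; exists n; split=> //; apply/(rightP _ n0); split=> //; lra.
Qed.

Let SR_unglued z : SR z -> unglued z.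
Proof.
move=> /SR_cases[/open_square_unglued//|[n [n0 rz _ _]]].
by apply: (unglued_seg n0); right; left.
Qed.

Let SR_seg n (y : R) : (n = k \/ n = l \/ n = m) -> seg n y -> SR (1, y).
Proof.
move=> cn sn; have [n0 hn knm] : [/\ (0 < n)%N, h n%:Z = g & (k <= n <= m)%N].
  case: cn => [->|[->|->]]; split=> //.
  - by rewrite leqnn (ltnW (ltn_trans kl lm)).
  - by rewrite (ltnW kl) (ltnW lm).
  - by rewrite leqnn (ltnW (ltn_trans kl lm)).
have [? ? ? ? ?] := dyE; split=> /=; [lra| |right; exists n; split=> //].
move: sn; rewrite /seg; case: cn => [->|[->|->]]; lra.
Qed.

Let SR_open z : SR z -> exists2 e, 0 < e & forall w, unglued w -> close e z w -> SR w.
Proof.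
move=> [z1 z2 zz]; have [? ? ? ? ?] := dyE.
pose e1 := Num.min (z.1 - (1 - d)) (Num.min (z.2 - dy m) (2 * dy k - z.2)).
have e10 : 0 < e1 by rewrite /e1 !lt_min; lra.
have [b1 b2 b3] : [/\ e1 <= z.1 - (1 - d), e1 <= z.2 - dy m & e1 <= 2 * dy k - z.2].
  by rewrite /e1 !ge_min !lexx !orbT.
have base w e : unglued w -> e <= e1 -> close e z w ->
    1 - d < w.1 <= 1 /\ dy m < w.2 < 2 * dy k.
  by move=> /unglued_bounds uw ee /and4P[*]; lra.
have [lt1|ge1] := ltP z.1 1.
  exists (Num.min e1 (1 - z.1)); first by rewrite lt_min e10 subr_gt0.
  have [c1 c2] : Num.min e1 (1 - z.1) <= e1 /\ Num.min e1 (1 - z.1) <= 1 - z.1.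
    by split; rewrite ge_min lexx ?orbT.
  move=> w uw cw; have [? ?] := base w _ uw c1 cw; split=> //; left.
  by move: cw => /and4P[*]; lra.
case: zz => [?|[n [n0 hn kn cn sn]]]; first by exfalso; lra.
have /andP[s1 s2] := sn.
pose e2 := Num.min (z.2 - dy n) (2 * dy n - z.2).
exists (Num.min e1 e2); first by rewrite lt_min e10 /e2 lt_min; lra.
have [c1 c2] : Num.min e1 e2 <= e1 /\ Num.min e1 e2 <= e2.
  by split; rewrite ge_min lexx ?orbT.
have [c3 c4] : e2 <= z.2 - dy n /\ e2 <= 2 * dy n - z.2.
  by rewrite /e2 !ge_min !lexx orbT.
move=> w uw cw; have [? ?] := base w _ uw c1 cw; split=> //; right.
by exists n; split=> //; move: cw => /and4P[*]; rewrite /seg; lra.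
Qed.

Let arc : set (R * R) := [set z | rl <= z.2 <= rk /\ z.1 = phi z.2].

Let arc_SR z : arc z -> SR z.
Proof.
move=> [/andP[z2 z2'] z1]; have := phi_gt z.2; rewrite -z1 => z1'.
have [e|z2l] := eqVneq z.2 rl.
  rewrite [z]surjective_pairing z1 e phil; apply: (@SR_seg l); first by right; left.
  exact: seg_mid.
have [e|z2k] := eqVneq z.2 rk.
  rewrite [z]surjective_pairing z1 e phik; apply: (@SR_seg k); first by left.
  exact: seg_mid.
have y12 : rl < z.2 < rk by rewrite !lt_neqAle eq_sym z2l z2k z2 z2'.
have := phi_lt1 y12; rewrite -z1 => z1''.
split; [lra| |by left].
by have [? ? ? ? ?] := dyE; move: y12; rewrite /rl /rk; lra.
Qed.

(** Outside the heights between [rl] and [rk] the parabola leaves the square. *)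
Let arc_phi z : SR z -> z.1 = phi z.2 -> arc z.
Proof.
move=> [z1 _ _] e; split=> //; rewrite !leNgt; apply/andP; split; apply/negP => c.
  by have := phi_gt1 (or_introl c); rewrite -e; lra.
by have := phi_gt1 (or_intror c); rewrite -e; lra.
Qed.

(** When the left strip is drawn through [flip], crossing [a_n] becomes the reflection of the
    segment in its midpoint. Both strips then share one picture, and the midpoints are fixed. *)
Definition mirror n z : R * R := (z.1, 3 * dy n - z.2).

Lemma flip_unglue_a n z : z.1 = 1 -> flip (unglue_a n z) = mirror n z.
Proof. by move=> z1; rewrite /flip /unglue_a /mirror /= z1; congr pair; lra. Qed.

Let SR_mirror n z : (0 < n)%N -> SR z -> right_segment n z -> SR (mirror n z).
Proof.
move=> n0 sz rz; have [_ cn] := SR_right n0 sz rz.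
have [z1 sn] := (rightP _ n0).1 rz.
by rewrite /mirror z1; apply: (SR_seg cn); rewrite seg_sym.
Qed.

(** The arc meets the side only at the midpoints of the segments [l] and [k]. *)
Let arc_mirror n z : (0 < n)%N -> arc z -> right_segment n z -> arc (mirror n z).
Proof.
move=> n0 az /(rightP _ n0)[z1 sn]; have [z2 e] := az.
have e1 : phi z.2 = 1 by rewrite -e.
have {e1} [e1|e1] : z.2 = rl \/ z.2 = rk.
  have [?|nl] := eqVneq z.2 rl; first by left.
  have [?|nk] := eqVneq z.2 rk; first by right.
  have : rl < z.2 < rk by rewrite !lt_neqAle eq_sym nl nk.
  by move=> /phi_lt1; rewrite e1 ltxx.
- have nl : n = l by apply: seg_inj sn _; rewrite e1; exact: seg_mid.
  have -> : mirror n z = z; last by [].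
  by rewrite [RHS]surjective_pairing /mirror nl e1 /rl; congr pair; lra.
- have nk : n = k by apply: seg_inj sn _; rewrite e1; exact: seg_mid.
  have -> : mirror n z = z; last by [].
  by rewrite [RHS]surjective_pairing /mirror nk e1 /rk; congr pair; lra.
Qed.

Section in_surface.
Variables (Y : topologicalType) (q : 'Z_2 -> R * R -> Y).
Hypothesis hq : two_sheets h q.
Let q' s z := q s (flip z).
Let hq' : two_sheets h q' := two_sheets_flip hq.

Let glued_stable (A : set (R * R)) := A `<=` SR /\
  forall n z, (0 < n)%N -> A z -> right_segment n z -> A (mirror n z).

Let q_mirror n s z : (0 < n)%N -> h n%:Z = g -> right_segment n z ->
  q s z = q' (s + g) (mirror n z).
Proof.
move=> n0 hn rz; rewrite (q_right hq s n0 rz) hn /q'.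
by rewrite -flip_unglue_a ?flipK //; have [] := (rightP _ n0).1 rz.
Qed.

(** The same picture [A] in the right strip of the sheet [s] and in the flipped left strip of the
    sheet on the other side. *)
Let two_sided (A : set (R * R)) s := q s @` A `|` q' (s + g) @` A.

(** Stability under [mirror] makes the image saturated: crossing a segment leads from one copy of
    [A] into the other. *)
Let two_sided_pre A s t z : glued_stable A -> unglued z ->
  two_sided A s (q t z) -> (t = s /\ A z) \/ (t = s + g /\ A (flip z)).
Proof.
move=> [AS Am] uz [[w Aw e]|[w Aw e]].
  have uw := SR_unglued (AS _ Aw).
  move: e => /(q_eq hq _ _ uw uz) c.
  case: (SR_cases (AS _ Aw)) => [ow|[n [n0 rw hn _]]].
    by have [st wz] := cross_open_square ow c; left; rewrite -wz.
  have [[-> <-]|[-> st]] := right_cross n0 rw c; first by left.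
  right; split; first by rewrite st hn Z2_addK.
  by rewrite flip_unglue_a; [exact: Am|have [] := (rightP _ n0).1 rw].
have uw := SR_unglued (AS _ Aw).
move: e; rewrite -{1}[z]flipK -/(q' _ _) => /(q_eq hq' _ _ uw (unglued_flip uz)) c.
case: (SR_cases (AS _ Aw)) => [ow|[n [n0 rw hn _]]].
  by have [st wz] := cross_open_square ow c; right; rewrite -wz.
have [[<- <-]|[e st]] := right_cross n0 rw c; first by right.
left; split; first by move: st; rewrite hn => /(congr1 (fun x => x + g)); rewrite !Z2_addK.
have -> : z = mirror n w; last exact: Am.
by rewrite -flip_unglue_a -?e ?flipK //; have [] := (rightP _ n0).1 rw.
Qed.

Definition handle s := two_sided SR s.

Lemma handle_pre s t z : unglued z -> handle s (q t z) ->
  (t = s /\ handle_side z) \/ (t = s + g /\ handle_side (flip z)).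
Proof. by apply: two_sided_pre; split=> // n w n0; exact: SR_mirror. Qed.

Lemma handle_open s : open (handle s).
Proof.
apply/(q_open hq) => t z uz /handle_pre[//|[-> Sz]|[-> Sz]].
  have [e e0 eS] := SR_open Sz; exists e => // w uw cw.
  by left; exists w => //; exact: eS.
have [e e0 eS] := SR_open Sz; exists e => // w uw cw.
right; exists (flip w); last by rewrite /q' flipK.
by apply: eS; [exact: unglued_flip|rewrite close_flip].
Qed.

Let v1 (t : R) := rl + 2 * t * (rk - rl).
Let v2 (t : R) := rk - (2 * t - 1) * (rk - rl).

(** Up the arc in the right strip from [a_l] to [a_k], across [a_k], then down the arc in the left
    strip and back across [a_l]. *)
Definition handle_curve s (t : R) : Y :=
  if t <= 2^-1 then q s (phi (v1 t), v1 t) else q' (s + g) (phi (v2 t), v2 t).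

Let rlk : 0 < rk - rl. Proof. by have [? ? ? ? ?] := dyE; rewrite /rk /rl; lra. Qed.

Let arc_v1 (t : R) : 0 <= t <= 2^-1 -> arc (phi (v1 t), v1 t).
Proof.
move=> t01; split=> //=; rewrite /v1.
have rlk0 := rlk.
have : 0 <= 2 * t * (rk - rl) by apply: mulr_ge0; lra.
have : 0 <= (1 - 2 * t) * (rk - rl) by apply: mulr_ge0; lra.
lra.
Qed.

Let arc_v2 (t : R) : 2^-1 <= t <= 1 -> arc (phi (v2 t), v2 t).
Proof.
move=> t01; split=> //=; rewrite /v2.
have rlk0 := rlk.
have : 0 <= (2 * t - 1) * (rk - rl) by apply: mulr_ge0; lra.
have : 0 <= (2 - 2 * t) * (rk - rl) by apply: mulr_ge0; lra.
lra.
Qed.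

Let arc_stable : glued_stable arc.
Proof. by split=> [z /arc_SR|n z n0] //; exact: arc_mirror. Qed.

Let q_k s : q s (1, rk) = q' (s + g) (1, rk).
Proof.
rewrite (q_mirror s k0 hk); last by apply/(rightP _ k0); split=> //; exact: seg_mid.
by congr q'; congr pair; rewrite /rk /=; lra.
Qed.

Let q_l s : q s (1, rl) = q' (s + g) (1, rl).
Proof.
rewrite (q_mirror s l0 hl); last by apply/(rightP _ l0); split=> //; exact: seg_mid.
by congr q'; congr pair; rewrite /rl /=; lra.
Qed.

Let curve_image s : handle_curve s @` `[0, 1] = two_sided arc s.
Proof.
have rlk0 := rlk.
apply/seteqP; split=> [_ [t /= + <-]|y [[z [z2 z1] <-]|[z [z2 z1] <-]]].
- rewrite in_itv /= /handle_curve => t01; case: ifP => t2.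
    by left; exists (phi (v1 t), v1 t) => //; apply: arc_v1; lra.
  by right; exists (phi (v2 t), v2 t) => //; apply: arc_v2; lra.
- pose t := (z.2 - rl) / (rk - rl) / 2.
  have e : v1 t = z.2 by rewrite /v1 /t; field; lra.
  have t0 : 0 <= t by rewrite /t !divr_ge0 //; lra.
  have t1 : t <= 2^-1.
    by rewrite /t -[leRHS]mul1r ler_pM2r ?invr_gt0 // ler_pdivrMr //; lra.
  exists t; first by rewrite /= in_itv /= t0; lra.
  by rewrite /handle_curve t1 e -z1 -surjective_pairing.
(* The upper end is reached at time 1/2, where the first branch of [handle_curve] is in force, hence
   [q_k]. *)
- have [e|z2k] := eqVneq z.2 rk.
    have -> : z = (1, rk) by rewrite [z]surjective_pairing z1 e phik.
    exists 2^-1; first by rewrite /= in_itv /=; lra.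
    rewrite /handle_curve lexx -q_k; congr q.
    have -> : v1 2^-1 = rk by rewrite /v1; lra.
    by rewrite phik.
  pose t := (1 + (rk - z.2) / (rk - rl)) / 2.
  have e : v2 t = z.2 by rewrite /v2 /t; field; lra.
  have t0 : 0 < (rk - z.2) / (rk - rl).
    by rewrite divr_gt0 // subr_gt0 lt_neqAle z2k; case/andP: z2.
  have t1 : (rk - z.2) / (rk - rl) <= 1 by rewrite ler_pdivrMr //; lra.
  exists t; first by rewrite /= in_itv /= /t; lra.
  have t2 : (t <= 2^-1) = false by apply/negP; rewrite /t; lra.
  by rewrite /handle_curve t2 e -z1 -surjective_pairing.
Qed.

(** The bound [d <= 1/2] keeps the right strip and the left strip of the same sheet disjoint. *)
Let half_lt z : SR z -> 1 / 2 < z.1.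
Proof. by have [? ? ? ? ?] := dyE; move=> [? _ _]; lra. Qed.

Let q_inj (r : 'Z_2 -> R * R -> Y) t z w : two_sheets h r -> SR z -> SR w ->
  r t z = r t w -> z = w.
Proof.
move=> hr Sz Sw /(q_eq hr _ _ (SR_unglued Sz) (SR_unglued Sw)) c.
case: (SR_cases Sz) => [oz|[n [n0 rz _ _]]]; first by have [] := cross_open_square oz c.
have [[]//|[e _]] := right_cross n0 rz c; exfalso.
have [z1 _] := (rightP _ n0).1 rz.
by have := half_lt Sw; rewrite e /= z1; lra.
Qed.

Lemma handle_curve_simple s : simple_closed_curve (handle_curve s).
Proof.
have rlk0 := rlk; have v1_0 : v1 0 = rl by rewrite /v1; lra.
have v1_h : v1 2^-1 = rk by rewrite /v1; lra.
have v2_1 : v2 1 = rl by rewrite /v2; lra.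
have v2_h : v2 2^-1 = rk by rewrite /v2; lra.
split.
- pose a1 (t : R) : R * R := (phi (v1 (clamp 0 2^-1 t)), v1 (clamp 0 2^-1 t)).
  pose a2 (t : R) : R * R := (phi (v2 (clamp 2^-1 1 t)), v2 (clamp 2^-1 1 t)).
  have h1 : (0 : R) <= 2^-1 by lra.
  have h2 : (2^-1 : R) <= 1 by lra.
  have ua1 (t : R) : unglued (a1 t) by apply/SR_unglued/arc_SR/arc_v1; exact: clamp_itv.
  have ua2 (t : R) : unglued (a2 t) by apply/SR_unglued/arc_SR/arc_v2; exact: clamp_itv.
  have ca1 : continuous a1 by rewrite /a1 /phi /v1; continuity.
  have ca2 : continuous a2 by rewrite /a2 /phi /v2; continuity.
  have cc : continuous (fun t : R => if t <= 2^-1 then q s (a1 t) else q' (s + g) (a2 t)).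
    apply: (@paste_continuous R Y (q s \o a1) (q' (s + g) \o a2)).
    + exact: continuous_within_comp (q_within hq (s := s)) ua1 ca1.
    + exact: continuous_within_comp (q_within hq' (s := s + g)) ua2 ca2.
    + rewrite /= /a1 /a2 !clamp_id ?lexx ?h1 ?h2 // v1_h v2_h phik.
      exact: q_k.
  apply: subspace_eq_continuous (continuous_subspaceT cc) => t.
  rewrite inE /= in_itv /= => t01; rewrite /from_subspace /handle_curve.
  case: ifP => t2; rewrite /a1 /a2 clamp_id //; first by lra.
  by have : 2^-1 < t; [rewrite ltNge t2|lra].
- have h1 : (0 : R) <= 2^-1 by lra.
  have h2 : (1 <= 2^-1 :> R) = false by apply/negP; lra.
  by rewrite /handle_curve h1 h2 v1_0 v2_1 phil; exact: q_l.
move=> t t'; wlog : t t' / t <= t'.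
  move=> H It It'; have /orP[le|le] := le_total t t'; first exact: H.
  by move=> e; apply/esym/H.
move=> tt'; rewrite /= !in_itv /= /handle_curve => It It'.
(* Away from its ends, the returning half of the curve lies in the open left strip, where first
   coordinates are below 1/2. *)
have mixed z z' : arc z -> arc z' -> z'.1 < 1 -> q s z <> q' (s + g) z'.
  move=> az az' z'1; have Sz := arc_SR az; have Sz' := arc_SR az'.
  have oz' : open_square z'.
    by case: (SR_cases Sz') => // -[n [n0 /(rightP _ n0)[e _] _ _]]; exfalso; lra.
  move=> /esym; rewrite /q' => /(q_eq hq _ _ (unglued_flip (SR_unglued Sz')) (SR_unglued Sz)).
  move=> /(cross_open_square ((open_square_flip _).2 oz'))[_ e].
  by have := half_lt Sz; have := half_lt Sz'; rewrite -e /=; lra.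
case: ifP => t2; case: ifP => t2'.
- move=> /(q_inj hq (arc_SR (arc_v1 _)) (arc_SR (arc_v1 _))) e.
  have : (phi (v1 t), v1 t) = (phi (v1 t'), v1 t') by apply: e; lra.
  move=> [_]; rewrite /v1 => /addrI; rewrite -!mulrA => /(mulfI _) /= e2.
  have /mulIf e3 : rk - rl != 0 by lra.
  by apply: e3; apply: e2; lra.
- move=> e; exfalso; move: e; apply: mixed.
  + by apply: arc_v1; lra.
  + by apply: arc_v2; have : 2^-1 < t'; [rewrite ltNge t2'|lra].
  + have t3 : 2^-1 < t' by rewrite ltNge t2'.
    apply: phi_lt1; rewrite /v2.
    have : 0 < (2 * t' - 1) * (rk - rl) by apply: mulr_gt0; lra.
    have : 0 < (2 - 2 * t') * (rk - rl) by apply: mulr_gt0; lra.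
    lra.
- by exfalso; move: t2; rewrite (le_trans tt' t2').
- have t3 : 2^-1 < t by rewrite ltNge t2.
  have t3' : 2^-1 < t' by rewrite ltNge t2'.
  move=> /(q_inj hq' (arc_SR (arc_v2 _)) (arc_SR (arc_v2 _))) e.
  have : (phi (v2 t), v2 t) = (phi (v2 t'), v2 t') by apply: e; lra.
  move=> [_]; rewrite /v2 => /addrI/oppr_inj.
  have /mulIf e3 : rk - rl != 0 by lra.
  by move=> /e3; lra.
Qed.

Lemma handle_curve_sub s : handle_curve s @` `[0, 1] `<=` handle s.
Proof.
by rewrite curve_image => y [[z /arc_SR Sz <-]|[z /arc_SR Sz <-]];
  [left|right]; exists z.
Qed.

(** Here [r] is [q] or [q']. Points to the left of the arc move horizontally to the line at
    [1 - d / 2], which meets every height of the strip. *)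
Let comp_out (r : 'Z_2 -> R * R -> Y) t (E : set Y) z w : two_sheets h r ->
  (forall v, SR v -> v.1 <> phi v.2 -> E (r t v)) ->
  SR z -> z.1 < phi z.2 -> SR w -> w.1 < phi w.2 ->
  connected_component E (r t z) (r t w).
Proof.
move=> hr hE; have [? ? ? ? dd] := dyE.
have inE_ v : SR v -> v.1 < phi v.2 -> unglued v /\ E (r t v).
  by move=> Sv lv; split; [exact: SR_unglued|apply: hE => // e; rewrite e ltxx in lv].
have base v : SR v -> v.1 < phi v.2 ->
    connected_component E (r t v) (r t (1 - d / 2, v.2)).
  move=> [v1' v2' v3] lv; apply: (segment_component hr) => u u01 /=.
  have vE : (1 - u) * v.2 + u * v.2 = v.2 by lra.
  rewrite vE; have := phi_gt v.2 => pv.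
  have b1 : 0 <= (1 - u) * (v.1 - (1 - d)) by apply: mulr_ge0; lra.
  have b2 : 0 <= u * (1 - (1 - d / 2)) by apply: mulr_ge0; lra.
  have b3 : 0 <= (1 - u) * (1 - v.1) by apply: mulr_ge0; lra.
  have [u1|u1] := eqVneq u 0.
    rewrite u1 subr0 mul1r mul0r addr0 -surjective_pairing.
    by apply: inE_.
  have b4 : 0 < u * (phi v.2 - (1 - d / 2)) by apply: mulr_gt0; lra.
  have b5 : 0 <= (1 - u) * (phi v.2 - v.1) by apply: mulr_ge0; lra.
  have b6 : 0 < u * d by apply: mulr_gt0; lra.
  have b7 : 0 <= u * (1 - d) by apply: mulr_ge0; lra.
  apply: inE_ => /=; last by lra.
  by split=> //=; [lra|left; lra].
move=> Sz lz Sw lw; apply: connected_component_trans (base z Sz lz) _.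
apply: connected_component_sym; apply: connected_component_trans (base w Sw lw) _.
apply: (segment_component hr) => u u01 /=.
have uE : (1 - u) * (1 - d / 2) + u * (1 - d / 2) = 1 - d / 2 by lra.
rewrite uE; have [_ z2 _] := Sz; have [_ w2 _] := Sw.
have b1 : 0 <= (1 - u) * (w.2 - dy m) by apply: mulr_ge0; lra.
have b2 : 0 <= (1 - u) * (2 * dy k - w.2) by apply: mulr_ge0; lra.
have b3 : 0 <= u * (z.2 - dy m) by apply: mulr_ge0; lra.
have b4 : 0 <= u * (2 * dy k - z.2) by apply: mulr_ge0; lra.
apply: inE_; last exact: phi_gt.
split=> /=; [lra| |left; lra].
have [u0|u0] := eqVneq u 0; first by rewrite u0 subr0 mul1r mul0r addr0.
have b5 : 0 < u * (z.2 - dy m) by apply: mulr_gt0; lra.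
have b6 : 0 < u * (2 * dy k - z.2) by apply: mulr_gt0; lra.
lra.
Qed.

(** No vertical line crosses the whole region between the arc and the side, so the common path [mid]
    runs half-way between them. *)
Let comp_in (r : 'Z_2 -> R * R -> Y) t (E : set Y) z w : two_sheets h r ->
  (forall v, SR v -> v.1 <> phi v.2 -> E (r t v)) ->
  SR z -> phi z.2 < z.1 -> SR w -> phi w.2 < w.1 ->
  connected_component E (r t z) (r t w).
Proof.
move=> hr hE; have [? ? ? ? dd] := dyE.
have inE_ v : SR v -> phi v.2 < v.1 -> unglued v /\ E (r t v).
  by move=> Sv lv; split; [exact: SR_unglued|apply: hE => // e; rewrite e ltxx in lv].
have range v : SR v -> phi v.2 < v.1 -> rl < v.2 < rk.
  move=> [v1' _ _] lv; have le1 : phi v.2 < 1 by lra.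
  have n1 : v.2 <> rl by move=> e; move: le1; rewrite e phil ltxx.
  have n2 : v.2 <> rk by move=> e; move: le1; rewrite e phik ltxx.
  rewrite !lt_neqAle eq_sym; apply/andP; split; apply/andP; split; try exact/eqP;
    rewrite leNgt; apply/negP => c.
    by have := phi_gt1 (or_introl c); lra.
  by have := phi_gt1 (or_intror c); lra.
pose mid y := (1 + phi y) / 2.
have midSR y : rl < y < rk -> SR (mid y, y).
  move=> yr; have := phi_gt y; have := phi_lt1 yr => p1 p2.
  split=> /=; rewrite ?/mid; [lra| |left; lra].
  by move: yr; rewrite /rl /rk; lra.
have base v : SR v -> phi v.2 < v.1 ->
    connected_component E (r t v) (r t (mid v.2, v.2)).
  move=> Sv lv; have rv := range v Sv lv; have p1 := phi_lt1 rv.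
  have [v1' v2' v3] := Sv; apply: (segment_component hr) => u u01 /=.
  have vE : (1 - u) * v.2 + u * v.2 = v.2 by lra.
  rewrite vE; have := phi_gt v.2 => pv.
  have [u1|u1] := eqVneq u 0.
    rewrite u1 subr0 mul1r mul0r addr0 -surjective_pairing.
    exact: inE_.
  have b1 : 0 <= (1 - u) * (v.1 - phi v.2) by apply: mulr_ge0; lra.
  have b2 : 0 < u * (1 - phi v.2) by apply: mulr_gt0; lra.
  have b3 : 0 <= (1 - u) * (1 - v.1) by apply: mulr_ge0; lra.
  apply: inE_ => /=; rewrite /mid; last by lra.
  by split=> //=; [lra|left; lra].
move=> Sz lz Sw lw; apply: connected_component_trans (base z Sz lz) _.
apply: connected_component_sym; apply: connected_component_trans (base w Sw lw) _.
pose y u := (1 - u) * w.2 + u * z.2.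
pose a u : R * R := (mid (y u), y u).
have -> : (mid w.2, w.2) = a 0 by rewrite /a /y subr0 mul1r mul0r addr0.
have -> : (mid z.2, z.2) = a 1 by rewrite /a /y subrr mul1r mul0r add0r.
apply: (path_component hr) => [|u u01].
  by rewrite /a /mid /phi /y; continuity.
have ry : rl < y u < rk.
  have := range z Sz lz; have := range w Sw lw => rw rz; rewrite /y.
  have b1 : 0 <= (1 - u) * (w.2 - rl) by apply: mulr_ge0; lra.
  have b2 : 0 <= (1 - u) * (rk - w.2) by apply: mulr_ge0; lra.
  have [u0|u0] := eqVneq u 0; first by rewrite u0 subr0 mul1r mul0r addr0.
  have b5 : 0 < u * (z.2 - rl) by apply: mulr_gt0; lra.
  have b6 : 0 < u * (rk - z.2) by apply: mulr_gt0; lra.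
  lra.
by apply: inE_; [exact: midSR|have := phi_lt1 ry; rewrite /a /mid /=; lra].
Qed.

(** The arcs cut the two strips into four regions. The two outer ones are joined across [a_m].
    Across [a_l], the height 7/4 [dy l], inside the arc, is mirrored to 5/4 [dy l], outside it; this
    joins each inner region to the outer region of the other strip. *)
Lemma handle_curve_compl_connected s :
  connected (handle s `\` handle_curve s @` `[0, 1]).
Proof.
rewrite curve_image; set E := _ `\` _; have [? ? ? ? dd] := dyE.
have flip_half z : SR z -> ~ arc (flip z).
  by move=> /half_lt z1 /arc_SR/half_lt /=; lra.
have Eq z : SR z -> z.1 <> phi z.2 -> E (q s z).
  move=> Sz nz; split; first by left; exists z.
  move=> /(two_sided_pre arc_stable (SR_unglued Sz))[[_ [_]]//|[_]].
  exact: flip_half.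
have Eq' z : SR z -> z.1 <> phi z.2 -> E (q' (s + g) z).
  move=> Sz nz; split; first by right; exists z.
  move=> /(two_sided_pre arc_stable (unglued_flip (SR_unglued Sz)))[[_]|[_]].
    exact: flip_half.
  by rewrite flipK => -[_].
have p54 : (5 / 4 * dy l : R) < phi (5 / 4 * dy l) /\ 1 < phi (5 / 4 * dy l).
  have : 1 < phi (5 / 4 * dy l) by apply: phi_gt1; left; rewrite /rl; lra.
  by move=> ?; split=> //; lra.
have p74 : phi (7 / 4 * dy l) < 1 by apply: phi_lt1; rewrite /rl /rk; lra.
have pm : 1 < phi (3 / 2 * dy m) by apply: phi_gt1; left; rewrite /rl; lra.
have S54 : SR (1, 5 / 4 * dy l).
  by apply: (@SR_seg l); [right; left|rewrite /seg; lra].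
have S74 : SR (1, 7 / 4 * dy l).
  by apply: (@SR_seg l); [right; left|rewrite /seg; lra].
have Sm : SR (1, 3 / 2 * dy m).
  by apply: (@SR_seg m); [right; right|exact: seg_mid].
have q54 : q s (1, 5 / 4 * dy l) = q' (s + g) (1, 7 / 4 * dy l).
  rewrite (q_mirror s l0 hl); last by apply/(rightP _ l0); split=> //=; rewrite /seg; lra.
  by congr q'; congr pair => /=; lra.
have q74 : q s (1, 7 / 4 * dy l) = q' (s + g) (1, 5 / 4 * dy l).
  rewrite (q_mirror s l0 hl); last by apply/(rightP _ l0); split=> //=; rewrite /seg; lra.
  by congr q'; congr pair => /=; lra.
have qm : q s (1, 3 / 2 * dy m) = q' (s + g) (1, 3 / 2 * dy m).
  rewrite (q_mirror s m0 hm); last by apply/(rightP _ m0); split=> //=; exact: seg_mid.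
  by congr q'; congr pair => /=; lra.
have out z w := @comp_out q s E z w hq Eq.
have out' z w := @comp_out q' (s + g) E z w hq' Eq'.
have in_ z w := @comp_in q s E z w hq Eq.
have in' z w := @comp_in q' (s + g) E z w hq' Eq'.
have trans := @connected_component_trans Y E.
have o' w : SR w -> w.1 < phi w.2 ->
    connected_component E (q s (1, 3 / 2 * dy m)) (q' (s + g) w).
  by move=> Sw lw; rewrite qm; exact: out'.
apply: (@connectedP_component _ _ (q s (1, 3 / 2 * dy m))).
  by apply: Eq => //= e; rewrite -e ltxx in pm.
move=> y [[[z Sz <-]|[z Sz <-]] nc].
- have [lt|gt|e] := ltgtP z.1 (phi z.2).
  + exact: out.
  + apply: (trans (q s (1, 7 / 4 * dy l))); last exact: in_.
    by rewrite q74; apply: o' => //; have [] := p54.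
  + by case: nc; left; exists z => //; exact: arc_phi.
- have [lt|gt|e] := ltgtP z.1 (phi z.2).
  + exact: o'.
  + apply: (trans (q' (s + g) (1, 7 / 4 * dy l))); last exact: in'.
    by rewrite -q54; apply: out => //; have [] := p54.
  + by case: nc; right; exists z => //; exact: arc_phi.
Qed.

End in_surface.
End handle.

(* The indices k < l < m crossed by a handle, its sheet and its width. *)
Record handle_data (R : realType) := HandleData {
  hd_k : nat; hd_l : nat; hd_m : nat; hd_s : 'Z_2; hd_d : R }.

Section handles.
Variables (R : realType) (h : int -> 'Z_2) (Y : topologicalType)
  (q : 'Z_2 -> R * R -> Y).
Hypothesis hq : two_sheets h q.
Implicit Types (D : handle_data R).

Definition valid_handle D : Prop :=
  [/\ (0 < hd_k D < hd_l D)%N, (hd_l D < hd_m D)%N,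
      h (hd_k D)%:Z = h (hd_m D)%:Z, h (hd_l D)%:Z = h (hd_m D)%:Z &
      0 < hd_d D <= 1 / 2].

Definition handle_of D : set Y :=
  handle h (hd_k D) (hd_l D) (hd_m D) (h (hd_m D)%:Z) (hd_d D) q (hd_s D).

(** Strips on the same side occupy disjoint ranges of heights, since
    [2 * dy (hd_k D') <= dy (hd_m D)]; strips on opposite sides are separated by the line at 1/2. *)
Lemma handle_of_disjoint D D' : valid_handle D -> valid_handle D' ->
  (hd_m D < hd_k D')%N -> handle_of D `&` handle_of D' = set0.
Proof.
move=> [/andP[k0 kl] lm hk hl /andP[d0 d1]] [/andP[k0' kl'] lm' hk' hl' /andP[d0' d1']] mk.
rewrite -subset0 => y [Hy H'y]; have [t [z [uz yz]]] := q_surj hq y.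
have := dy_ltn R mk => dmk; rewrite -yz in Hy H'y.
have [[_ [a1 a2 _]]|[_ [/= a1 a2 _]]] := handle_pre k0 kl lm hk hl erefl d0 d1 hq uz Hy;
have [[_ [b1 b2 _]]|[_ [/= b1 b2 _]]] := handle_pre k0' kl' lm' hk' hl' erefl d0' d1' hq uz H'y;
  by exfalso; clear hk hl hk' hl'; lra.
Qed.

Lemma genus_of_handle_sequence (U : set Y) : connected U ->
  (forall N, exists D, [/\ valid_handle D, (N < hd_k D)%N & handle_of D `<=` U]) ->
  infinite_genus (R := R) U.
Proof.
move=> cU /choice[F FP] n.
(* [N i.+1] is the last index of the handle chosen beyond [N i], so successive handles use
   increasing, disjoint ranges of indices. *)
pose N := fix N i := if i is j.+1 then hd_m (F (N j)) else 0%N.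
have N_lt i : (N i < N i.+1)%N.
  have [[/andP[_ kl] lm _ _ _] Nk _] := FP (N i).
  exact: ltn_trans Nk (ltn_trans kl lm).
have N_mono i j : (i <= j)%N -> (N i <= N j)%N.
  elim: j => [|j IH]; first by rewrite leqn0 => /eqP ->.
  rewrite leq_eqVlt => /orP[/eqP -> //|]; rewrite ltnS => /IH le.
  exact: leq_trans le (ltnW (N_lt j)).
apply: (@genus_of_handles _ _ U n (fun i : 'I_n => handle_of (F (N i)))
  (fun i => let D := F (N i) in handle_curve (hd_k D) (hd_l D)
     (h (hd_m D)%:Z) (hd_d D) q (hd_s D))).
- exact: q_hausdorff hq.
- exact: cU.
- move=> i; have [[/andP[k0 kl] lm hk hl /andP[d0 d1]] _ HU] := FP (N i); split.
  + exact: (handle_open k0 kl lm hk hl erefl d0 d1 hq).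
  + exact: HU.
  + exact: (handle_curve_simple k0 kl lm hk hl erefl d0 d1 hq).
  + exact: (handle_curve_sub k0 kl lm hk hl erefl d0 d1 hq).
  + exact: (handle_curve_compl_connected k0 kl lm hk hl erefl d0 d1 hq).
move=> i j; wlog : i j / (i < j)%N.
  move=> H ij; have [lt|gt|e] := ltngtP i j; first exact: H.
    by rewrite setIC; apply: H => //; rewrite eq_sym.
  by move: ij; rewrite (val_inj e) eqxx.
move=> ij _; have [v _ _] := FP (N i); have [v' Nk _] := FP (N j).
apply: handle_of_disjoint => //.
exact: leq_ltn_trans (N_mono i.+1 j ij) Nk.
Qed.

(** Either the value 0 recurs forever among the [h n], or all late values are 1. *)
Lemma three_equal N : exists k l m, [/\ (N < k)%N, (k < l)%N, (l < m)%N,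
  h k%:Z = h m%:Z & h l%:Z = h m%:Z].
Proof.
have [inf|/existsNP[M fin]] :=
    pselect (forall M, exists n, (M < n)%N /\ h n%:Z = 0).
  have [k [Nk hk]] := inf N; have [l [kl hl]] := inf k; have [m [lm hm]] := inf l.
  by exists k, l, m; rewrite hk hl hm.
have one n : (M < n)%N -> h n%:Z = 1.
  by move=> Mn; have [h0|//] := Z2_case (h n%:Z); case: fin; exists n.
pose a := maxn M N; have [Ma Na] : (M <= a)%N /\ (N <= a)%N.
  by rewrite leq_maxl leq_maxr.
by exists a.+1, a.+2, a.+3; rewrite !one //; lia.
Qed.

Lemma two_sheets_infinite_genus : connected [set: Y] ->
  infinite_genus (R := R) [set: Y].
Proof.
move=> cY; apply: genus_of_handle_sequence => // N.
have [k [l [m [Nk kl lm hk hl]]]] := three_equal N.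
exists (HandleData k l m 0 (1/2)); split=> //; split=> //=.
  by rewrite kl (leq_ltn_trans _ Nk).
by clear hk hl; lra.
Qed.

End handles.

(** * Ends of the cover *)

Section ends_of_exhaustion.
Context {Y : topologicalType}.

Lemma card_set2 (T : Type) (a b : T) : a <> b -> [set a; b] #= `I_2.
Proof.
move=> ab; apply/eq_cardSP; exists a; first by left.
rewrite (_ : [set a; b] `\ a = [set b]); first exact: card_set1.
apply/seteqP; split=> [x [[->|->//] /=]|x ->] //; split; first by right.
exact/nesym.
Qed.

Lemma connected_component_open (A B : set Y) y : open A -> open B ->
  A `&` B = set0 -> connected A -> A y -> connected_component (A `|` B) y = A.
Proof.
move=> oA oB AB cA Ay; apply/seteqP; split; last first.
  by apply: connected_component_max => // x Ax; left.
set C := connected_component _ _.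
have <- : C `&` A = C; last by move=> x [].
apply: (@component_connected _ (A `|` B) y).
- by exists y; split=> //; apply: connected_component_refl; left.
- by exists A.
- exists (~` B); first exact: open_closedC.
  apply/seteqP; split=> x [Cx Ax]; split=> //.
    by move=> Bx; have : (A `&` B) x by []; rewrite AB.
  by have [//|/Ax] := connected_component_sub Cx.
Qed.

Variable L : nat -> set Y.
Hypotheses (cL : forall N, compact (L N)) (L_mono : forall N, L N `<=` L N.+1)
  (L_cofinal : forall K, compact K -> exists N, K `<=` L N).

Lemma exhaustion_mono M N : (M <= N)%N -> L M `<=` L N.
Proof.
elim: N => [|N IH]; first by rewrite leqn0 => /eqP ->.
rewrite leq_eqVlt => /orP[/eqP -> //|]; rewrite ltnS => /IH h.
exact: subset_trans h (@L_mono N).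
Qed.

Lemma end_component (e : set Y -> set Y) K y : ends e -> compact K -> e K y ->
  e K = connected_component (~` K) y.
Proof.
move=> [e1 _ _] cK; have [z _ ->] := e1 K cK.
exact: same_connected_component.
Qed.

Lemma end_nonempty (e : set Y -> set Y) K : ends e -> compact K -> e K !=set0.
Proof.
move=> [e1 _ _] cK; have [z Kz ->] := e1 K cK.
by exists z; exact: connected_component_refl.
Qed.

(** For [K] inside [L N], the value at [K] is the component that contains the value at [L N]. *)
Lemma ends_determined (e e' : set Y -> set Y) : ends e -> ends e' ->
  (forall N, e (L N) = e' (L N)) -> e = e'.
Proof.
move=> he he' ee'; apply/funext => K; have [_ e2 e3] := he; have [_ e2' e3'] := he'.
have [cK|ncK] := pselect (compact K); last by rewrite e3 // e3'.
have [N KL] := L_cofinal cK; have [y ey] := end_nonempty he (@cL N).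
have eKy := e2 _ _ cK (@cL N) KL y ey.
have eKy' : e' K y by apply: (e2' _ _ cK (@cL N) KL); rewrite -ee'.
by rewrite (end_component he cK eKy) (end_component he' cK eKy').
Qed.

Section end_of.
Variable F : nat -> set Y.
Hypotheses (F_mono : forall N, F N.+1 `<=` F N) (F_conn : forall N, connected (F N))
  (F0 : forall N, F N !=set0) (FL : forall N, F N `<=` ~` L N).

(** The end along which the connected sets [F N] escape: the component containing [F N] once [K] is
    inside [L N]. The compactness clause yields [set0] elsewhere, as [ends] requires. *)
Definition end_of (K : set Y) : set Y :=
  [set y | compact K /\ exists N x, [/\ K `<=` L N, F N x &
    connected_component (~` K) x y]].

Let F_le M N : (M <= N)%N -> F N `<=` F M.
Proof.
elim: N => [|N IH]; first by rewrite leqn0 => /eqP ->.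
rewrite leq_eqVlt => /orP[/eqP -> //|]; rewrite ltnS => /IH h.
exact: subset_trans (@F_mono N) h.
Qed.

Lemma end_ofE K N x : compact K -> K `<=` L N -> F N x ->
  end_of K = connected_component (~` K) x.
Proof.
move=> cK KL Fx; apply/seteqP; split=> [y [_ [M [z [KM Fz zy]]]]|y xy]; last first.
  by split=> //; exists N, x.
have key M1 M2 u w : (M1 <= M2)%N -> K `<=` L M1 -> F M1 u -> F M2 w ->
    connected_component (~` K) u w.
  move=> M12 KM1 Fu Fw; exists (F M1); last exact: F_le Fw.
  by split=> // v /FL nv Kv; apply: nv; exact: KM1.
apply: connected_component_trans zy.
have /orP[le|le] := leq_total N M; first exact: key le KL Fx Fz.
by apply: connected_component_sym; exact: key le KM Fz Fx.
Qed.

Lemma end_of_ends : ends end_of.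
Proof.
split=> [K cK|K K' cK cK' KK'|K ncK].
- have [N KL] := L_cofinal cK; have [x Fx] := F0 N; exists x; last exact: end_ofE Fx.
  by move=> Kx; apply: (FL Fx); exact: KL.
- have [N KL] := L_cofinal cK'; have [x Fx] := F0 N.
  rewrite (end_ofE cK' KL Fx) (end_ofE cK (subset_trans KK' KL) Fx).
  move=> y [C [Cx CK' Cc] Cy]; exists C => //; split=> // z Cz Kz.
  by apply: (CK' z Cz); exact: KK'.
- by rewrite -subset0 => y [].
Qed.

Lemma end_of_sub K : compact K -> exists N, forall M, (N <= M)%N -> F M `<=` end_of K.
Proof.
move=> cK; have [N KL] := L_cofinal cK; exists N => M NM y /(F_le NM) Fy.
rewrite (end_ofE cK KL Fy); apply: connected_component_refl => Ky.
by apply: (FL Fy); exact: KL.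
Qed.

End end_of.

Lemma one_end : (forall N, connected (~` L N)) -> (forall N, ~` L N !=set0) ->
  @ends Y #= `I_1.
Proof.
move=> Lc L0; pose F N := ~` L N.
have F_mono N : F N.+1 `<=` F N by apply: subsetC; exact: L_mono.
have FL N : F N `<=` ~` L N by [].
have eF : ends (end_of F) by exact: (end_of_ends F_mono Lc L0 FL).
suff -> : @ends Y = [set end_of F] by exact: card_set1.
apply/seteqP; split=> [e he|_ ->] //=; apply: ends_determined => // N.
have id e' : ends e' -> e' (L N) = ~` L N.
  move=> he'; have [y ey] := end_nonempty he' (@cL N).
  rewrite (end_component he' (@cL N) ey); apply: connected_component_id => //.
  have [e1 _ _] := he'; have [z _ ez] := e1 _ (@cL N).
  by move: ey; rewrite ez => /connected_component_sub.
by rewrite !id.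
Qed.

Section two_ends.
Variables (F : bool -> nat -> set Y).
Hypotheses (F_mono : forall b N, F b N.+1 `<=` F b N)
  (F_conn : forall b N, connected (F b N)) (F0 : forall b N, F b N !=set0)
  (F_open : forall b N, open (F b N))
  (F_dis : forall N, F true N `&` F false N = set0)
  (FL : forall N, ~` L N = F true N `|` F false N).

Let FL_sub b N : F b N `<=` ~` L N.
Proof. by rewrite FL; case: b => y Fy; [left|right]. Qed.

Let F_comp b N y : F b N y -> connected_component (~` L N) y = F b N.
Proof.
rewrite FL; case: b => Fy; first exact: connected_component_open.
by rewrite setUC; apply: connected_component_open => //; rewrite setIC.
Qed.

Let end_F b : ends (end_of (F b)).
Proof. exact: (end_of_ends (@F_mono b) (@F_conn b) (@F0 b) (@FL_sub b)). Qed.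

Let end_of_L b N : end_of (F b) (L N) = F b N.
Proof.
have [x Fx] := @F0 b N.
have <- := F_comp Fx.
exact: (end_ofE (@F_mono b) (@F_conn b) (@FL_sub b) (@cL N) _ Fx).
Qed.

Lemma two_endsP e : ends e -> exists b, e = end_of (F b).
Proof.
move=> he; have eF N : exists b, e (L N) = F b N.
  have [y ey] := end_nonempty he (@cL N).
  have e1 := end_component he (@cL N) ey.
  have : (~` L N) y by move: ey; rewrite e1 => /connected_component_sub.
  by rewrite FL => -[Fy|Fy]; [exists true|exists false]; rewrite e1 (F_comp Fy).
have [b eb] := eF 0%N; exists b; apply: ends_determined => // N; rewrite end_of_L.
(* The value at [L N.+1] is contained in the value at [L N], so the choice between the two sequences
   cannot change with [N]. *)
elim: N => // N IH; have [b' eb'] := eF N.+1; rewrite eb'.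
suff -> : b = b' by [].
have [y Fy] := @F0 b' N.+1.
have Fby : F b N y.
  have [_ e2 _] := he; rewrite -IH; apply: (e2 _ _ (@cL N) (@cL N.+1)) => //.
  by rewrite eb'.
have Fby' := F_mono Fy.
case: (b) (b') Fby Fby' => [] [] // f1 f2.
  by have : (F true N `&` F false N) y by []; rewrite F_dis.
by have : (F true N `&` F false N) y by []; rewrite F_dis.
Qed.

Lemma two_ends : @ends Y #= `I_2.
Proof.
suff -> : @ends Y = [set end_of (F true); end_of (F false)].
  apply: card_set2 => /(congr1 (fun e => e (L 0%N))); rewrite !end_of_L => e.
  have [y Fy] := @F0 true 0%N; have : (F true 0%N `&` F false 0%N) y by rewrite -e.
  by rewrite F_dis.
apply/seteqP; split=> [e /two_endsP[[] ->]|e [->|->]]; by [left|right|exact: end_F].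
Qed.

Lemma two_ends_sub e K : ends e -> compact K ->
  exists b N, forall M, (N <= M)%N -> F b M `<=` e K.
Proof.
move=> /two_endsP[b ->] cK; exists b.
exact: (end_of_sub (@F_mono b) (@F_conn b) (@FL_sub b)).
Qed.

End two_ends.
End ends_of_exhaustion.

(* The missing boundary points of the square: on each side a sequence indexed
   by nat and its limit, a corner indexed by None. *)
Inductive side := SLeft | SRight | SBottom | STop.
Definition vertex : Type := side * option nat.

Section vertices.
Variable R : realType.
Implicit Types (z w : R * R) (n N : nat) (v : vertex) (r : R).

(** Distance to the corner where the segments of the side accumulate. [None] is that corner and
    [Some 0] the other end of the side, so every corner of the square is named by two vertices. *)
Definition gap (o : option nat) : R := if o is Some k then dy k else 0.

Definition pt v : R * R :=
  match v.1 with
  | SLeft => (0, 1 - gap v.2) | SRight => (1, gap v.2)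
  | SBottom => (1 - gap v.2, 0) | STop => (gap v.2, 1)
  end.

Definition vflip v : vertex :=
  (match v.1 with SLeft => SRight | SRight => SLeft
   | SBottom => STop | STop => SBottom end, v.2).

Definition vdiag v : vertex :=
  (match v.1 with SLeft => SBottom | SRight => STop
   | SBottom => SLeft | STop => SRight end, v.2).

Lemma pt_flip v : pt (vflip v) = flip (pt v).
Proof. by case: v => [[] o]; rewrite /pt /flip /=; congr pair; lra. Qed.

Lemma pt_diag v : pt (vdiag v) = diag (pt v).
Proof. by case: v => [[] o]. Qed.

Lemma gap_itv o : 0 <= gap o <= 1.
Proof.
case: o => [k|] /=; last by rewrite lexx ler01.
by rewrite ltW ?dy_gt0 // dy_le1.
Qed.

Lemma pt_bounds v : (0 <= (pt v).1 <= 1) && (0 <= (pt v).2 <= 1).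
Proof. by case: v => [[] o]; have := gap_itv o; rewrite /pt /=; lra. Qed.

Lemma gap_right n o : gap o <= dy n \/ 2 * dy n <= gap o.
Proof.
case: o => [k|] /=; last by left; rewrite ltW ?dy_gt0.
by have [nk|kn] := leqP n k; [left; exact: dy_leq|right; exact: dy_ltn].
Qed.

(** On the right side no gap lies strictly between [dy n] and [2 * dy n]. A vertex on the bottom or
    top side is no better placed than an end of the segment, and the left side is too far. *)
Lemma right_near n z v r : (0 < n)%N -> right_segment n z -> close r (pt v) z ->
  r <= 1 -> z.2 - dy n < r \/ 2 * dy n - z.2 < r.
Proof.
move=> n0 /(rightP _ n0)[z1 /andP[s1 s2]] /and4P[c1 c2 c3 c4] r1.
have d2 := dy_le_half R n0; have d0 := dy_gt0 R n.
case: v c1 c2 c3 c4 => [[] o]; rewrite /pt /= => c1 c2 c3 c4.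
- by exfalso; lra.
- by have [h|h] := gap_right n o; [left; lra|right; lra].
- by left; lra.
- by right; lra.
Qed.

(* Crossing a_n (b_n) near an end of it leads from one missing point to
   another one. *)
Definition seam (h : int -> 'Z_2) (v v' : vertex) (k : 'Z_2) : Prop :=
  exists n m m', [/\ (0 < n)%N, (m = n /\ m' = n.-1) \/ (m = n.-1 /\ m' = n) &
    [/\ v = (SRight, Some m), v' = (SLeft, Some m') & k = h n%:Z] \/
    [/\ v = (STop, Some m), v' = (SBottom, Some m') & k = h (- n%:Z)]].

(** The translation takes the lower end [dy n] to [1 - dy n.-1] and the upper end [dy n.-1] to
    [1 - dy n]: the indices at the two ends of a seam differ by one. *)
Lemma right_near_seam n z v r : (0 < n)%N -> right_segment n z -> close r (pt v) z ->
  r <= 1 -> exists m m', [/\ (m = n /\ m' = n.-1) \/ (m = n.-1 /\ m' = n),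
    close r (pt (SRight, Some m)) z & close r (pt (SLeft, Some m')) (unglue_a n z)].
Proof.
move=> n0 rz cz r1; have near_ := right_near n0 rz cz r1.
have /(rightP _ n0)[z1 /andP[s1 s2]] := rz.
have dp : dy n.-1 = 2 * dy n :> R by exact: dy_pred.
have r0 : 0 < r by move: cz => /and4P[*]; lra.
case: near_ => hz; [exists n, n.-1|exists n.-1, n]; split; try by [left|right];
  by rewrite /close /pt /unglue_a /= ?dp; apply/and4P; split; lra.
Qed.

Lemma left_near_seam n z v r : (0 < n)%N -> left_segment n z -> close r (pt v) z ->
  r <= 1 -> exists m m', [/\ (m = n /\ m' = n.-1) \/ (m = n.-1 /\ m' = n),
    close r (pt (SRight, Some m)) (glue_a n z) & close r (pt (SLeft, Some m')) z].
Proof.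
move=> n0 lz cz r1.
have [m [m' [mm' c1 c2]]] : exists m m', [/\ (m = n /\ m' = n.-1) \/ (m = n.-1 /\ m' = n),
    close r (pt (SRight, Some m)) (flip z) &
    close r (pt (SLeft, Some m')) (unglue_a n (flip z))].
  apply: (@right_near_seam n (flip z) (vflip v)) => //; first exact/right_flip.
  by rewrite pt_flip close_flip.
exists m', m; split.
- by case: mm' => -[-> ->]; [right|left].
- have -> : glue_a n z = flip (unglue_a n (flip z)).
    have [z1 _] := (leftP _ n0).1 lz.
    by rewrite glue_aE // /flip /unglue_a /= z1; congr pair; lra.
  by rewrite -close_flip flipK -pt_flip.
- by rewrite -close_flip -pt_flip.
Qed.

Lemma glue_bEdiag n z : glue_b n z = diag (glue_a n (diag z)).
Proof. by []. Qed.

(** The vertex [v] near [z] need not be an end of the segment being crossed, so it is replaced by an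
    end [w] that is also near [z]. *)
Lemma cross_near_seam h s z s' z' v r : cross h s z s' z' -> close r (pt v) z -> r <= 1 ->
  (s = s' /\ z = z') \/ exists (w w' : vertex) k, [/\ close r (pt w) z, close r (pt w') z',
    s' = s + k & seam h w w' k \/ seam h w' w k].
Proof.
move=> [c|[n n0 [[lz [-> ->]]|[bz [-> ->]]]]|[n n0 [[lz [-> ->]]|[bz [-> ->]]]]] cz r1.
- by left.
- have [m [m' [mm' c1 c2]]] := left_near_seam n0 lz cz r1.
  right; exists (SLeft, Some m'), (SRight, Some m), (h n%:Z); split=> //.
  by right; exists n, m, m'; split=> //; left.
- have [||m [m' [mm' c1 c2]]] := @left_near_seam n (diag z) (vdiag v) r n0 _ _ r1.
  + exact/left_diag.
  + by rewrite pt_diag close_diag.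
  right; exists (SBottom, Some m'), (STop, Some m), (h (- n%:Z)); split=> //.
  + by rewrite -close_diag -pt_diag.
  + by rewrite glue_bEdiag -close_diag diagK -pt_diag.
  + by right; exists n, m, m'; split=> //; right.
- have [m [m' [mm' c1 c2]]] := right_near_seam n0 (left_glue_a n0 lz) cz r1.
  right; exists (SRight, Some m), (SLeft, Some m'), (h n%:Z); split=> //.
  + by move: c2; rewrite glue_aK.
  + by rewrite Z2_addK.
  + by left; exists n, m, m'; split=> //; left.
- have [||m [m' [mm' c1 c2]]] := @right_near_seam n (diag (glue_b n z')) (vdiag v) r n0 _ _ r1.
  + by apply/right_diag => //; exact: bottom_glue_b.
  + by rewrite pt_diag close_diag.
  right; exists (STop, Some m), (SBottom, Some m'), (h (- n%:Z)); split=> //.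
  + by rewrite -close_diag -pt_diag.
  + move: c2; rewrite glue_bEdiag diagK glue_aK // => c2.
    by rewrite -close_diag -pt_diag.
  + by rewrite Z2_addK.
  + by left; exists n, m, m'; split=> //; right.
Qed.

Lemma inner_coord (x e : R) : 0 <= x <= 1 -> 0 < e <= 1 / 2 ->
  exists u, (0 < u < 1) && (x - e < u < x + e).
Proof.
move=> x01 e0; have [x2|x2] := leP x (1/2).
  by exists (x + e / 2); lra.
by exists (x - e / 2); lra.
Qed.

Lemma pt_inner v r : 0 < r <= 1 / 2 -> exists2 z, open_square z & close r (pt v) z.
Proof.
move=> r0; have /andP[b1 b2] := pt_bounds v.
have [a /andP[a1 a2]] := inner_coord b1 r0; have [b /andP[b3 b4]] := inner_coord b2 r0.
by exists (a, b); [apply/open_squareP => /=; lra|rewrite /close /=; lra].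
Qed.

End vertices.

(** * Linking the missing points at a given scale *)

Section links.
Variables (R : realType) (h : int -> 'Z_2) (Y : topologicalType)
  (q : 'Z_2 -> R * R -> Y).
Hypothesis hq : two_sheets h q.
Implicit Types (z w : R * R) (s : 'Z_2) (n N : nat) (v : vertex).

(** The shift to [N.+1] keeps the radius at most 1/2 for every [N], so that each box contains
    interior points of the square. *)
Definition box N v : set (R * R) := [set z | unglued z /\ close (dy N.+1) (pt R v) z].

Definition node : Type := 'Z_2 * vertex.

Definition meets N (a b : node) : Prop := exists z w,
  [/\ box N a.2 z, box N b.2 w & q a.1 z = q b.1 w].

Definition reach N := clos_refl_trans node (meets N).

Definition boxes N (P : set node) : set Y :=
  [set y | exists a z, [/\ P a, box N a.2 z & q a.1 z = y]].

Lemma eps_bounds N : 0 < (dy N.+1 : R) <= 1 / 2.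
Proof. by have := dy_le_half R (ltn0Sn N); have := dy_gt0 R N.+1; lra. Qed.

Lemma meets_sym N a b : meets N a b -> meets N b a.
Proof. by move=> [z [w [? ? ?]]]; exists w, z. Qed.

Lemma reach_sym N a b : reach N a b -> reach N b a.
Proof.
elim=> [x y m|x|x y z _ IH1 _ IH2]; [exact/rt_step/meets_sym|exact: rt_refl|].
exact: rt_trans IH2 IH1.
Qed.

(** A box is star-shaped about any point of it in the open square. *)
Lemma box_component N (P : set node) a z w : P a -> box N a.2 z -> box N a.2 w ->
  connected_component (boxes N P) (q a.1 z) (q a.1 w).
Proof.
move=> Pa; have [c oc cc] := pt_inner a.2 (eps_bounds N).
have key (v : R * R) : box N a.2 v -> connected_component (boxes N P) (q a.1 c) (q a.1 v).
  move=> [uv cv]; apply: (segment_component hq) => t t01.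
  have [->|t1] := eqVneq t 1.
    rewrite subrr !mul0r !add0r !mul1r -surjective_pairing; split=> //.
    by exists a, v.
  have t1' : 0 <= t < 1 by move: t1; rewrite neq_lt; lra.
  have us := open_square_unglued (unglued_star oc uv t1'); split=> //.
  exists a, ((1 - t) * c.1 + t * v.1, (1 - t) * c.2 + t * v.2); split=> //.
  split=> //; move: cc cv; set e := dy _; set p := pt _ _.
  rewrite /close /= => /and4P[c1 c2 c3 c4] /and4P[v1 v2 v3 v4].
  have conv (x y u : R) : x < u -> y < u -> (1 - t) * x + t * y < u.
    move=> xu yu; have : 0 < (1 - t) * (u - x) by apply: mulr_gt0; lra.
    have : 0 <= t * (u - y) by apply: mulr_ge0; lra.
    lra.
  have := conv _ _ _ c2 v2; have := conv _ _ _ c4 v4.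
  have := conv (- c.1) (- v.1) (- (p.1 - e)); have := conv (- c.2) (- v.2) (- (p.2 - e)).
  by move=> k1 k2 k3 k4; apply/and4P; split; lra.
move=> bz bw; apply: connected_component_trans (key w bw).
exact/connected_component_sym/key.
Qed.

Lemma reach_component N (P : set node) a b z w :
  (forall a b, P a -> meets N a b -> P b) -> reach N a b -> P a ->
  box N a.2 z -> box N b.2 w ->
  connected_component (boxes N P) (q a.1 z) (q b.1 w).
Proof.
move=> cP r Pa bz bw; suff [_] : P b /\ forall z w, box N a.2 z -> box N b.2 w ->
    connected_component (boxes N P) (q a.1 z) (q b.1 w) by apply.
elim: r Pa {z w bz bw} => {a b} [a b m|a|a b c _ IH1 _ IH2] Pa.
- split=> [|z w bz bw]; first exact: cP m.
  have [z1 [z2 [b1 b2 e]]] := m.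
  apply: connected_component_trans (box_component Pa bz b1) _.
  by rewrite e; apply: box_component => //; exact: cP m.
- by split=> // z w; exact: box_component.
- have [Pb l1] := IH1 Pa; have [Pc l2] := IH2 Pb; split=> // z w bz bw.
  have [u ou cu] := pt_inner b.2 (eps_bounds N).
  have bu : box N b.2 u by split=> //; exact: open_square_unglued.
  exact: connected_component_trans (l1 _ _ bz bu) (l2 _ _ bu bw).
Qed.

Lemma seam_meets N s v v' k : seam h v v' k -> meets N (s, v) (s + k, v').
Proof.
have /andP[e0 e1] := eps_bounds N.
have main (h' : int -> 'Z_2) (q1 : 'Z_2 -> R * R -> Y) n m m' : two_sheets h' q1 ->
    (0 < n)%N -> (m = n /\ m' = n.-1) \/ (m = n.-1 /\ m' = n) ->
    exists z, [/\ box N (SRight, Some m) z, box N (SLeft, Some m') (unglue_a n z) &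
      q1 s z = q1 (s + h' n%:Z) (unglue_a n z)].
  move=> hq1 n0 mm; have dn := dy_gt0 R n; have dp : dy n.-1 = 2 * dy n :> R by exact: dy_pred.
  (* Less than the length [dy n] of the segment and less than the radius of the box: the point at
     distance [a] from the end lies in both. *)
  pose a := Num.min (dy n) (dy N.+1) / 2 : R.
  have [a0 a1 a2] : [/\ 0 < a, a < dy n & a < dy N.+1].
    have m1 : Num.min (dy n) (dy N.+1) <= dy n :> R by rewrite ge_min lexx.
    have m2 : Num.min (dy n) (dy N.+1) <= dy N.+1 :> R by rewrite ge_min lexx orbT.
    have m3 : 0 < Num.min (dy n) (dy N.+1) :> R by rewrite lt_min dn e0.
    by rewrite /a; split; lra.
  have nn : (n.-1 == n) = false by move: n0; clear; case: n => //= n _; rewrite ltn_eqF.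
  pose y : R := if m == n then dy n + a else 2 * dy n - a.
  have rz : right_segment n (1 : R, y).
    by apply/(rightP _ n0); split=> //=; rewrite /seg /y; case: ifP => _; lra.
  have uz : unglued (1 : R, y) by apply: (unglued_seg n0); right; left.
  have uz' : unglued (unglue_a n (1 : R, y)).
    by apply: (unglued_seg n0); left; exact: left_unglue_a.
  exists (1, y); split; [split=> //|split=> //|exact: (q_right hq1 s n0 rz)].
  - by case: mm => -[mE _]; rewrite /close /pt /= /y mE ?eqxx ?nn ?dp; lra.
  - by case: mm => -[mE mE']; rewrite /close /pt /unglue_a /= /y mE mE' ?eqxx ?nn ?dp; lra.
move=> [n [m [m' [n0 mm [[-> -> ->]|[-> -> ->]]]]]].
  by have [z [b1 b2 e]] := main h q n m m' hq n0 mm; exists z, (unglue_a n z).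
have [z [[u1 c1] [u2 c2] e]] := main _ _ n m m' (two_sheets_diag hq) n0 mm.
exists (diag z), (diag (unglue_a n z)); split=> //=.
- by split; [exact: unglued_diag|rewrite -close_diag diagK -pt_diag].
- by split; [exact: unglued_diag|rewrite -close_diag diagK -pt_diag].
Qed.

Lemma same_pt_meets N s v v' : pt R v = pt R v' -> meets N (s, v) (s, v').
Proof.
move=> vv'; have [z oz cz] := pt_inner v (eps_bounds N).
have uz := open_square_unglued oz.
by exists z, z; split=> //; split=> //=; rewrite -vv'.
Qed.

(** The two centres are [dy k <= dy N.+1] apart; a point half-way between them, moved into the
    square, lies in both open boxes. *)
Lemma tail_meets N s (d : side) k : (N < k)%N ->
  meets N (s, (d, Some k)) (s, (d, None)).
Proof.
move=> Nk; have := dy_leq R Nk; have := dy_gt0 R k; have := eps_bounds N.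
set e := dy N.+1 => e0 k0 ke.
suff [z oz [c1 c2]] : exists2 z, open_square z & close e (pt R (d, Some k)) z /\
    close e (pt R (d, None)) z.
  have uz := open_square_unglued oz.
  by exists z, z; split=> //; split.
case: d; rewrite /pt /close /=.
- by exists (e / 2, 1 - dy k / 2); [apply/open_squareP => /=; lra|split=> /=; lra].
- by exists (1 - e / 2, dy k / 2); [apply/open_squareP => /=; lra|split=> /=; lra].
- by exists (1 - dy k / 2, e / 2); [apply/open_squareP => /=; lra|split=> /=; lra].
- by exists (dy k / 2, 1 - e / 2); [apply/open_squareP => /=; lra|split=> /=; lra].
Qed.

End links.

(** * An exhaustion by compact sets *)

Section exhaustion.
Variables (R : realType) (h : int -> 'Z_2) (Y : topologicalType)
  (q : 'Z_2 -> R * R -> Y).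
Hypothesis hq : two_sheets h q.
Implicit Types (z w : R * R) (s : 'Z_2) (n N : nat) (v : vertex) (r : R).

Definition far r z := forall v, ~ close r (pt R v) z.

Lemma far_le r r' z : r <= r' -> far r' z -> far r z.
Proof. by move=> rr f v c; apply: (f v); exact: close_le c. Qed.

Lemma far_flip r z : far r (flip z) -> far r z.
Proof. by move=> f v c; apply: (f (vflip v)); rewrite pt_flip close_flip. Qed.

Lemma far_diag r z : far r (diag z) -> far r z.
Proof. by move=> f v c; apply: (f (vdiag v)); rewrite pt_diag close_diag. Qed.

Lemma unglued_far z : unglued z -> exists r, 0 < r <= 1 /\ far r z.
Proof.
move: z; apply: unglued_ind.
- move=> z /open_squareP oz.
  exists (Num.min (Num.min z.1 (1 - z.1)) (Num.min z.2 (1 - z.2))).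
  set m := Num.min _ _.
  have [m1 m2 m3 m4] : [/\ m <= z.1, m <= 1 - z.1, m <= z.2 & m <= 1 - z.2].
    by rewrite /m !ge_min !lexx !orbT.
  split; first by rewrite {1}/m !lt_min; lra.
  by move=> [[] o] /and4P[/= ? ? ? ?]; lra.
- move=> n z n0 rz; have /(rightP _ n0)[z1 /andP[s1 s2]] := rz.
  exists (Num.min (z.2 - dy n) (2 * dy n - z.2)).
  set m := Num.min _ _.
  have [m1 m2] : m <= z.2 - dy n /\ m <= 2 * dy n - z.2.
    by rewrite /m !ge_min !lexx !orbT.
  have m3 : m <= 1 by have := dy_le_half R n0; have := dy_gt0 R n; lra.
  split; first by rewrite m3 andbT /m lt_min; lra.
  by move=> v c; have [] := right_near n0 rz c m3; lra.
- by move=> z [r [r0 f]]; exists r; split=> //; exact: far_flip.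
- by move=> z [r [r0 f]]; exists r; split=> //; exact: far_diag.
Qed.

(** Being far from the missing points does not depend on the chosen preimage, since crossing back
    from near a vertex ends near a vertex. *)
Lemma far_cross r s z s' z' : r <= 1 -> cross h s z s' z' -> far r z -> far r z'.
Proof.
move=> r1 /crossC c f v cv.
have [[_ zz']|[w [w' [k [_ cw _ _]]]]] := cross_near_seam c cv r1.
  by apply: (f v); rewrite -zz'.
exact: (f w').
Qed.

Lemma square_cases z : (0 <= z.1 <= 1) && (0 <= z.2 <= 1) ->
  unglued z \/ exists v, z = pt R v.
Proof.
have right_ w : w.1 = 1 -> 0 <= w.2 <= 1 -> unglued w \/ exists v, w = pt R v.
  move=> w1 w2; have [e|w20] := eqVneq w.2 0.
    by right; exists (SRight, None); rewrite [w]surjective_pairing w1 e.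
  have [e|w21] := eqVneq w.2 1.
    by right; exists (SRight, Some 0%N); rewrite [w]surjective_pairing w1 e /pt /= dy0.
  have [|n n0 [e|sn]] := @seg_exists R w.2.
  - by rewrite !lt_neqAle eq_sym w20 w21.
  - by right; exists (SRight, Some n); rewrite [w]surjective_pairing w1 e.
  - by left; apply: (unglued_seg n0); right; left; apply/(rightP _ n0).
have left_ w : w.1 = 0 -> 0 <= w.2 <= 1 -> unglued w \/ exists v, w = pt R v.
  move=> w1 w2; have [||uw|[v e]] := right_ (flip w); rewrite /flip /=; try lra.
    by left; rewrite -[w]flipK; exact: unglued_flip.
  by right; exists (vflip v); rewrite pt_flip -e flipK.
have diag_ w : unglued (diag w) \/ (exists v, diag w = pt R v) ->
    unglued w \/ exists v, w = pt R v.
  move=> [uw|[v e]]; first by left; rewrite -[w]diagK; exact: unglued_diag.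
  by right; exists (vdiag v); rewrite pt_diag -e diagK.
move=> /andP[z1 z2].
have [e|z10] := eqVneq z.1 0; first exact: left_.
have [e|z11] := eqVneq z.1 1; first exact: right_.
have [e|z20] := eqVneq z.2 0; first by apply/diag_/left_.
have [e|z21] := eqVneq z.2 1; first by apply/diag_/right_.
left; apply: open_square_unglued; apply/open_squareP.
by rewrite !lt_neqAle z11 z21 eq_sym z10 eq_sym z20 /=; lra.
Qed.

Definition core N : set Y := ~` boxes q N setT.

Lemma coreP N s z : unglued z -> core N (q s z) <-> far (dy N.+1) z.
Proof.
move=> uz; have /andP[e0 e1] := eps_bounds R N; split=> [nE v c|f [a [w [_ [uw cw] e]]]].
  by apply: nE; exists (s, v), z.
move: e => /(q_eq hq _ _ uw uz)/crossC c.
by have := far_cross _ c f; apply; [lra|exact: cw].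
Qed.

(** The closed square without the open boxes is compact, and it lies in [unglued] because by
    [square_cases] all other boundary points are missing points, centres of boxes. *)
Lemma core_compact N : compact (core N).
Proof.
pose G : set (R * R) := (`[0, 1] `*` `[0, 1]) `&` [set z | far (dy N.+1) z].
have Gu z : G z -> unglued z.
  move=> [[/=]]; rewrite !in_itv /= => z1 z2 f.
  have [|//|[v e]] := @square_cases z; first by rewrite z1 z2.
  by case: (f v); rewrite -e; apply: close_refl; exact: dy_gt0.
have cS : compact (`[0, 1] `*` `[0, 1] : set (R * R)).
  by apply: compact_setX; exact: segment_compact.
have cG : compact G.
  apply: (subclosed_compact _ cS); last by move=> z [].
  apply: closedI; first by apply: compact_closed cS; exact: norm_hausdorff.
  rewrite (_ : [set z | _] = \bigcap_(v in [set: vertex]) (~` close (dy N.+1) (pt R v))).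
    by apply: closed_bigI => v _; apply: open_closedC; exact: open_close.
  by apply/seteqP; split=> [z f v _|z f v]; [exact: f|exact: (f v)].
have -> : core N = q 0 @` G `|` q 1 @` G.
  apply/seteqP; split=> [y cy|y [[z Gz <-]|[z Gz <-]]].
  - have [s [z [uz e]]] := q_surj hq y; rewrite -e in cy *.
    have f := (coreP N s uz).1 cy.
    have Gz : G z.
      by split=> //; have /andP[? ?] := unglued_bounds uz; split=> /=; rewrite in_itv.
    by have [->|->] := Z2_case s; [left|right]; exists z.
  - by apply/coreP; [exact: Gu|exact: Gz.2].
  - by apply/coreP; [exact: Gu|exact: Gz.2].
have qc s : compact (q s @` G).
  by apply: continuous_compact => //; apply: continuous_subspaceW (q_within hq (s := s)).
exact: compactU.
Qed.

Lemma core_mono N : core N `<=` core N.+1.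
Proof.
move=> y; have [s [z [uz <-]]] := q_surj hq y.
move=> /(coreP _ _ uz) f; apply/(coreP _ _ uz); apply: far_le f.
exact: dy_leq.
Qed.

Lemma core_cofinal K : compact K -> exists N, K `<=` core N.
Proof.
move=> /compact_near_coveringP cK.
have main : \forall N \near \oo, K `<=` core N.
  apply: (cK nat \oo core) => y Ky.
  have [s [z [uz yz]]] := q_surj hq y; have [r [r01 fz]] := unglued_far uz.
  have /andP[r0 r1] := r01; have [N0 hN0] := dy_small (divr_gt0 r0 (ltr0n R 2)).
  (* The strict bound [r / 2 < r'] leaves room to move, so [V] is open, and all of [V] lies in
     [core N] as soon as [dy N.+1 <= r / 2]. *)
  pose V := [set y' | exists s w, [/\ unglued w, q s w = y' &
    exists r', r / 2 < r' <= 1 /\ far r' w]].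
  have Vfar t w : unglued w -> V (q t w) -> exists r', r / 2 < r' <= 1 /\ far r' w.
    move=> uw [t' [w' [uw' /(q_eq hq _ _ uw' uw) c [r' [hr' f]]]]].
    have [_ r'1] := andP hr'.
    by exists r'; split=> //; exact: far_cross c f.
  have oV : open V.
    apply/(q_open hq) => t w uw /(Vfar _ _ uw)[r' [hr' f]].
    exists ((r' - r / 2) / 2); first by lra.
    move=> u uu cu; exists t, u; split=> //; exists ((r' + r / 2) / 2); split; first by lra.
    move=> v cv; apply: (f v); move: cu cv; rewrite /close.
    by move=> /and4P[a1 a2 a3 a4] /and4P[b1 b2 b3 b4]; apply/and4P; split; lra.
  have Vy : V y by exists s, z; split=> //; exists r; split=> //; lra.
  exists (V, [set N | (N0 <= N)%N]) => /=.
    by split; [exact: open_nbhs_nbhs|exists N0].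
  move=> [y' N] /= [Vy' N0N]; have [t [w [uw e]]] := q_surj hq y'.
  rewrite -e in Vy' *; apply/coreP => //; have [r' [hr' f]] := Vfar _ _ uw Vy'.
  apply: far_le f; have : dy N.+1 <= dy N0 :> R by apply: dy_leq; exact: leqW.
  lra.
by have [N _ hN] := main; exists N; apply: hN => /=.
Qed.

End exhaustion.

(** The parity of the number of indices from 1 to [k] at which [f] differs from [g]. *)
Definition excess (f : nat -> 'Z_2) (g : 'Z_2) (k : nat) : 'Z_2 :=
  \sum_(0 <= j < k) (f j.+1 + g).

Lemma excessS f g k : excess f g k.+1 = excess f g k + (f k.+1 + g).
Proof. by rewrite /excess big_nat_recr. Qed.

Lemma excess_eq f g K k : (forall n, (K < n)%N -> f n = g) -> (K <= k)%N ->
  excess f g k = excess f g K.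
Proof.
move=> fg; elim: k => [|k IH]; first by rewrite leqn0 => /eqP ->.
rewrite leq_eqVlt => /orP[/eqP -> //|]; rewrite ltnS => Kk.
by rewrite excessS IH // fg ?ltnS // Z2_addss addr0.
Qed.

Lemma Z2_regroup (s a b c g : 'Z_2) :
  s + (a + (c + g)) + (g + b) = s + a + b + c.
Proof.
have -> : s + (a + (c + g)) + (g + b) = s + a + b + c + g + g by ring.
exact: Z2_addK.
Qed.

(** * Which missing points are linked *)

Section reachability.
Variables (R : realType) (h : int -> 'Z_2) (Y : topologicalType)
  (q : 'Z_2 -> R * R -> Y).
Hypothesis hq : two_sheets h q.
Implicit Types (s : 'Z_2) (n N k : nat).

Let C : vertex := (SLeft, None).
Let D : vertex := (SRight, None).

(** Each seam raises the index by one and changes the side, so the chain that starts at (0, 0) on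
    the left side is on the left exactly at even indices. *)
Lemma reach_up_a N s k : reach q N (s, (if odd k then SRight else SLeft, Some k))
  (s + h k.+1%:Z, (if odd k then SLeft else SRight, Some k.+1)).
Proof.
case: ifP => ok.
  by apply/rt_step/(seam_meets hq); exists k.+1, k, k.+1; split=> //; [right|left].
apply/rt_step/meets_sym.
rewrite -{2}(Z2_addK s (h k.+1%:Z)); apply: (seam_meets hq).
by exists k.+1, k.+1, k; split=> //; left.
Qed.

Lemma reach_up_b N s k : reach q N (s, (if odd k then STop else SBottom, Some k))
  (s + h (- k.+1%:Z), (if odd k then SBottom else STop, Some k.+1)).
Proof.
case: ifP => ok.
  by apply/rt_step/(seam_meets hq); exists k.+1, k, k.+1; split=> //; [right|right].
apply/rt_step/meets_sym.
rewrite -{2}(Z2_addK s (h (- k.+1%:Z))); apply: (seam_meets hq).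
by exists k.+1, k.+1, k; split=> //; [left|right].
Qed.

Lemma reach_any_up N s d k : exists s' d', reach q N (s, (d, Some k)) (s', (d', Some k.+1)).
Proof.
case: d.
- exists (s + h k.+1%:Z), SRight; apply/rt_step/meets_sym.
  rewrite -{2}(Z2_addK s (h k.+1%:Z)); apply: (seam_meets hq).
  by exists k.+1, k.+1, k; split=> //; left.
- exists (s + h k.+1%:Z), SLeft; apply/rt_step/(seam_meets hq).
  by exists k.+1, k, k.+1; split=> //; [right|left].
- exists (s + h (- k.+1%:Z)), STop; apply/rt_step/meets_sym.
  rewrite -{2}(Z2_addK s (h (- k.+1%:Z))); apply: (seam_meets hq).
  by exists k.+1, k.+1, k; split=> //; [left|right].
- exists (s + h (- k.+1%:Z)), SBottom; apply/rt_step/(seam_meets hq).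
  by exists k.+1, k, k.+1; split=> //; [right|right].
Qed.

Lemma reach_tail N s d k : (N < k)%N ->
  reach q N (s, (d, Some k)) (s, (d, None)).
Proof. by move=> Nk; apply/rt_step/tail_meets. Qed.

Lemma reach_top_C N s : reach q N (s, (STop, None)) (s, C).
Proof. by apply/rt_step/same_pt_meets; rewrite /pt /= subr0. Qed.

Lemma reach_D_bottom N s : reach q N (s, D) (s, (SBottom, None)).
Proof. by apply/rt_step/same_pt_meets; rewrite /pt /= subr0. Qed.

(** Far out, the ends of the segment [n] are close to the corner (1, 0) on one side and to (0, 1) on
    the opposite one. *)
Lemma reach_D_C N s n : (N.+1 < n)%N -> reach q N (s, D) (s + h n%:Z, C) /\
  reach q N (s, D) (s + h (- n%:Z), C).
Proof.
case: n => // n; rewrite ltnS => Nn; split.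
  apply: rt_trans (reach_tail _ _ (k := n.+1) _); last exact: leqW.
  apply: rt_trans (reach_sym (reach_tail _ _ Nn)) _.
  apply/rt_step/(seam_meets hq).
  by exists n.+1, n, n.+1; split=> //; [right|left].
apply: rt_trans (reach_D_bottom _ _) _; apply: rt_trans (reach_top_C _ _).
apply: rt_trans (reach_sym (reach_tail _ _ (k := n.+1) _)) _; first exact: leqW.
apply: rt_trans (reach_tail _ _ Nn).
apply/rt_step/meets_sym; rewrite -{2}(Z2_addK s (h (- n.+1%:Z))).
by apply: (seam_meets hq); exists n.+1, n, n.+1; split=> //; [right|right].
Qed.

Lemma reach_corner N s v : exists s', reach q N (s, v) (s', C).
Proof.
have corner d t : exists s', reach q N (t, (d, None)) (s', C).
  have [rD _] := reach_D_C t (ltnSn N.+1).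
  case: d.
  - by exists t; exact: rt_refl.
  - by exists (t + h N.+2%:Z).
  - exists (t + h N.+2%:Z); apply: rt_trans rD.
    by apply: reach_sym; exact: reach_D_bottom.
  - by exists t; exact: reach_top_C.
case: v => d [k|]; last exact: corner.
(* [j] counts the seams to climb until the index exceeds [N] and a limit corner is within reach. *)
have [j] : exists j, (N < k + j)%N by exists N.+1; rewrite addnS ltnS leq_addl.
elim: j k s d => [|j IH] k s d.
  rewrite addn0 => Nk; have [s' r] := corner d s; exists s'.
  exact: rt_trans (reach_tail _ _ Nk) r.
have [s1 [d1 r1]] := reach_any_up N s d k.
rewrite addnS -addSn => /(IH _ s1 d1)[s' r']; exists s'.
exact: rt_trans r1 r'.
Qed.

Lemma reach_chain_a N s g k : ~~ odd k ->
  reach q N (s, (SLeft, Some 0%N)) (s + excess (fun n => h n%:Z) g k, (SLeft, Some k)).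
Proof.
(* A step contributes [h j.+1], that is, the new term of [excess] plus [g]; the extra copies of [g]
   cancel at even indices. *)
move=> ek; have main j : reach q N (s, (SLeft, Some 0%N))
    (s + excess (fun n => h n%:Z) g j + g *+ j, (if odd j then SRight else SLeft, Some j)).
  elim: j => [|j IH]; first by rewrite /excess big_geq // !addr0; exact: rt_refl.
  apply: rt_trans IH _; have := reach_up_a N (s + excess (fun n => h n%:Z) g j + g *+ j) j.
  by rewrite excessS mulrS /= Z2_regroup; case: (odd j).
have := main k; rewrite (negbTE ek) -(odd_double_half k) (negbTE ek) add0n.
by rewrite -mul2n mulrnA mulr2n Z2_addss mul0rn addr0.
Qed.

Lemma reach_chain_b N s g k : ~~ odd k ->
  reach q N (s, (SBottom, Some 0%N))
    (s + excess (fun n => h (- n%:Z)) g k, (SBottom, Some k)).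
Proof.
move=> ek; have main j : reach q N (s, (SBottom, Some 0%N))
    (s + excess (fun n => h (- n%:Z)) g j + g *+ j, (if odd j then STop else SBottom, Some j)).
  elim: j => [|j IH]; first by rewrite /excess big_geq // !addr0; exact: rt_refl.
  apply: rt_trans IH _; have := reach_up_b N (s + excess (fun n => h (- n%:Z)) g j + g *+ j) j.
  by rewrite excessS mulrS /= Z2_regroup; case: (odd j).
have := main k; rewrite (negbTE ek) -(odd_double_half k) (negbTE ek) add0n.
by rewrite -mul2n mulrnA mulr2n Z2_addss mul0rn addr0.
Qed.

(* Running from one corner down to (0, 0) along the segments a_k and up again
   along the b_k changes the sheet by the parity of the entries other than g. *)
Lemma reach_around N s g K :
  (forall n, (K < n)%N -> h n%:Z = g /\ h (- n%:Z) = g) ->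
  reach q N (s, C) (s + excess (fun n => h n%:Z) g K +
    excess (fun n => h (- n%:Z)) g K + g, C).
Proof.
(* Even, so that both chains end on the side where they began; beyond [K], so that [excess] has
   stabilized; beyond [N], so that [reach_tail] applies. *)
move=> hg; pose k := (maxn K N.+1).*2.
have [Kk Nk ek] : [/\ (K <= k)%N, (N < k)%N & ~~ odd k].
  by rewrite /k odd_double -addnn; split=> //;
    have := leq_maxl K N.+1; have := leq_maxr K N.+1; lia.
have Ea : excess (fun n => h n%:Z) g k = excess (fun n => h n%:Z) g K.
  by apply: excess_eq => // n /hg[].
have Eb : excess (fun n => h (- n%:Z)) g k = excess (fun n => h (- n%:Z)) g K.
  by apply: excess_eq => // n /hg[].
apply: rt_trans (reach_sym (reach_tail _ _ Nk)) _.
rewrite -{1}(Z2_addK s (excess (fun n => h n%:Z) g k)).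
apply: rt_trans (reach_sym (reach_chain_a _ _ _ ek)) _.
apply: (rt_trans _ _ _ (s + excess (fun n => h n%:Z) g k, (SBottom, Some 0%N))).
  by apply/rt_step/same_pt_meets; rewrite /pt /= dy0 subrr.
apply: rt_trans (reach_chain_b _ _ g ek) _; apply: rt_trans (reach_tail _ _ Nk) _.
apply: rt_trans (reach_sym (reach_D_bottom _ _)) _; rewrite Ea Eb.
(* The final [+ g] is the change of sheet along the last link, from (1, 0) back to (0, 1). *)
have [<- _] : h (k + N).+2%:Z = g /\ h (- (k + N).+2%:Z) = g by apply: hg; lia.
by apply: (proj1 (reach_D_C _ _)); lia.
Qed.

End reachability.

(** * Parity of the number of exceptional entries *)

Section parity.
Variables (h : int -> 'Z_2) (g : 'Z_2) (K : nat).
Hypotheses (h0 : h 0 = 0)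
  (hg : forall n, (K < n)%N -> h n%:Z = g /\ h (- n%:Z) = g).

(** The integers from [- K] to [K], each once; outside them every entry is [g]. *)
Let window : seq int :=
  [seq n%:Z | n <- iota 0 K.+1] ++ [seq - n.+1%:Z | n <- iota 0 K].

Let mem_window (i : int) : h i = g + 1 -> i \in window.
Proof.
move=> hi; rewrite mem_cat.
have ng : h i <> g by rewrite hi; have [->|->] := Z2_case g.
case: i hi ng => n _ ng; apply/orP.
  left; apply/map_f; rewrite mem_iota add0n /= ltnS leqNgt.
  by apply/negP => /hg[].
right; apply/mapP; exists n; last by [].
rewrite mem_iota add0n /= ltnNge; apply/negP => Kn.
by apply: ng; have [_ <-] := hg (n := n.+1) Kn; rewrite NegzE.
Qed.

Let uniq_window : uniq window.
Proof.
rewrite cat_uniq !map_inj_uniq ?iota_uniq ?andbT //=.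
- by apply/hasPn => _ /mapP[n _ ->]; apply/negP => /mapP[m _].
- by move=> a b; lia.
- by move=> a b [].
Qed.

Let card_seq (T : eqType) (s : seq T) : uniq s -> [set` s] #= `I_(size s).
Proof.
elim: s => [_|x s IH /= /andP[xs us]]; first by rewrite II0 card_eq0 set_nil.
apply/eq_cardSP; exists x; first by rewrite /= inE eqxx.
rewrite (_ : [set` x :: s] `\ x = [set` s]); first exact: IH.
apply/seteqP; split=> [y [/= + yx]|y /= sy].
  by rewrite inE => /orP[/eqP|].
by rewrite inE sy orbT; split=> // yx; rewrite -yx sy in xs.
Qed.

Let Z2_natr n : (n%:R : 'Z_2) = (odd n)%:R.
Proof.
rewrite -{1}(odd_double_half n) natrD -mul2n natrM.
have -> : (2%:R : 'Z_2) = 0 by apply/val_inj.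
by rewrite mul0r addr0.
Qed.

(** In [Z_2] the number of entries other than [g] is the sum of all [h i + g] over the window.
    Positive and negative indices give the two excesses, and the entry [h 0 = 0] gives the final
    [g]. *)
Lemma even_entriesP : even_number_of_entries h (g + 1) <->
  excess (fun n => h n%:Z) g K + excess (fun n => h (- n%:Z)) g K + g = 0.
Proof.
pose P (i : int) := h i == g + 1.
have setE : [set i | h i = g + 1] = [set` seq.filter P window].
  apply/seteqP; split=> i hi.
    change (is_true (i \in seq.filter P window)).
    by rewrite mem_filter /P hi eqxx mem_window.
  have : i \in seq.filter P window by [].
  by rewrite mem_filter => /andP[/eqP].
have cardE := card_seq (filter_uniq P uniq_window).
have sumE : ((size (seq.filter P window))%:R : 'Z_2) =
    excess (fun n => h n%:Z) g K + excess (fun n => h (- n%:Z)) g K + g.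
  have -> : ((size (seq.filter P window))%:R : 'Z_2) = \sum_(i <- window) (h i + g).
    rewrite size_filter; elim: window => [|i l IH]; first by rewrite big_nil.
    rewrite big_cons /= natrD IH; congr (_ + _); rewrite /P.
    by have [->|->] := Z2_case (h i); have [->|->] := Z2_case g; apply/val_inj.
  have iota1 : iota 1 K = [seq j.+1 | j <- iota 0 K] by rewrite -[1%N]addn0 iotaDl.
  rewrite /window big_cat !big_map /= big_cons h0 add0r iota1 big_map.
  rewrite /excess /index_iota subn0; ring.
split=> [[n]|e].
  rewrite setE => en; rewrite -sumE Z2_natr.
  have -> : size (seq.filter P window) = n.*2.
    by apply/card_eq_II; apply: card_eq_trans en; rewrite card_eq_sym.
  by rewrite odd_double.
exists (size (seq.filter P window))./2; rewrite setE.
have ev : ~~ odd (size (seq.filter P window)).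
  by apply/negP => od; move: sumE; rewrite e Z2_natr od.
have -> : (size (seq.filter P window))./2.*2 = size (seq.filter P window).
  by rewrite -[RHS]odd_double_half (negbTE ev).
exact: cardE.
Qed.

End parity.

Lemma bi_eventually_bound h g : bi_eventually_equal h g ->
  exists K, forall n : nat, (K < n)%N -> h n%:Z = g /\ h (- n%:Z) = g.
Proof.
move=> /finite_seqP[s sE]; exists (\max_(i <- s) `|i|%N) => n sn.
have key (i : int) : `|i|%N = n -> h i = g.
  move=> ni; apply: contrapT => /eqP hi.
  have : [set i | h i != g] i by [].
  rewrite sE /= => si; move: sn; rewrite ltnNge -ni.
  by rewrite (big_rem i si) /= leq_maxl.
by split; apply: key; rewrite ?abszN.
Qed.

Lemma bi_eventually_of_bound h g K :
  (forall n : nat, (K < n)%N -> h n%:Z = g /\ h (- n%:Z) = g) ->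
  bi_eventually_equal h g.
Proof.
move=> hg.
have fin (w : seq int) : (forall i, h i != g -> i \in w) -> bi_eventually_equal h g.
  by move=> hw; apply: (@sub_finite_set _ _ [set` w]); [move=> i /hw|exact: finite_seq].
apply: (fin ([seq n%:Z | n <- iota 0 K.+1] ++ [seq - n%:Z | n <- iota 0 K.+1])) => i hi.
rewrite mem_cat.
have iK : (`|i| <= K)%N.
  rewrite leqNgt; apply/negP => Ki; have [e1 e2] := hg _ Ki.
  move/eqP: hi; apply; case: i Ki e1 e2 => n _ e1 e2; first exact: e1.
  by move: e2; rewrite NegzE.
case: i hi iK => n _ nK; apply/orP; [left|right]; apply/mapP.
  by exists n => //; rewrite mem_iota.
by exists n.+1; rewrite ?NegzE // mem_iota.
Qed.

(** * Counting the ends *)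

Section classification.
Variables (R : realType) (h : int -> 'Z_2) (Y : topologicalType)
  (q : 'Z_2 -> R * R -> Y).
Hypotheses (hq : two_sheets h q) (h0 : h 0 = 0) (cY : connected [set: Y]).
Implicit Types (s : 'Z_2) (n N k : nat) (v : vertex).

Let C : vertex := (SLeft, None).
Let D : vertex := (SRight, None).

Definition balanced : Prop :=
  exists g, bi_eventually_equal h g /\ even_number_of_entries h (g + 1).

Lemma reach_other_sheet N : ~ balanced -> reach q N (0, C) (1, C).
Proof.
move=> nb; pose far_index (i : int) := (N.+1 < `|i|)%N.
have fromD i s : far_index i -> reach q N (s, D) (s + h i, C).
  by case: i => n Nn; [have [] := reach_D_C hq s Nn|
    have [_] := reach_D_C hq s Nn; rewrite NegzE].
have [[i [j [fi fj hij]]]|same] :=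
    pselect (exists i j, [/\ far_index i, far_index j & h i <> h j]).
  (* Starting on the sheet [h i], the link with index [i] ends on the sheet 0 and the one with index
     [j] on the sheet 1. *)
  have r1 := fromD i (h i) fi; have r2 := fromD j (h i) fj.
  rewrite Z2_addss in r1; have e : h i + h j = 1.
    by move: hij; have [->|->] := Z2_case (h i); have [->|->] := Z2_case (h j) => // _;
      apply/val_inj.
  by rewrite e in r2; apply: rt_trans (reach_sym r1) r2.
(* Otherwise all far entries are equal to [g], and only the walk around the square remains: it
   changes the sheet because the parity condition fails. *)
pose g := h N.+2%:Z.
have hg n : (N.+1 < n)%N -> h n%:Z = g /\ h (- n%:Z) = g.
  move=> Nn; have key i : far_index i -> h i = g.
    move=> fi; apply: contrapT => hi; apply: same; exists i, N.+2%:Z; split=> //.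
    exact: ltnSn.
  by split; apply: key; rewrite /far_index ?abszN.
have := reach_around hq N 0 hg; rewrite add0r; set t := _ + _ + g.
have [t0|-> //] := Z2_case t.
case: nb; exists g; split; first exact: bi_eventually_of_bound hg.
exact/(even_entriesP h0 hg).
Qed.

Lemma unbalanced_one_end : ~ balanced -> @ends Y #= `I_1.
Proof.
move=> nb; have ne N : ~` core q N !=set0.
  have [z oz cz] := pt_inner C (eps_bounds R N).
  exists (q 0 z); rewrite /core setCK; exists (0, C), z; split=> //.
  by split=> //; exact: open_square_unglued.
apply: (@one_end _ (core q)) => //.
- exact: core_compact hq.
- exact: core_mono hq.
- exact: core_cofinal hq.
move=> N; rewrite /core setCK.
have [z oz cz] := pt_inner C (eps_bounds R N).
have bz : box N C z by split=> //; exact: open_square_unglued.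
have all_ a : reach q N (0, C) a.
  case: a => s v; have [s' r] := reach_corner hq N s v.
  apply: rt_trans (reach_sym r); have [->|->] := Z2_case s'; first exact: rt_refl.
  exact: reach_other_sheet.
apply: (@connectedP_component _ _ (q 0 z)); first by exists (0, C), z.
move=> _ [a [w [_ bw <-]]].
by apply: (reach_component hq (a := (0, C))) (all_ a) _ bz bw.
Qed.

(** * Two ends in the balanced case *)

Section balanced.
Variables (g : 'Z_2) (K : nat).
Hypotheses (hg : forall n, (K < n)%N -> h n%:Z = g /\ h (- n%:Z) = g)
  (even_g : excess (fun n => h n%:Z) g K + excess (fun n => h (- n%:Z)) g K + g = 0).

(** At a limit corner this is the eventual value of [excess], constant from [K] on. *)
Let ex (f : nat -> 'Z_2) (o : option nat) : 'Z_2 :=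
  excess f g (if o is Some k then k else K).

(* The end of the cover near a missing point of the sheet 0. *)
Let col v : 'Z_2 :=
  match v.1 with
  | SLeft => ex (fun n => h n%:Z) v.2 | SRight => ex (fun n => h n%:Z) v.2 + g
  | SBottom => ex (fun n => h (- n%:Z)) v.2 | STop => ex (fun n => h (- n%:Z)) v.2 + g
  end.

Let col_seam v v' t : seam h v v' t -> col v + col v' = t.
Proof.
have Z2 (a b : 'Z_2) : a + (b + g) + g + a = b /\ a + g + (a + (b + g)) = b.
  by have [->|->] := Z2_case a; have [->|->] := Z2_case b;
    have [->|->] := Z2_case g; split; apply/val_inj.
move=> [[|n] [m [m' [// _ [[-> ->]|[-> ->]]
  [[-> -> ->]|[-> -> ->]]]]]]; rewrite /col /ex /= ?excessS.
- exact: (Z2 _ (h n.+1%:Z)).1.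
- exact: (Z2 _ (h (- n.+1%:Z))).1.
- exact: (Z2 _ (h n.+1%:Z)).2.
- exact: (Z2 _ (h (- n.+1%:Z))).2.
Qed.

Let tail N (o : option nat) : bool := if o is Some k then (N <= k)%N else true.

(** If [k < k'] then [dy k] and [dy k'] are at least half of [dy k] apart, which is at least [dy N]
    when [k < N]. *)
Let gap_near N o o' : gap R o < gap R o' + dy N -> gap R o' < gap R o + dy N ->
  o = o' \/ tail N o /\ tail N o'.
Proof.
have key k k' : (k < k')%N -> (dy k : R) < dy k' + dy N -> (N <= k)%N /\ (N <= k')%N.
  move=> kk' lt; have Nk : (N <= k)%N.
    rewrite leqNgt; apply/negP => kN.
    by have := dy_ltn R kk'; have := dy_ltn R kN; lra.
  by split=> //; exact: leq_trans Nk (ltnW kk').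
have key0 k : (dy k : R) < 0 + dy N -> (N <= k)%N.
  move=> lt; rewrite leqNgt; apply/negP => kN.
  by have := dy_ltn R kN; have := dy_gt0 R N; lra.
case: o o' => [k|] [k'|] /= h1 h2.
- have [kk'|kk'|->] := ltngtP k k'; last by left.
    by right; exact: key h1.
  by right; have [] := key _ _ kk' h2.
- by right; split=> //; exact: key0.
- by right; split=> //; exact: key0.
- by left.
Qed.

Let ex_tail N f o : (forall n, (K < n)%N -> f n = g) -> (K <= N)%N -> tail N o ->
  ex f o = excess f g K.
Proof.
case: o => [k|] //= fg KN Nk; apply: excess_eq => //.
exact: leq_trans KN Nk.
Qed.

(** Vertices near a common point are on one side, equal or both in the tail where [excess] is
    constant, or on adjacent sides near a common corner. At (0, 0) and (1, 1) both excesses vanish;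
    at the other two corners [even_g] is needed. *)
Let col_close N z v v' : (K < N)%N -> close (dy N.+1) (pt R v) z ->
  close (dy N.+1) (pt R v') z -> col v = col v'.
Proof.
move=> KN; have d2 := dyS R N; have KN' := ltnW KN.
have dN : 2 * dy N <= 1 :> R by apply: dy_le_half; exact: leq_ltn_trans KN.
have ha n : (K < n)%N -> h n%:Z = g by move=> /hg[].
have hb n : (K < n)%N -> h (- n%:Z) = g by move=> /hg[].
have near0 o : gap R o < dy N -> tail N o.
  move=> lt; have := gap_itv R o => go.
  have [n1 n2] : gap R o < gap R None + dy N /\ gap R None < gap R o + dy N.
    by split=> /=; lra.
  by have [->|[]] := gap_near n1 n2.
have near1 o : 1 - gap R o < dy N -> o = Some 0%N.
  move=> lt; have := gap_itv R o => go; have := dy0 R => dy00.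
  have [n1 n2] : gap R o < gap R (Some 0%N) + dy N /\ gap R (Some 0%N) < gap R o + dy N.
    by split=> /=; lra.
  have [//|[_ /=]] := gap_near n1 n2.
  by rewrite leqn0 => /eqP N0; rewrite N0 in KN.
have ea o : tail N o -> ex (fun n => h n%:Z) o = excess (fun n => h n%:Z) g K.
  exact: ex_tail.
have eb o : tail N o -> ex (fun n => h (- n%:Z)) o = excess (fun n => h (- n%:Z)) g K.
  exact: ex_tail.
(* The two forms of [even_g]: left and top sides agree at (0, 1), right and bottom sides at (1,
   0). *)
have [e1 e2] : excess (fun n => h n%:Z) g K = excess (fun n => h (- n%:Z)) g K + g /\
    excess (fun n => h n%:Z) g K + g = excess (fun n => h (- n%:Z)) g K.
  have Z2 (a b : 'Z_2) : a + b + g = 0 -> a = b + g /\ a + g = b.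
    by have [->|->] := Z2_case a; have [->|->] := Z2_case b;
      have [->|->] := Z2_case g => // _; split; apply/val_inj.
  exact: Z2.
have same f o o' : (forall n, (K < n)%N -> f n = g) ->
    gap R o < gap R o' + dy N -> gap R o' < gap R o + dy N -> ex f o = ex f o'.
  move=> fg n1 n2; have [->//|[t t']] := gap_near n1 n2.
  by rewrite !(ex_tail fg KN').
have far_coords (x e : R) : x < 0 + e -> 1 - e < x -> 4 * e <= 1 -> False.
  by move=> a1 a2 a3; suff : 1 < 1 :> R; [rewrite ltxx|lra].
have e4 : 4 * dy N.+1 <= 1 :> R by lra.
have ex0 f : ex f (Some 0%N) = 0 by rewrite /ex /excess big_geq.
case: v v' => [d o] [d' o'] /and4P[c1 c2 c3 c4] /and4P[c1' c2' c3' c4'].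
rewrite /pt /= in c1 c2 c3 c4 c1' c2' c3' c4'; rewrite /col /=.
case: d c1 c2 c3 c4 => /= c1 c2 c3 c4; case: d' c1' c2' c3' c4' => /= c1' c2' c3' c4'.
- by apply: same => //; lra.
- by case: (far_coords _ _ c2 c1' e4).
- have n1 : 1 - gap R o < dy N by lra.
  have n2 : 1 - gap R o' < dy N by lra.
  by rewrite (near1 o n1) (near1 o' n2) !ex0.
- have n1 : gap R o < dy N by lra.
  have n2 : gap R o' < dy N by lra.
  by rewrite (ea o (near0 o n1)) (eb o' (near0 o' n2)).
- by case: (far_coords _ _ c2' c1 e4).
- by congr (_ + g); apply: same => //; lra.
- have n1 : gap R o < dy N by lra.
  have n2 : gap R o' < dy N by lra.
  by rewrite (ea o (near0 o n1)) (eb o' (near0 o' n2)).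
- have n1 : 1 - gap R o < dy N by lra.
  have n2 : 1 - gap R o' < dy N by lra.
  by rewrite (near1 o n1) (near1 o' n2) !ex0.
- have n1 : 1 - gap R o < dy N by lra.
  have n2 : 1 - gap R o' < dy N by lra.
  by rewrite (near1 o n1) (near1 o' n2) !ex0.
- have n1 : gap R o < dy N by lra.
  have n2 : gap R o' < dy N by lra.
  by rewrite (eb o (near0 o n1)) (ea o' (near0 o' n2)).
- by apply: same => //; lra.
- by case: (far_coords _ _ c4 c3' e4).
- have n1 : gap R o < dy N by lra.
  have n2 : gap R o' < dy N by lra.
  by rewrite (eb o (near0 o n1)) (ea o' (near0 o' n2)).
- have n1 : 1 - gap R o < dy N by lra.
  have n2 : 1 - gap R o' < dy N by lra.
  by rewrite (near1 o n1) (near1 o' n2) !ex0.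
- by case: (far_coords _ _ c4' c3 e4).
- by congr (_ + g); apply: same => //; lra.
Qed.

(** By [col_seam] the sheet and [col] change together across a seam, so their sum is preserved. *)
Let colour (b : bool) : set node := [set a | a.1 + col a.2 = b%:R].

Let colour_sat N b s z : (K < N)%N -> unglued z ->
  boxes q N (colour b) (q s z) ->
  exists2 v, close (dy N.+1) (pt R v) z & colour b (s, v).
Proof.
move=> KN uz [[t v] [z1 [Pa [uz1 cz1] /(q_eq hq _ _ uz1 uz) c]]] /=.
have /andP[e0 e1] := eps_bounds R N.
have [|[st zz]|[w [w' [k [cw cw' -> sm]]]]] := cross_near_seam c cz1; first by lra.
  by exists v; rewrite -?zz // /colour /= -st.
exists w' => //; rewrite /colour /=; have vw := col_close KN cz1 cw.
have kE : col w + col w' = k.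
  by case: sm => /col_seam //; rewrite addrC.
by rewrite -kE addrA Z2_addK -vw.
Qed.

Let colour_meets N b a a' : (K < N)%N -> colour b a -> meets q N a a' ->
  colour b a'.
Proof.
move=> KN Pa [z [w [bz [uw cw] e]]].
have [|v cv] := @colour_sat N b a'.1 w KN uw; first by exists a, z.
by rewrite /colour /= (col_close KN cw cv).
Qed.

Let F (b : bool) N : set Y := boxes q (N + K.+1) (colour b).

Let KN N : (K < N + K.+1)%N. Proof. by rewrite addnS ltnS leq_addl. Qed.

Let corner_colour b : colour b (b%:R + col C, C).
Proof. exact: Z2_addK. Qed.

(** Every node is linked to the corner (0, 1) of some sheet without a change of colour, and the
    colour determines that sheet. *)
Let F_conn b N : connected (F b N).
Proof.
have [z oz cz] := pt_inner C (eps_bounds R (N + K.+1)).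
have bz : box (N + K.+1) C z by split=> //; exact: open_square_unglued.
apply: (@connectedP_component _ _ (q (b%:R + col C) z)).
  by exists (b%:R + col C, C), z; split=> //; exact: corner_colour.
move=> _ [[s v] [w [Pa bw <-]]]; apply: connected_component_sym.
have [s' r] := reach_corner hq (N + K.+1) s v.
have cl a a' := @colour_meets (N + K.+1) b a a' (KN N).
have Pc : colour b (s', C).
  elim: r Pa {bw} => [a a' m Pa|//|a a' a'' _ IH1 _ IH2 /IH1/IH2 //].
  exact: cl m.
have <- : s' = b%:R + col C by rewrite -Pc Z2_addK.
by apply: (reach_component hq cl r Pa bw bz).
Qed.

Let F_nonempty b N : F b N !=set0.
Proof.
have [z oz cz] := pt_inner C (eps_bounds R (N + K.+1)).
exists (q (b%:R + col C) z), (b%:R + col C, C), z.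
by split; [exact: corner_colour|split=> //; exact: open_square_unglued|].
Qed.

Let F_mono b N : F b N.+1 `<=` F b N.
Proof.
move=> _ [a [z [Pa [uz cz] <-]]]; exists a, z; split=> //; split=> //.
by apply: close_le cz; apply: dy_leq.
Qed.

Let F_open b N : open (F b N).
Proof.
apply/(q_open hq) => s z uz /(colour_sat (KN N) uz)[v cv Pv].
have : nbhs z (close (dy (N + K.+1).+1) (pt R v)).
  by apply: open_nbhs_nbhs; split; first exact: open_close.
move=> /nbhs_closeP[r r0 hr]; exists r => // w uw /hr cw.
by exists (s, v), w.
Qed.

Let F_disjoint N : F true N `&` F false N = set0.
Proof.
rewrite -subset0 => y [Ft Ff]; have [s [z [uz yz]]] := q_surj hq y.
rewrite -yz in Ft Ff.
have [v cv Pv] := colour_sat (KN N) uz Ft.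
have [v' cv' Pv'] := colour_sat (KN N) uz Ff.
have := col_close (KN N) cv cv'; move: Pv Pv'; rewrite /colour /= => e1 e2 e3.
by move: e1; rewrite e3 e2.
Qed.

Let F_core N : ~` core q (N + K.+1) = F true N `|` F false N.
Proof.
rewrite /core setCK; apply/seteqP; split=> [y [[s v] [z [_ bz <-]]]|y].
  by have [e|e] := Z2_case (s + col v); [right|left]; exists (s, v), z.
by move=> [[a [z [_ bz <-]]]|[a [z [_ bz <-]]]]; exists a, z.
Qed.

Let L N := core q (N + K.+1).
Let L_compact N : compact (L N). Proof. exact: core_compact hq _. Qed.
Let L_mono N : L N `<=` L N.+1.
Proof. by rewrite /L addSn; exact: core_mono hq _. Qed.
Let L_cofinal A : compact A -> exists N, A `<=` L N.
Proof.
move=> /(core_cofinal hq)[N AN]; exists N; apply: subset_trans AN _.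
by apply: (exhaustion_mono (core_mono hq)); rewrite leq_addr.
Qed.

Lemma balanced_two_ends : @ends Y #= `I_2.
Proof.
exact: (two_ends L_compact L_mono L_cofinal F_mono F_conn F_nonempty F_open
  F_disjoint F_core).
Qed.

Lemma balanced_genus_ends (e : set Y -> set Y) : ends e -> end_of_infinite_genus R e.
Proof.
move=> he A cA.
have [b [N FN]] := two_ends_sub L_compact L_mono L_cofinal F_mono F_conn
  F_nonempty F_open F_disjoint F_core he cA.
apply: (genus_of_handle_sequence hq) => [|M].
  have [e1 _ _] := he; have [y _ ->] := e1 A cA.
  exact: component_connected.
pose E := (N + K.+1).+1; pose k := (maxn M E).+1.
have [Mk Ek] : (M < k)%N /\ (E < k)%N by rewrite !ltnS leq_maxl leq_maxr.
have Kk : (K < k)%N by rewrite /E in Ek; lia.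
have hk : h k%:Z = g by have [] := hg Kk.
have hk1 : h k.+1%:Z = g by have [] := hg (ltnW Kk : K < k.+1)%N.
have hk2 : h k.+2%:Z = g by have [] := hg (leqW (ltnW Kk) : K < k.+2)%N.
(* The right strip of this handle fits in the box of [D], the left strip in the box of [C] on the
   sheet changed by [g]; both nodes have colour [b]. The width is the radius of the boxes. *)
pose H := HandleData k k.+1 k.+2 (b%:R + col D) (dy E : R).
have /andP[d0 d1] := eps_bounds R (N + K.+1).
have CD : col C + g = col D by [].
exists H; split=> //.
  by split; rewrite /= ?hk ?hk1 ?hk2 ?ltnSn //; apply/andP.
move=> y Hy; apply: (FN N) => //; have [t [z [uz yz]]] := q_surj hq y.
have dk := dy_ltn R Ek; have dk2 := dy_gt0 R k.+2.
rewrite -yz in Hy *.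
have [[-> [z1 z2 _]]|[-> [z1 z2 _]]] :=
  handle_pre (ltn0Sn _) (ltnSn k) (ltnSn k.+1) (etrans hk (esym hk2))
    (etrans hk1 (esym hk2)) erefl d0 d1 hq uz Hy.
- exists (b%:R + col D, D), z; split=> //; first exact: Z2_addK.
  by split=> //; rewrite /close /pt /=; rewrite -/E; lra.
- rewrite hk2; exists (b%:R + col D + g, C), z; split=> //=.
    by rewrite /colour /= -CD addrA !Z2_addK.
  by split=> //; rewrite /flip /= in z1 z2; rewrite /close /pt /=; rewrite -/E; lra.
Qed.

End balanced.

Lemma balanced_jacobs_ladder : balanced -> jacobs_ladder R Y.
Proof.
move=> [g [bg eg]]; have [K hK] := bi_eventually_bound bg.
have /(even_entriesP h0 hK) e := eg; split.
- exact: two_sheets_surface hq cY.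
- exact: two_sheets_infinite_genus hq cY.
- exact: balanced_two_ends hK e.
- exact: balanced_genus_ends hK e.
Qed.

Lemma unbalanced_loch_ness : ~ balanced -> loch_ness_monster R Y.
Proof.
move=> nb; split.
- exact: two_sheets_surface hq cY.
- exact: two_sheets_infinite_genus hq cY.
- exact: unbalanced_one_end.
Qed.

End classification.

Theorem corollary8p2 (R : realType) (h : int -> 'Z_2) (hB : calB h)
    (Y : topologicalType) (p : Y -> chamanara R) (Yh : is_cover_of h p) :
  (jacobs_ladder R Y <->
     (bi_eventually_equal h 0 /\ even_number_of_entries h 1) \/
     (bi_eventually_equal h 1 /\ even_number_of_entries h 0)) /\
  (~ ((bi_eventually_equal h 0 /\ even_number_of_entries h 1) \/
      (bi_eventually_equal h 1 /\ even_number_of_entries h 0)) ->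
   loch_ness_monster R Y).
Proof.
have [q hq] := two_sheets_of_cover Yh.
have [phi [_ _ cY _ _]] := Yh; have [h0 _] := hB.
have e10 : 1 + 1 = 0 :> 'Z_2 by apply/val_inj.
have e01 : 0 + 1 = 1 :> 'Z_2 by apply/val_inj.
have -> : ((bi_eventually_equal h 0 /\ even_number_of_entries h 1) \/
    (bi_eventually_equal h 1 /\ even_number_of_entries h 0)) = balanced h.
  apply/propext; split=> [[?|?]|[g]]; first by exists 0; rewrite e01.
    by exists 1; rewrite e10.
  by have [->|->] := Z2_case g; rewrite ?e01 ?e10; [left|right].
have loch := unbalanced_loch_ness hq h0 cY.
split=> //; split; last exact: balanced_jacobs_ladder hq h0 cY.
move=> [_ _ two _]; apply: contrapT => /loch[_ _ one].
have /card_eq_II : `I_1 #= `I_2 by apply: card_eq_trans two; rewrite card_eq_sym.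
by [].
Qed.
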